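(* Let $\Gamma$ be a marked graph of rank $n\ge2$. For $\ell\in\Sigma_\Gamma$ and $\tau\in T_\ell(\Sigma_\Gamma)$ define $$\|(\ell,\tau)\|^L=\sup\left\{\frac{\tau(\alpha)}{\ell(\alpha)}\ \Big|\ \alpha\text{ is a loop in }\Gamma\right\}.$$ Then: (1) If $\tau$ is integrable, then $\|(\ell,\tau)\|^L=\lim_{t\to0^+}\frac{d(\ell,\ell+t\tau)}{t}$. (2) The supremum in the definition is achieved on a candidate loop of $\Gamma$. (3) $\|(\ell,\tau)\|^L$ is continuous on the total tangent space $T(\Sigma_\Gamma)$. (4) $\|(\ell,\tau)\|^L\geq0$ with equality only if $\tau=0$. (5) $\|(\ell,\tau_1+\tau_2)\|^L\leq\|(\ell,\tau_1)\|^L+\|(\ell,\tau_2)\|^L$ for all $\tau_1,\tau_2\in T_\ell(\Sigma_\Gamma)$. (6) If $c>0$ then $\|(\ell,c\tau)\|^L=c\,\|(\ell,\tau)\|^L$.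
   Context: A graph is a finite connected cell complex of dimension 1 with all vertices of valence $>2$. A metric on $\Gamma$ is a function $\ell:E(\Gamma)\to[0,1]$ with $\sum_e\ell(e)=1$ and such that $\bigcup_{\ell(e)=0}e$ is a forest; $\Sigma_\Gamma$ is the space of all metrics on $\Gamma$. The tangent space is $T_\ell(\Sigma_\Gamma)=\{\tau:E(\Gamma)\to\mathbb{R}\mid\sum_e\tau(e)=0\}$; these are naturally identified for different $\ell$, so $T(\Sigma_\Gamma)\cong\Sigma_\Gamma\times\mathbb{R}^{N-1}$, $N$ the number of edges. A vector $\tau\in T_\ell(\Sigma_\Gamma)$ is integrable if $\tau(e)<0$ implies $\ell(e)>0$ for all edges $e$; then $\ell+t\tau\in\Sigma_\Gamma$ for small $t\geq0$. Loops are essential (not null-homotopic). For a loop $\alpha$, $\ell(\alpha)$ (resp. $\tau(\alpha)$) is the sum of $\ell(e)$ (resp. $\tau(e)$) over the edges crossed, with multiplicity, by the immersed loop freely homotopic to $\alpha$. A loop $\alpha$ in $\Gamma$ is a candidate if it is one of: embedded; a figure eight: there are two embedded circles $u,v$ meeting in one point, $\alpha$ crosses each of $u,v$ once and no edges outside $u\cup v$; a barbell: there are two disjoint embedded circles $u,v$ connected by an arc $w$ with interior disjoint from $u$ and $v$, $\alpha$ crosses $u,v$ once, $w$ twice, and no edges outside $u\cup v\cup w$. Fix a marking of $\Gamma$, so that $\ell\in\Sigma_\Gamma$ is identified with a point of Outer space. For $\ell,\ell'\in\Sigma_\Gamma$ the Lipschitz distance is $d(\ell,\ell')=\min_\phi\log\sigma(\phi)$,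 where $\phi$ ranges over maps $\Gamma\to\Gamma$, from $(\Gamma,\ell)$ to $(\Gamma,\ell')$, homotopic to the identity and linear on edges, and $\sigma(\phi)$ is the largest slope of $\phi$; when some edges have length $0$, $(\Gamma,\ell)$ is interpreted as the metric graph obtained by collapsing those edges (and similarly for $\ell'$), the maps being those homotopic to the resulting identification. *)

(* Defs.v *)
From HB Require Import structures.
From mathcomp Require Import all_boot all_order all_algebra.
From mathcomp Require Import all_classical all_reals all_analysis.

Set Implicit Arguments.
Unset Strict Implicit.
Unset Printing Implicit Defensive.

Import Order.TTheory GRing.Theory Num.Theory.
Import numFieldNormedType.Exports.
Local Open Scope classical_set_scope.
Local Open Scope ring_scope.

(** * Finite one-dimensional cell complexes *)

(* Loop edges and multiple edges are allowed.  Each edge carries an arbitrary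
   reference orientation, its attaching map. *)
Record multigraph := Multigraph {
  vertex : finType;
  edge : finType;
  origin : edge -> vertex;
  terminus : edge -> vertex }.

(* [(e, false)] is [e] with its reference orientation, [(e, true)] is [e]
   reversed. *)
Definition dart (G : multigraph) : Type := (edge G * bool)%type.
HB.instance Definition _ (G : multigraph) :=
  Finite.copy (dart G) (edge G * bool)%type.

Section Combinatorics.
Variable G : multigraph.
Implicit Types (d : dart G) (c u v w : seq (dart G)).

Definition dsrc d : vertex G := if d.2 then terminus d.1 else origin d.1.
Definition dtgt d : vertex G := if d.2 then origin d.1 else terminus d.1.
Definition drev d : dart G := (d.1, ~~ d.2).

(* A loop edge contributes 2. *)
Definition valence (x : vertex G) : nat := #|[pred d : dart G | dsrc d == x]|.

Definition adjacency : rel (vertex G) :=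
  [rel x y | [exists d : dart G, (dsrc d == x) && (dtgt d == y)]].

Definition is_graph : Prop :=
  (forall x y, connect adjacency x y) /\ (forall x, (2 < valence x)%N).

Definition rank : nat := (#|edge G|.+1 - #|vertex G|)%N.

Definition follows : rel (dart G) := [rel d d' | dtgt d == dsrc d'].

(* Cyclic edge paths; [cycle] also checks the pair (last dart, first dart). *)
Definition closed_path c : bool := (c != [::]) && cycle follows c.

(* Closed edge paths without backtracking, also at the base point. *)
Definition immersed c : bool :=
  (c != [::]) && cycle [rel d d' | follows d d' && (d' != drev d)] c.

Definition verts c : seq (vertex G) := map dsrc c.
Definition edges c : seq (edge G) := map fst c.

Definition embedded_circle c : bool :=
  [&& closed_path c, uniq (verts c) & uniq (edges c)].

Definition figure_eight c : Prop :=
  exists u v, [/\ c = u ++ v, closed_path c,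
    embedded_circle u && embedded_circle v, uniq (edges (u ++ v)) &
    #|[pred x | (x \in verts u) && (x \in verts v)]| = 1%N].

(* The vertices of [verts w] other than the first one are those in the interior
   of the arc; since [c] is closed, [w] runs from the base vertex of [u] to the
   base vertex of [v]. *)
Definition barbell c : Prop :=
  exists u v w, [/\ c = u ++ w ++ v ++ rev (map drev w), closed_path c,
    embedded_circle u && embedded_circle v, ~~ has (mem (verts u)) (verts v) &
    [&& uniq (verts w), uniq (edges (u ++ w ++ v)) &
        ~~ has (mem (verts u ++ verts v)) (behead (verts w))]].

(* The starting point of the loop is irrelevant. *)
Definition candidate c : Prop :=
  exists k, let c' := rot k c in
    [\/ embedded_circle c', figure_eight c' | barbell c'].

End Combinatorics.

Definition rose (n : nat) : multigraph :=
  @Multigraph unit 'I_n (fun=> tt) (fun=> tt).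

(** * Metric graphs *)

(* [mgraph l] is the metric graph obtained from the intervals [0, l e] by gluing
   their ends: [(e, t)] is the point of [e] at distance [t * l e] from its
   origin, and the topology is that of the path pseudometric [gdist] below.
   Points at distance 0 are not identified at the level of the type.  They are
   the several names of a vertex and, when some edges have length 0, the points
   identified by collapsing these edges.  Continuous maps and homotopies into
   [mgraph l], or out of it, are those of its separated quotient, that is of the
   graph with the edges of length 0 collapsed. *)
Definition mgraph (R : realType) (G : multigraph) (l : edge G -> R) : Type :=
  (edge G * {i01 R})%type.
HB.instance Definition _ (R : realType) (G : multigraph) (l : edge G -> R) :=
  Choice.copy (mgraph l) (edge G * {i01 R})%type.

Section MetricGraph.
Variables (R : realType) (G : multigraph) (l : edge G -> R).
Implicit Types (p q : mgraph l) (x : vertex G) (c : R).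

Definition at_vertex p x : Prop :=
  p.2%:num = 0 /\ origin p.1 = x \/ p.2%:num = 1 /\ terminus p.1 = x.

(* [chain p q c]: there is a path of length [c] from [p] to [q] that is a
   concatenation of segments of edges. *)
Inductive chain : mgraph l -> mgraph l -> R -> Prop :=
| chain_nil p : chain p p 0
| chain_segment (e : edge G) (s t : {i01 R}) q c :
    chain (e, t) q c -> chain (e, s) q (l e * `|s%:num - t%:num| + c)
| chain_vertex p p' x q c :
    at_vertex p x -> at_vertex p' x -> chain p' q c -> chain p q c.

Definition gdist p q : R := inf [set c | chain p q c].

(* When [l] is nonnegative and [G] is connected, this is [gdist p q < eps]. *)
Definition gball p (eps : R) q : Prop := exists2 c, chain p q c & c < eps.

Lemma chain_trans p q r c c' : chain p q c -> chain q r c' -> chain p r (c + c').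
Proof.
elim=> [p0|e s t q0 c0 _ IH|p0 p' x q0 c0 h h' _ IH] H; first by rewrite add0r.
  by rewrite -addrA; apply: chain_segment; exact: IH.
by apply: (chain_vertex h h'); exact: IH.
Qed.

Lemma chain_sym p q c : chain p q c -> chain q p c.
Proof.
elim=> [p0|e s t q0 c0 _ IH|p0 p' x q0 c0 h h' _ IH]; first exact: chain_nil.
  have := chain_trans IH (chain_segment t (chain_nil (e, s))).
  by rewrite addr0 distrC addrC.
by have := chain_trans IH (chain_vertex h' h (chain_nil p0)); rewrite addr0.
Qed.

Let ent := entourage_ gball.

Let nbhs (p : mgraph l) := nbhs_ ent p.

Let nbhsE : nbhs = nbhs_ ent. Proof. by []. Qed.

HB.instance Definition _ := hasNbhs.Build (mgraph l) nbhs.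

Let gball_center p (eps : R) : 0 < eps -> gball p eps p.
Proof. by move=> eps0; exists 0 => //; exact: chain_nil. Qed.

Let gball_sym p q (eps : R) : gball p eps q -> gball q eps p.
Proof. by move=> [c pq ceps]; exists c => //; exact: chain_sym. Qed.

Let gball_triangle p q r (eps eps' : R) :
  gball p eps q -> gball q eps' r -> gball p (eps + eps') r.
Proof.
move=> [c pq ceps] [c' qr ceps']; exists (c + c'); first exact: chain_trans qr.
exact: ltrD.
Qed.

Let entE : ent = entourage_ gball. Proof. by []. Qed.

HB.instance Definition _ := Nbhs_isPseudoMetric.Build R (mgraph l)
  nbhsE gball_center gball_sym gball_triangle entE.

End MetricGraph.

(* The underlying topological space of [G], all edges having length 1. *)
Notation realization R G := (@mgraph R G (fun=> 1)).

Definition collapse (R : realType) (G : multigraph) (l : edge G -> R) :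
  realization R G -> mgraph l := id.

(** * Homotopies *)

Section Homotopy.
Variable R : realType.

Definition homotopic (X Y : topologicalType) (f g : X -> Y) : Prop :=
  exists H : R -> X -> Y,
    [/\ {within [set p : R * X | 0 <= p.1 <= 1],
           continuous (fun p : R * X => H p.1 p.2)},
        H 0 =1 f & H 1 =1 g].

Definition homotopy_equivalence (X Y : topologicalType) (f : X -> Y) : Prop :=
  continuous f /\
  exists g : Y -> X,
    [/\ continuous g, homotopic (g \o f) id & homotopic (f \o g) id].

(* Maps from the circle R/Z. *)
Definition is_loop (X : topologicalType) (a : R -> X) : Prop :=
  continuous a /\ forall t, a (t + 1) = a t.

Definition freely_homotopic (X : topologicalType) (a b : R -> X) : Prop :=
  exists H : R -> R -> X,
    [/\ {within [set p : R * R | 0 <= p.1 <= 1],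
           continuous (fun p : R * R => H p.1 p.2)},
        forall s, 0 <= s <= 1 -> forall t, H s (t + 1) = H s t,
        H 0 =1 a & H 1 =1 b].

Definition essential (X : topologicalType) (a : R -> X) : Prop :=
  is_loop a /\ ~ exists p : X, freely_homotopic a (fun=> p).

Definition marking (n : nat) (G : multigraph)
    (m : realization R (rose n) -> realization R G) : Prop := homotopy_equivalence m.

End Homotopy.

(** * Loops in a graph *)

Section Loops.
Variables (R : realType) (G : multigraph).
Implicit Types (a b : R -> realization R G) (c : seq (dart G)).

Definition dart_point (d : dart G) (s : {i01 R}) : realization R G :=
  (d.1, if d.2 then (1 - s%:num)%:i01 else s).

(* [a] is the loop that crosses the darts of [c] successively, each in time
   [1 / size c]. *)
Definition traverses a c : Prop :=
  is_loop a /\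
  forall (i : 'I_(size c)) (s : {i01 R}), s%:num < 1 ->
    a ((i%:R + s%:num) / (size c)%:R) = dart_point (tnth (in_tuple c) i) s.

(* The immersed loop [c] is freely homotopic to [a]. *)
Definition immersed_representative a c : Prop :=
  immersed c /\ exists2 b, traverses b c & freely_homotopic a b.

Definition candidate_loop a : Prop := exists2 c, candidate c & traverses a c.

(* This is [f(a)] when [c] is the immersed representative of the loop [a]. *)
Definition path_sum (f : edge G -> R) c : R := \sum_(d <- c) f d.1.

End Loops.

(** * Metrics, tangent vectors and the Lipschitz distance *)

Section OuterSpace.
Variables (R : realType) (G : multigraph).
Implicit Types (l tau : edge G -> R) (s : edge G -> R).

(* The edges of length 0 form a forest: they contain no embedded circle. *)
Definition is_metric l : Prop :=
  [/\ forall e, 0 <= l e <= 1, \sum_e l e = 1 &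
      forall c : seq (dart G), embedded_circle c ->
        ~~ all (fun e => l e == 0) (edges c)].

Definition is_tangent tau : Prop := \sum_e tau e = 0.

Definition integrable_vector l tau : Prop := forall e, tau e < 0 -> 0 < l e.

(* [f] is linear with slope [s e] on each edge [e] of positive length: it is
   locally a dilation by the factor [s e].  Hence [f] is constant on [e] or
   crosses edges without backtracking, at constant speed. *)
Definition linear_on_edges l l' (f : mgraph l -> mgraph l') s : Prop :=
  forall e, 0 < l e -> 0 <= s e /\
    exists2 delta : R, 0 < delta & forall t t' : {i01 R},
      `|t%:num - t'%:num| < delta ->
      gdist (f (e, t)) (f (e, t')) = s e * (l e * `|t%:num - t'%:num|).

Definition max_slope l s : R := \big[Num.max/0]_(e | 0 < l e) s e.

(* Slopes of the maps homotopic to the identity of [G], up to the collapses of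
   the edges of length 0 in the source and in the target. *)
Definition lipschitz_constants l l' : set R :=
  [set sigma | exists (f : mgraph l -> mgraph l') s,
    [/\ continuous f, homotopic R (f \o collapse l) (collapse l'),
        linear_on_edges f s & sigma = max_slope l s]].

(* The infimum is a minimum when [l] and [l'] are metrics. *)
Definition lipschitz_distance l l' : R :=
  inf [set ln sigma | sigma in lipschitz_constants l l'].

Definition loop_ratios l tau : set R :=
  [set x | exists (a : R -> realization R G) (c : seq (dart G)),
    [/\ essential a, immersed_representative a c & x = path_sum tau c / path_sum l c]].

(* [||(l, tau)||^L]. *)
Definition norm_L l tau : R := sup (loop_ratios l tau).

End OuterSpace.

(* Main.v *)
Require Import Defs.
From HB Require Import structures.
From mathcomp Require Import all_boot all_order all_algebra.
From mathcomp Require Import all_classical all_reals all_analysis.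
From mathcomp Require Import zify ring lra.

Set Implicit Arguments.
Unset Strict Implicit.
Unset Printing Implicit Defensive.

Import Order.TTheory GRing.Theory Num.Theory.
Import numFieldNormedType.Exports.
Local Open Scope classical_set_scope.
Local Open Scope ring_scope.

(** Fix a metric [l] and a tangent vector [tau], let [lambda] be the norm and
    [f = tau - lambda l].  Every immersed loop [c] satisfies [f(c) <= 0], and
    [f(c) = 0] exactly when the ratio of [c] is [lambda].  All parts of the
    theorem are read off from this function [f].

    Maximising loops.  An immersed loop that runs through a dart twice splits
    there into two shorter immersed loops, and the numerators and denominators of
    their ratios add up.  Hence the ratio is maximised, for all [l] and
    [tau] at once, among the finitely many immersed loops that are no longer than
    the number of darts; the norm is locally a maximum of finitely many
    continuous functions [norm_cts], and subadditive and homogeneous.  Cutting and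
    regluing a maximising loop along an embedded circle that it contains leads to
    a maximising embedded circle or barbell [extremal_candidate]; a figure eight
    splits further into its two circles.

    Potentials.  As [f] is nonpositive on loops, its sums along edge paths without
    backtracking are bounded.  The difference of the suprema for the two
    orientations of an edge, diminished by [f e] and halved, is a function [phi] on
    darts such that
    [phi d + phi (drev d) = - f e] on every edge [e], and [phi d + phi d' >= 0] for
    distinct darts [d], [d'] with the same source [potential_feasible].  All
    valences being at least 3, the total sum of such a [phi] bounds every
    [`|phi d|] [total_sum].  This sum is [- sum f = lambda], so [lambda >= 0], and
    [lambda = 0] forces [phi = 0], [f = 0] and [tau = 0].

    Upper bound for the distance.  Among the functions [phi] with
    [phi d + phi (drev d) <= - f e] and the same condition at the vertices, choose
    one of minimal total sum.  At each vertex it vanishes, or it is [- r] on one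
    dart and [r] on all the others: it prescribes a motion of the vertex by [r]
    into that dart.  Moving all vertices by [t phi] in [l' = l + t tau] makes the
    image of [e] have length
    [l' e + t (phi d + phi (drev d)) <= (1 + t lambda) l e], so the moved graph is
    the image of a map with slopes at most [1 + t lambda] [stretching_map].

    Lower bound.  A map from [l] to [l'] with slopes at most [sigma] that is
    homotopic to the identity satisfies [l'(c) <= sigma l(c)] for embedded circles
    and barbells [c] [candidate_stretch].  It suffices that every loop homotopic
    to [c] crosses each edge [e] at least as often as [c].  Record the motion of
    the coordinate of [e] along a loop as a composition of maps [x -> x + a] and
    [x -> - x] of the line: a homotopy of the loop conjugates this holonomy
    [homotopy_translation], so that a translation keeps its length, and this
    length bounds the crossings from below [translation_le].  For an embedded
    circle no signs are used and the length is a winding number, equal to 1.  A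
    barbell crosses its arc twice in opposite directions; a change of sign at an
    edge of each of its circles, that is passing to a double cover, makes the two
    crossings add up to 2 [barbell_crossing].

    Together, the distance from [l] to [l + t tau] is [ln (1 + t lambda)] for all
    small [t > 0] [distance_short_time].  The holonomy also shows that the
    maximising candidates are essential [loop_essential]. *)

(** * Lists and cyclic sequences *)
Section Lists.
Variables (T : eqType) (e : rel T) (x0 : T).
Implicit Types s : seq T.

Lemma sorted_catE s1 s2 : s1 != [::] -> s2 != [::] ->
  sorted e (s1 ++ s2) =
  [&& sorted e s1, e (last x0 s1) (head x0 s2) & sorted e s2].
Proof. by case: s1 s2 => [|x s1] [|y s2] //= _ _; rewrite cat_path. Qed.

Lemma cycleE s : s != [::] ->
  cycle e s = sorted e s && e (last x0 s) (head x0 s).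
Proof. by case: s => [|x s] //= _; rewrite rcons_path. Qed.

Lemma last_cat_ne s1 s2 : s2 != [::] -> last x0 (s1 ++ s2) = last x0 s2.
Proof. by rewrite last_cat; case: s2. Qed.

Lemma head_cat_ne s1 s2 : s1 != [::] -> head x0 (s1 ++ s2) = head x0 s1.
Proof. by case: s1. Qed.

Lemma head_mem s : s != [::] -> head x0 s \in s.
Proof. by case: s => //= a s _; exact: mem_head. Qed.

Lemma last_mem_ne s : s != [::] -> last x0 s \in s.
Proof. by case: s => //= a s _; exact: mem_last. Qed.

Lemma cat_ne s1 s2 : (s1 ++ s2 == [::]) = (s1 == [::]) && (s2 == [::]).
Proof. by case: s1. Qed.

Lemma sorted_cat_l s1 s2 : sorted e (s1 ++ s2) -> sorted e s1.
Proof. by move=> /cat_sorted2[]. Qed.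

Lemma sorted_cat_r s1 s2 : sorted e (s1 ++ s2) -> sorted e s2.
Proof. by move=> /cat_sorted2[]. Qed.

Lemma cycle_catE s1 s2 : s1 != [::] -> s2 != [::] ->
  cycle e (s1 ++ s2) =
  [&& sorted e s1, e (last x0 s1) (head x0 s2), sorted e s2 &
      e (last x0 s2) (head x0 s1)].
Proof.
move=> h1 h2; rewrite cycleE ?cat_ne ?(negPf h1) // sorted_catE // last_cat_ne //.
by rewrite head_cat_ne // -!andbA.
Qed.

Lemma cycle_catC s1 s2 : cycle e (s1 ++ s2) = cycle e (s2 ++ s1).
Proof. by rewrite -rot_size_cat rot_cycle. Qed.

Lemma nuniq_split s : ~~ uniq s ->
  exists x s1 s2 s3, s = s1 ++ (x :: s2) ++ (x :: s3).
Proof.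
elim: s => //= a s IH; rewrite negb_and negbK => /orP[/path.splitPr[p1 p2]|/IH].
  by exists a, [::], p1, p2.
by move=> [x [s1 [s2 [s3 ->]]]]; exists x, (a :: s1), s2, s3.
Qed.

Lemma uniq_cat_neq s1 s2 x y : uniq (s1 ++ s2) -> x \in s1 -> y \in s2 -> x != y.
Proof.
rewrite cat_uniq => /and3P[_ /hasPn h _] xs ys; apply: contraNneq (h y ys) => <-.
exact: xs.
Qed.

End Lists.

(** * Edge paths without backtracking *)
Section Paths.
Variable G : multigraph.
Implicit Types (d : dart G) (c p s u v w : seq (dart G)).

Definition nonback : rel (dart G) := [rel d d' | follows d d' && (d' != drev d)].

Definition revp p : seq (dart G) := rev (map (@drev G) p).

Lemma immersedE c : immersed c = (c != [::]) && cycle nonback c.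
Proof. by []. Qed.

Lemma drevK : involutive (@drev G).
Proof. by case=> e b; rewrite /drev /= negbK. Qed.

Lemma dsrc_drev d : dsrc (drev d) = dtgt d.
Proof. by case: d => e []. Qed.

Lemma dtgt_drev d : dtgt (drev d) = dsrc d.
Proof. by case: d => e []. Qed.

Lemma drev_neq d : drev d != d.
Proof. by case: d => e []; rewrite /drev xpair_eqE eqxx. Qed.

Lemma same_edge d d' : d.1 = d'.1 -> d' = d \/ d' = drev d.
Proof.
by case: d d' => e b [e' b'] /= ->; case: b b' => [] []; [left|right|right|left].
Qed.

Lemma nonback_rev d d' : nonback (drev d') (drev d) = nonback d d'.
Proof.
rewrite /nonback /= /follows /= dtgt_drev dsrc_drev drevK eq_sym; congr (_ && _).
by rewrite eq_sym.
Qed.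

Lemma nonbackE d d' : nonback d d' = (dtgt d == dsrc d') && (d' != drev d).
Proof. by []. Qed.

Lemma nonback_in d d' : nonback d (drev d') = (dtgt d == dtgt d') && (d != d').
Proof. by rewrite nonbackE dsrc_drev (inj_eq (can_inj drevK)) (eq_sym d'). Qed.

Lemma nonback_out d d' : nonback (drev d) d' = (dsrc d == dsrc d') && (d != d').
Proof. by rewrite nonbackE dtgt_drev drevK (eq_sym d'). Qed.

Lemma revp_cat p s : revp (p ++ s) = revp s ++ revp p.
Proof. by rewrite /revp map_cat rev_cat. Qed.

Lemma revpK : involutive revp.
Proof. by move=> p; rewrite /revp map_rev revK mapK //; exact: drevK. Qed.

Lemma revp_ne p : (revp p == [::]) = (p == [::]).
Proof. by rewrite -!size_eq0 /revp size_rev size_map. Qed.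

Lemma mem_revp p d : (d \in revp p) = (drev d \in p).
Proof.
rewrite /revp mem_rev; apply/mapP/idP => [[x xp ->]|h]; first by rewrite drevK.
by exists (drev d) => //; rewrite drevK.
Qed.

Lemma last_revp x0 p : p != [::] -> last x0 (revp p) = drev (head x0 p).
Proof. by case: p => //= d p _; rewrite /revp /= rev_cons last_rcons. Qed.

Lemma head_revp x0 p : p != [::] -> head x0 (revp p) = drev (last x0 p).
Proof.
move=> h; rewrite -{2}(revpK p) last_revp ?revp_ne // drevK.
by [].
Qed.

Lemma sorted_revp p : sorted nonback (revp p) = sorted nonback p.
Proof.
rewrite /revp rev_sorted sorted_map; apply: eq_sorted => d d' /=.
exact: nonback_rev.
Qed.

Lemma nonback_follows p : sorted nonback p -> sorted (@follows G) p.
Proof. by apply: sub_sorted => d d' /= /andP[]. Qed.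

Lemma edgesP c e : reflect (exists2 d, d \in c & e = d.1) (e \in edges c).
Proof. exact: (iffP (@mapP (dart G) _ fst c e)). Qed.

Lemma edges_revp p : edges (revp p) = rev (edges p).
Proof. by rewrite /edges /revp map_rev -map_comp; congr rev; apply: eq_map. Qed.

(** The vertices of a path can be listed by the sources or by the targets of its
    darts; comparing the lists relates the vertices of a path and of its
    reverse. *)
Lemma targets_sources x0 p : p != [::] -> sorted (@follows G) p ->
  map (@dtgt G) p = rcons (behead (verts p)) (dtgt (last x0 p)).
Proof.
elim: p => //= d [|d' p] IH //= _ /andP[/eqP dd' h].
by have := IH isT h; rewrite /= => ->; rewrite dd'.
Qed.

Lemma verts_revp x0 p : p != [::] -> sorted (@follows G) p ->
  verts (revp p) = dtgt (last x0 p) :: rev (behead (verts p)).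
Proof.
move=> p0 h; rewrite /verts /revp map_rev -map_comp.
rewrite (eq_map (g := @dtgt G)); last by move=> d; rewrite /= dsrc_drev.
by rewrite (targets_sources x0) // rev_rcons.
Qed.

(** An edge crossed twice is crossed in the same direction, repeating its source,
    or in opposite directions; in the latter case the crossings are not
    consecutive, and the target of the first one is repeated. *)
Lemma uniq_edges_of_verts p :
  sorted nonback p -> uniq (verts p) -> uniq (edges p).
Proof.
elim: p => //= d p IH; case: p IH => [|d1 p] IH //= /andP[/andP[/eqP f1 f2] h].
rewrite -/(verts (d1 :: p)) -/(edges (d1 :: p)) => /andP[nd uv].
apply/andP; split; last exact: IH.
apply/negP => /(edgesP (d1 :: p))[/= d' d'p] /same_edge[] E.
  by move/negP: nd; apply; rewrite -E; exact: (map_f (@dsrc G) d'p).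
move: d'p; rewrite inE => /orP[/eqP d'1|d'p].
  by rewrite -d'1 E eqxx in f2.
move: uv => /= /andP[/negP + _]; apply.
by rewrite -f1 -dsrc_drev -E; apply: map_f.
Qed.

(** The piece [w] of [p] is cut off at its first return to [vis] or to itself.  If
    [p] starts on [vis], it is an arc that either connects two points of [vis] or
    ends in a circle disjoint from it. *)
Lemma first_hit x0 p (vis : seq (vertex G)) :
  p != [::] -> sorted (@follows G) p -> dtgt (last x0 p) \in vis ++ verts p ->
  exists w b, [/\ p = w ++ b, w != [::], uniq (verts w),
    ~~ has (mem vis) (behead (verts w)) & dtgt (last x0 w) \in vis ++ verts w].
Proof.
elim: p vis => //= d p IH vis _ h hl.
have [hd|hd] := boolP (dtgt d \in vis ++ [:: dsrc d]).
  by exists [:: d], p.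
case: p IH h hl => [|d' p] IH /= h hl; first by rewrite (negPf hd) in hl.
move/andP: h => [/eqP dd' h].
have [] := IH (dsrc d :: vis) isT h.
  move: hl; rewrite !mem_cat !inE /=.
  by case/or4P => ->; rewrite ?orbT.
move=> w [b [E w0 uw hw lw]]; exists (d :: w), b; split => //=.
- by rewrite E.
- rewrite uw andbT; case: w w0 E uw hw {lw} => //= a w _ [<- _] uw.
  rewrite inE negb_or -dd' eq_sym; move: hd.
  rewrite mem_cat inE negb_or => /andP[_ ->] /=.
  by apply: contra => h1; apply/hasP; exists (dsrc d) => //; rewrite !inE eqxx.
- case: w w0 E uw hw {lw} => //= a w _ [<- _] uw.
  move: hd; rewrite mem_cat negb_or dd' => /andP[/negPf h1 _] hw.
  rewrite h1 /=; apply: contra hw => /hasP[y y1 y2]; apply/hasP; exists y => //.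
  by rewrite /= inE; apply/orP; right.
- case: w w0 {E uw hw} lw => //= a w _.
  by rewrite !mem_cat !inE mem_cat !inE; case/or4P => [->|->|->|->]; rewrite ?orbT.
Qed.

(** When a simple path ends at one of its own vertices, its part after that vertex
    is a circle. *)
Lemma close_circle x0 w : w != [::] -> sorted nonback w -> uniq (verts w) ->
  dtgt (last x0 w) \in verts w ->
  exists w1 v, [/\ w = w1 ++ v, embedded_circle v, v != [::] &
    dsrc (head x0 v) = dtgt (last x0 w)].
Proof.
move=> w0 + + /mapP[d dw E]; move: E; case/splitPr: dw => w1 v' E sw uw.
exists w1, (d :: v'); split => //.
have sv : sorted nonback (d :: v') by move: sw; exact: sorted_cat_r.
have uv : uniq (verts (d :: v')).
  by move: uw; rewrite /verts map_cat cat_uniq => /and3P[].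
apply/and3P; split => //; last exact: uniq_edges_of_verts.
apply/andP; split => //; rewrite (cycleE _ x0) //=.
apply/andP; split; [exact: (nonback_follows sv)|apply/eqP].
by rewrite -E last_cat /=.
Qed.

Lemma closed_has_circle x0 p : p != [::] -> sorted nonback p ->
  dtgt (last x0 p) \in verts p ->
  exists w v b, [/\ p = w ++ v ++ b, embedded_circle v & v != [::]].
Proof.
move=> p0 sp hl.
have [w [b [E w0 uw _ lw]]] := @first_hit x0 p [::] p0 (nonback_follows sp) hl.
rewrite E in sp.
have [w1 [v [E' ev v0 _]]] := close_circle w0 (sorted_cat_l sp) uw lw.
by exists w1, v, b; split => //; rewrite catA -E'.
Qed.

Lemma immersed_closed c : immersed c -> closed_path c.
Proof.
move=> /andP[c0 h]; apply/andP; split => //; apply: sub_cycle h => d d' /= /andP[] //.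
Qed.

(** Only the passage through the base point has to be checked: backtracking there
    would repeat an edge. *)
Lemma embedded_immersed c :
  sorted nonback c -> embedded_circle c -> immersed c.
Proof.
move=> sc /and3P[/andP[c0 cc] uv ue].
have [x0 _] : exists x0 : dart G, true by case: c c0 {sc cc uv ue} => // d c _; exists d.
rewrite immersedE c0 /= (cycleE _ x0) // sc /=.
move: cc; rewrite (cycleE _ x0) // /nonback /= => /andP[_ ->] /=.
case: c c0 ue {uv sc} => //= d [|d' c] _ /=.
  by move=> _; rewrite eq_sym drev_neq.
move=> /andP[h _]; apply: contra h => /eqP ->.
by apply/(edgesP (d' :: c)); exists (last d' c) => //; exact: mem_last.
Qed.

Lemma immersed_has_circle c : immersed c ->
  exists w v b, c = w ++ v ++ b /\ embedded_circle v.
Proof.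
case: c => // d c /andP[c0]; rewrite (cycleE _ d) // => /andP[sc /= /andP[/eqP h _]].
have [|w [v [b [E ev _]]]] := @closed_has_circle d (d :: c) c0 sc; last by exists w, v, b.
by rewrite /= h inE eqxx.
Qed.

(** Both pieces pass from their last dart to [d] as the whole loop does. *)
Lemma immersed_cut d s1 s2 s3 : immersed (s1 ++ (d :: s2) ++ d :: s3) ->
  immersed (d :: s2) /\ immersed (d :: s3 ++ s1).
Proof.
rewrite immersedE => /andP[_]; rewrite cycle_catC -catA (cycle_catE _ d) //=.
by move=> /and4P[h1 h2 h3 h4]; rewrite !immersedE !(cycleE _ d) //= h1 h3.
Qed.

End Paths.

(** * Extremal loops *)
Section Extremal.
Variables (R : realType) (G : multigraph).
Implicit Types (d : dart G) (c p s u v w : seq (dart G)) (f : edge G -> R).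

Lemma path_sum_cat f p s : path_sum f (p ++ s) = path_sum f p + path_sum f s.
Proof. by rewrite /path_sum big_cat. Qed.

Lemma path_sum_cons f d s : path_sum f (d :: s) = f d.1 + path_sum f s.
Proof. by rewrite /path_sum big_cons. Qed.

Lemma path_sum_nil f : path_sum f [::] = 0.
Proof. by rewrite /path_sum big_nil. Qed.

Lemma path_sum_revp f p : path_sum f (revp p) = path_sum f p.
Proof.
rewrite /path_sum /revp -map_rev big_map /=; apply: perm_big.
by rewrite perm_rev.
Qed.

Lemma sum_eq0_l (x y : R) : x <= 0 -> y <= 0 -> x + y = 0 -> x = 0.
Proof. by move=> *; lra. Qed.

(** Induction on the length of [c].  Whenever immersed loops [a] and [b] use the
    same darts as [c], up to orientation and with equal multiplicities,
    [f a + f b = f c = 0] forces [f a = f b = 0]; the same holds if they use them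
    twice as often.  A loop that repeats a dart is cut there.  Otherwise write
    [c = u ++ b] with [u] an embedded circle.  If [b] is immersed, [u] and [b] are
    the two loops.  If not, [b] starts by some [d] and ends by [drev d]; let [w0]
    be its piece up to its first return to [u] or to itself.  If [w0] returns to
    [u], it forms an embedded circle with an arc of [u], and the other arc with the
    rest of [b] forms a loop.  If [w0] ends in a circle [v], there is a
    barbell with circles [u] and [v], and a second loop that joins [u] to [v] along
    the rest of [b]. *)
Lemma extremal_candidate f :
  (forall c, immersed c -> path_sum f c <= 0) ->
  forall c, immersed c -> path_sum f c = 0 ->
  exists a, [/\ immersed a, path_sum f a = 0 & embedded_circle a \/ barbell a].
Proof.
move=> f_le0 c; elim: {c}(size c).+1 {-2}c (ltnSn (size c)) => // n IH c cn ic fc.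
have [uc|/nuniq_split[d [s1 [s2 [s3 E]]]]] := boolP (uniq c); last first.
  move: ic fc; rewrite E => /immersed_cut[i1 i2].
  rewrite !(path_sum_cat, path_sum_cons) => fc.
  apply: (IH (d :: s2)) => //.
    by move: cn; rewrite E !size_cat /= !ltnS; lia.
  apply: (sum_eq0_l (f_le0 _ i1) (f_le0 _ i2)).
  by rewrite !(path_sum_cons, path_sum_cat); lra.
have [x0 _] : exists x0 : dart G, true by case: c ic {uc fc cn} => // d c _; exists d.
have [w [u [b [Ec eu u0]]]] : exists w u b,
    [/\ c = w ++ u ++ b, embedded_circle u & u != [::]].
  have [c0 cc] := andP ic; move: cc; rewrite (cycleE _ x0) // => /andP[sc /andP[/eqP h _]].
  apply: (@closed_has_circle G x0 c) => //.
  by rewrite h; apply: map_f; exact: head_mem.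
have {w b Ec ic uc fc cn} [b [ic uc fc]] : exists b,
    [/\ immersed (u ++ b), uniq (u ++ b) & path_sum f (u ++ b) = 0].
  exists (b ++ w); move: ic uc fc; rewrite Ec !immersedE !cat_ne (negPf u0) /= andbF /=.
  rewrite cycle_catC -catA => ->; rewrite uniq_catC -catA => ->.
  by rewrite !path_sum_cat => <-; split => //; ring.
have [b0|b0] := eqVneq b [::].
  move: ic fc; rewrite b0 cats0 => iu fu; exists u; split => //; by left.
move: (ic); rewrite immersedE (cycle_catE _ x0) // => /andP[_ /and4P[su hub sb hbu]].
have iu := embedded_immersed su eu.
have clu : dtgt (last x0 u) = dsrc (head x0 u).
  by move: eu => /and3P[/andP[_]]; rewrite (cycleE _ x0) // => /andP[_ /eqP].
have clb : dtgt (last x0 b) = dsrc (head x0 b).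
  by move: hub hbu => /andP[/eqP <- _] /andP[/eqP -> _].
have [ib|ib] := boolP (nonback (last x0 b) (head x0 b)).
  have {}ib : immersed b by rewrite immersedE b0 /= (cycleE _ x0) // sb.
  exists u; split; [by []| |by left].
  by move: fc; rewrite path_sum_cat; apply: sum_eq0_l; exact: f_le0.
have {ib} hlb : head x0 b = drev (last x0 b).
  by apply/eqP; move: ib; rewrite nonbackE clb eqxx /= negbK.
have uvu : uniq (verts u) by have /and3P[] := eu.
have xu : dsrc (head x0 b) \in verts u.
  by move: hub => /andP[/eqP <- _]; rewrite clu; apply: map_f; exact: head_mem.
have [|w0 [b2 [E w00 uw0 dw0 zw0]]] :=
    @first_hit G x0 b (verts u) b0 (nonback_follows sb).
  by rewrite clb mem_cat xu.
have sw0 : sorted (@nonback G) w0 by move: sb; rewrite E; exact: sorted_cat_l.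
have b20 : b2 != [::].
  apply/eqP => b2E; move: E; rewrite b2E cats0 => E.
  have := uniq_edges_of_verts sw0 uw0; rewrite -E.
  case: b {clb hub hbu sb E xu ic uc fc} b0 hlb => //= d1 b' _; case: b' => [|d2 b'] /=.
    by move/eqP; rewrite eq_sym (negPf (drev_neq d1)).
  move=> -> /andP[/negP h _]; apply: h.
  by apply/(edgesP (d2 :: b')); exists (last d2 b') => //; exact: mem_last.
have hw0 : head x0 b = head x0 w0 by rewrite E head_cat_ne.
have lb2 : last x0 b = last x0 b2 by rewrite E last_cat_ne.
have sb2 : sorted (@nonback G) b2 by move: sb; rewrite E; exact: sorted_cat_r.
have jw0 : nonback (last x0 w0) (head x0 b2).
  by move: sb; rewrite E (sorted_catE _ x0) // => /and3P[].
have uwb : uniq (w0 ++ b2) by move: uc; rewrite E cat_uniq => /and3P[].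
have uuw : forall d d', d \in u -> d' \in w0 -> d != d'.
  move=> d d' h1 h2; apply: (uniq_cat_neq uc h1); by rewrite E mem_cat h2.
have uub : forall d d', d \in u -> d' \in b2 -> d != d'.
  move=> d d' h1 h2; apply: (uniq_cat_neq uc h1); by rewrite E mem_cat h2 orbT.
have hh : dsrc (head x0 w0) = dsrc (head x0 u).
  by rewrite -hw0 -clb; move/andP: hbu => [/eqP -> _].
have hlb2 : dtgt (last x0 b2) = dsrc (head x0 u) by rewrite -lb2 clb hw0.
have jz : dtgt (last x0 w0) = dsrc (head x0 b2) by move: jw0 => /andP[/eqP].
have lw0m := last_mem_ne x0 w00; have hw0m := head_mem x0 w00.
have lb2m := last_mem_ne x0 b20; have hb2m := head_mem x0 b20.
have [zu|zu] := boolP (dtgt (last x0 w0) \in verts u).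
  have [g gu zE] : exists2 g, g \in u & dtgt (last x0 w0) = dsrc g.
    by move/mapP: zu => [g gu ->]; exists g.
  have [u1 [u2 uE]] : exists u1 u2, u = u1 ++ g :: u2.
    by case/splitPr: gu => p1 p2; exists p1, p2.
  set v2 := g :: u2 in uE.
  have v20 : v2 != [::] by [].
  have su1 : sorted (@nonback G) u1 by move: su; rewrite uE; exact: sorted_cat_l.
  have sv2 : sorted (@nonback G) v2 by move: su; rewrite uE; exact: sorted_cat_r.
  have lv2 : last x0 u = last x0 v2 by rewrite uE last_cat_ne.
  have ia : immersed (u1 ++ revp w0).
    rewrite immersedE cat_ne revp_ne (negPf w00) andbF /=.
    have [u10|u10] := eqVneq u1 [::].
      rewrite u10 /= (cycleE _ x0) ?revp_ne // sorted_revp sw0 last_revp // head_revp //.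
      rewrite nonback_rev nonbackE zE hh uE u10 /= eqxx /=.
      apply: contraTneq uwb => h; have : last x0 w0 = last x0 b2.
        by rewrite -lb2 -(drevK (last x0 b)) -hlb hw0 h drevK.
      move=> h'; rewrite cat_uniq; apply/and3P => -[_ /hasPn/(_ _ lb2m) /negP + _].
      by apply; rewrite -h'.
    have hu1 : head x0 u = head x0 u1 by rewrite uE head_cat_ne.
    rewrite (cycle_catE _ x0) ?revp_ne // su1 sorted_revp sw0 /=.
    rewrite head_revp // last_revp // nonback_in nonback_out hh hu1 eqxx /= zE.
    move: su; rewrite uE (sorted_catE _ x0) // => /and3P[_ /andP[h _] _].
    have -> : dtgt (last x0 u1) == dsrc g by move: h; rewrite /follows.
    rewrite uuw ?lw0m //=; last by rewrite uE mem_cat last_mem_ne.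
    by rewrite eq_sym uuw // uE mem_cat head_mem.
  have ib : immersed (revp v2 ++ b2).
    rewrite immersedE cat_ne (negPf b20) andbF /= (cycle_catE _ x0) ?revp_ne //.
    rewrite sorted_revp sv2 sb2 last_revp // head_revp // nonback_out nonback_in.
    rewrite -jz zE eqxx hlb2 -clu lv2 eqxx /= uub //=.
    rewrite eq_sym uub // uE mem_cat; apply/orP; right.
    exact: (last_mem_ne x0 v20).
  exists (u1 ++ revp w0); split => //.
    apply: (sum_eq0_l (f_le0 _ ia) (f_le0 _ ib)); move: fc.
    by rewrite E uE !path_sum_cat !path_sum_revp => <-; ring.
  left; apply/and3P.
  have uva : uniq (verts (u1 ++ revp w0)).
    rewrite /verts map_cat -!/(verts _) (verts_revp x0 w00 (nonback_follows sw0)).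
    move: uvu; rewrite uE /verts map_cat -!/(verts _) !cat_uniq => /and3P[-> hu _] /=.
    rewrite rev_uniq mem_rev has_rev.
    have -> : uniq (behead (verts w0)) by move: uw0; case: (verts w0) => //= a q /andP[].
    have /hasPn dw := dw0.
    rewrite andbT; apply/andP; split.
      rewrite negb_or; apply/andP; split.
        by move: hu => /hasPn/(_ (dsrc g)); rewrite zE; apply; rewrite inE eqxx.
      apply/hasPn => y /dw /=; apply: contra; rewrite uE /verts map_cat mem_cat => ->.
      by [].
    by apply/negP => /dw /=; rewrite zu.
  split => //; first exact: immersed_closed.
  apply: uniq_edges_of_verts => //; move/andP: ia => [a0]; rewrite (cycleE _ x0) //.
  by case/andP.
have zw : dtgt (last x0 w0) \in verts w0 by move: zw0; rewrite mem_cat (negPf zu).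
have [w [v [wE ev v0 hv]]] := close_circle w00 sw0 uw0 zw.
have w_0 : w != [::].
  apply: contraNneq zu => w_0; rewrite -hv.
  have -> : head x0 v = head x0 w0 by rewrite wE w_0.
  by rewrite hh; apply: map_f; exact: head_mem.
have sw : sorted (@nonback G) w by move: sw0; rewrite wE; exact: sorted_cat_l.
have sv : sorted (@nonback G) v by move: sw0; rewrite wE; exact: sorted_cat_r.
have hw : head x0 w0 = head x0 w by rewrite wE head_cat_ne.
have lv : last x0 w0 = last x0 v by rewrite wE last_cat_ne.
have jwv : nonback (last x0 w) (head x0 v).
  by move: sw0; rewrite wE (sorted_catE _ x0) // => /and3P[].
have vm d : d \in v -> d \in w0 by rewrite wE mem_cat orbC => ->.
have wm d : d \in w -> d \in w0 by rewrite wE mem_cat => ->.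
have lvm := last_mem_ne x0 v0; have hvm := head_mem x0 v0.
have lwm := last_mem_ne x0 w_0; have hwm := head_mem x0 w_0.
have lum := last_mem_ne x0 u0; have hum := head_mem x0 u0.
have jvw : dtgt (last x0 v) = dtgt (last x0 w).
  by rewrite -lv -hv; move/andP: jwv => [/eqP ->].
have uw0' : uniq w0 by move: uwb; rewrite cat_uniq => /and3P[].
have ia : immersed (u ++ w ++ v ++ revp w).
  rewrite immersedE cat_ne (negPf u0) /= (cycle_catE _ x0) ?cat_ne ?(negPf w_0) //.
  rewrite su head_cat_ne // -hw -hw0 hub /= !last_cat_ne ?cat_ne ?revp_ne ?(negPf w_0) ?andbF //.
  rewrite last_revp // nonback_out -hw -hh eqxx eq_sym uuw // andbT.
  rewrite (sorted_catE _ x0) ?cat_ne ?(negPf v0) // sw head_cat_ne // jwv /=.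
  rewrite (sorted_catE _ x0) ?revp_ne // sv sorted_revp sw head_revp // nonback_in jvw eqxx /=.
  by rewrite !andbT eq_sym; apply: (@uniq_cat_neq _ w v) => //; rewrite -wE.
have ib : immersed (u ++ revp b2 ++ v ++ b2).
  rewrite immersedE cat_ne (negPf u0) /=.
  rewrite (cycle_catE _ x0) ?cat_ne ?revp_ne ?(negPf b20) //.
  rewrite su head_cat_ne ?revp_ne // head_revp // nonback_in clu hlb2 eqxx uub //=.
  rewrite !last_cat_ne ?cat_ne ?revp_ne ?(negPf v0) ?(negPf b20) // -lb2 hbu andbT.
  rewrite (sorted_catE _ x0) ?revp_ne ?cat_ne ?(negPf v0) // sorted_revp sb2 head_cat_ne //.
  rewrite last_revp // nonback_out -jz hv eqxx /= (sorted_catE _ x0) // sv sb2 -lv jw0 !andbT /=.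
  by rewrite eq_sym; apply: (uniq_cat_neq uwb) => //; exact: vm.
exists (u ++ w ++ v ++ revp w); split => //.
  apply: (sum_eq0_l (f_le0 _ ia) (f_le0 _ ib)); move: fc.
  rewrite E wE !path_sum_cat !path_sum_revp => fc.
  have -> : forall x y z t : R, x + (y + (z + y)) + (x + (t + (z + t))) =
     2 * (x + (y + z + t)) by move=> *; ring.
  by rewrite fc mulr0.
right; exists u, v, w; split => //; first exact: immersed_closed.
- by rewrite eu ev.
- apply/hasPn => y; rewrite /= => yv; have /hasPn := dw0; apply.
  rewrite wE /verts map_cat; case: (w) w_0 => //= a q _.
  by rewrite mem_cat; apply/orP; right.
have uew : uniq (edges w0) by exact: uniq_edges_of_verts.
apply/and3P; split.
- by move: uw0; rewrite wE /verts map_cat cat_uniq => /and3P[].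
- rewrite -wE /edges map_cat cat_uniq uew andbT.
  have -> : uniq (map fst u) by have /and3P[] := eu.
  apply/hasPn => e /(edgesP w0)[d dw ->]; apply/negP => /(edgesP u)[d' du ee].
  have tu q : q \in u -> dtgt q \in verts u.
    move=> qu; have : dtgt q \in map (@dtgt G) u by exact: map_f.
    rewrite (targets_sources x0 u0 (nonback_follows su)) mem_rcons inE clu.
    case/orP => [/eqP ->|]; first by apply: map_f.
    by case: (verts u) => //= a q' h; rewrite inE h orbT.
  have [dd|dd] := same_edge ee; first by move: (uuw _ _ du dw); rewrite dd eqxx.
  have h1 : dsrc d \in verts u by rewrite -dtgt_drev -dd; exact: tu.
  have h2 : dtgt d \in verts u.
    by rewrite -dsrc_drev -dd; exact: map_f.
  have : dtgt d \in map (@dtgt G) w0 by exact: map_f.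
  rewrite (targets_sources x0 w00 (nonback_follows sw0)) mem_rcons inE.
  case/orP => [/eqP h|]; first by move: zu; rewrite -h h2.
  by have /hasPn := dw0 => /[apply] /=; rewrite h2.
- apply/hasPn => y yw /=; rewrite mem_cat negb_or; apply/andP; split.
    have /hasPn := dw0; apply; rewrite wE /verts map_cat.
    by case: (w) w_0 yw => //= a q _; rewrite mem_cat => ->.
  move: uw0; rewrite wE /verts map_cat cat_uniq => /and3P[_ /hasPn h _].
  apply/negP => /h /negP; apply; move: yw; case: (w) => //= a q yq.
  by rewrite inE yq orbT.
Qed.

End Extremal.

(** * Coordinates along an edge *)
Section CircleCoordinate.
Variable R : realType.
Implicit Types x y z : R.

(** Coordinates are points of the circle R/Z, represented in [0, 1]. *)
Definition circ_near x y :=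
  [|| `|y - x| < 16^-1, (x < 16^-1) && (1 - 16^-1 < y) | (y < 16^-1) && (1 - 16^-1 < x)].

(** The signed length of the shorter of the two arcs from [x] to [y]. *)
Definition circ_inc x y : R :=
  if `|y - x| <= 2^-1 then y - x else if x < y then y - x - 1 else y - x + 1.

(** The shorter arc from [x] to [y] crosses 1/2: the points lie on different sides
    of 1/2, unless the arc is the one through 0. *)
Definition circ_flip x y : bool :=
  ((x < 2^-1) (+) (y < 2^-1)) (+) (2^-1 < `|y - x|).

Lemma circ_nearP x y : circ_near x y ->
  [\/ `|y - x| <= 2^-1 /\ `|y - x| < 16^-1,
      [/\ x < 16^-1, 1 - 16^-1 < y & 2^-1 < `|y - x|] |
      [/\ y < 16^-1, 1 - 16^-1 < x & 2^-1 < `|y - x|]].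
Proof.
move=> /or3P[h|/andP[h1 h2]|/andP[h1 h2]].
- by apply: Or31; split=> //; lra.
- apply: Or32; split => //; rewrite ger0_norm; lra.
- apply: Or33; split => //; rewrite ler0_norm; lra.
Qed.

Lemma circ_near_int x y (k : int) : 0 <= x <= 1 -> 0 <= y <= 1 ->
  `|y - x + k%:~R| < 16^-1 -> circ_near x y /\ circ_inc x y = y - x + k%:~R.
Proof.
move=> x01 y01 h; have /andP[h1 h2] : (-(1 + 16^-1) < k%:~R :> R) && (k%:~R < 1 + 16^-1 :> R).
  by move: h; rewrite ltr_norml => /andP[h1 h2]; apply/andP; split; lra.
have k2 : (k < 2)%R by rewrite -(ltr_int R); apply: (lt_trans h2); lra.
have k3 : (- 2 < k)%R by rewrite -(ltr_int R); apply: lt_trans h1; lra.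
have : [\/ k = -1, k = 0 | k = 1].
  have : [|| k == -1, k == 0 | k == 1] by lia.
  by case/or3P => /eqP ->; [constructor 1|constructor 2|constructor 3].
rewrite /circ_near /circ_inc => -[] ke; move: h; rewrite ke ltr_norml => /andP[a1 a2].
- split; first by apply/or3P; apply: Or32; apply/andP; split; lra.
  by rewrite ger0_norm; [case: ifPn; [lra|case: ifPn; lra]|lra].
- split; first by apply/or3P; apply: Or31; rewrite ltr_norml; apply/andP; split; lra.
  by case: ifPn; [lra|rewrite -ltNge ltr_normr => /orP[]; lra].
- split; first by apply/or3P; apply: Or33; apply/andP; split; lra.
  by rewrite ler0_norm; [case: ifPn; [lra|case: ifPn; lra]|lra].
Qed.

Lemma circ_incP x y : circ_near x y ->
  [\/ [/\ circ_inc x y = y - x, `|y - x| < 16^-1 & (2^-1 < `|y - x|) = false],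
      [/\ circ_inc x y = y - x - 1, x < 16^-1, 1 - 16^-1 < y & (2^-1 < `|y - x|) = true] |
      [/\ circ_inc x y = y - x + 1, y < 16^-1, 1 - 16^-1 < x & (2^-1 < `|y - x|) = true]].
Proof.
move=> /circ_nearP[[h1 h2]|[h1 h2 h3]|[h1 h2 h3]].
- by apply: Or31; rewrite /circ_inc h1; split => //; rewrite ltNge h1.
- apply: Or32; rewrite /circ_inc leNgt h3 /=; case: ifPn => //; lra.
- apply: Or33; rewrite /circ_inc leNgt h3 /=; case: ifPn => //; lra.
Qed.

Lemma circ_inc_cocycle x y z : 0 <= x <= 1 -> 0 <= y <= 1 -> 0 <= z <= 1 ->
  circ_near x y -> circ_near y z -> circ_near x z ->
  circ_inc x y + circ_inc y z = circ_inc x z.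
Proof.
move=> x01 y01 z01 /circ_incP[[-> + _]|[-> + + _]|[-> + + _]]
  /circ_incP[[-> + _]|[-> + + _]|[-> + + _]]
  /circ_incP[[-> + _]|[-> + + _]|[-> + + _]]; rewrite ?ltr_norml; lra.
Qed.

Lemma circ_flip_cocycle x y z :
  circ_near x y -> circ_near y z -> circ_near x z ->
  circ_flip x y (+) circ_flip y z = circ_flip x z.
Proof.
move=> hxy hyz hxz; rewrite /circ_flip.
suff <- : (2^-1 < `|y - x|) (+) (2^-1 < `|z - y|) = (2^-1 < `|z - x|).
  by case: (x < _); case: (y < _); case: (z < _); case: (_ < `|y - x|); case: (_ < `|z - y|).
move: hxy hyz hxz => /circ_incP[[_ + ->]|[_ + + ->]|[_ + + ->]]
  /circ_incP[[_ + ->]|[_ + + ->]|[_ + + ->]]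
  /circ_incP[[_ + ->]|[_ + + ->]|[_ + + ->]] //=; rewrite ?ltr_norml; lra.
Qed.

(** Nearby points on both sides of 1/2 are far from 0. *)
Lemma circ_flip_mid x y z : circ_near x y -> circ_near y z -> circ_flip x y ->
  0 < y /\ 0 < z.
Proof.
rewrite /circ_flip => /circ_incP[[_ + ->]|[_ + + ->]|[_ + + ->]]
  /circ_incP[[_ + _]|[_ + + _]|[_ + + _]]; rewrite ?ltr_norml;
  case: (ltrP x 2^-1) => h1; case: (ltrP y 2^-1) => h2 //= *; split; lra.
Qed.

Lemma circ_inc00 : circ_inc 0 0 = 0 :> R.
Proof. by rewrite /circ_inc subrr normr0 invr_ge0 ler0n. Qed.

End CircleCoordinate.

Section Increments.
Variables (R : realType) (G : multigraph) (l : edge G -> R).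
Hypothesis l_ge0 : forall e, 0 <= l e.
Implicit Types (p q : mgraph l) (e : edge G).

(** The map to R/Z that collapses the complement of [e] to the point 0. *)
Definition ecoord e p : R := if p.1 == e then p.2%:num else 0.

Lemma ecoord01 e p : 0 <= ecoord e p <= 1.
Proof.
rewrite /ecoord; case: ifP => _; last by rewrite lexx ler01.
by apply/andP; split.
Qed.

Lemma ecoord_vertex e p x : at_vertex p x -> exists b : bool, ecoord e p = b%:R.
Proof.
rewrite /ecoord; case: ifP => _; last by exists false.
by case=> -[-> _]; [exists false|exists true].
Qed.

(** A chain from [p] to [q] lifts, through the coordinate of [e], to a path in the
    line, which ends at [ecoord e q] up to an integer [k e].  Its displacement is at
    most the length of the segments of the chain on [e], divided by [l e]. *)
Lemma chain_lift p q c : chain p q c ->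
  exists k : edge G -> int, \sum_e l e * `|ecoord e q - ecoord e p + (k e)%:~R| <= c.
Proof.
elim=> [p0|e s t q0 c0 _ [k hk]|p0 p' x q0 c0 h h' _ [k hk]].
- by exists (fun=> 0); rewrite big1 // => e _; rewrite subrr addr0 normr0 mulr0.
- exists k; apply: le_trans (lerD (lexx _) hk).
  have -> : l e * `|s%:num - t%:num| = \sum_e' l e' * (if e' == e then `|s%:num - t%:num| else 0).
    rewrite (bigD1 e) //= eqxx big1 ?addr0 // => e' /negPf ->; by rewrite mulr0.
  rewrite -big_split /=; apply: ler_sum => e' _; rewrite -mulrDr ler_wpM2l //.
  rewrite /ecoord /= (eq_sym e e'); case: (e' == e); last by rewrite add0r.
  set z := (if _ then _ else _).
  have -> : z - s%:num + (k e')%:~R = (t%:num - s%:num) + (z - t%:num + (k e')%:~R) by ring.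
  by rewrite (distrC (s%:num)); exact: ler_normD.
- have [b [b' bb']] : exists b b' : edge G -> int,
      forall e, ecoord e p0 = (b e)%:~R /\ ecoord e p' = (b' e)%:~R.
    have /choice[b hb] : forall e, exists b : int, ecoord e p0 = b%:~R.
      by move=> e; have [c1 ->] := ecoord_vertex e h; exists c1%:R; rewrite natz pmulrn.
    have /choice[b' hb'] : forall e, exists b : int, ecoord e p' = b%:~R.
      by move=> e; have [c1 ->] := ecoord_vertex e h'; exists c1%:R; rewrite natz pmulrn.
    by exists b, b'.
  exists (fun e => k e + b e - b' e); apply: le_trans hk.
  apply: ler_sum => e _; have [-> ->] := bb' e.
  rewrite le_eqVlt; apply/orP; left; apply/eqP; congr (_ * `| _ |).
  by rewrite rmorphB rmorphD /=; ring.
Qed.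

(** Below this scale the coordinates of two points determine how a short chain
    between them crosses the edges of positive length. *)
Definition fine_scale (delta : R) := 0 < delta /\ forall e, 0 < l e -> 16 * delta <= l e.

Lemma fine_ex : exists delta, fine_scale delta.
Proof.
exists (16^-1 * \big[Num.min/1]_(e | 0 < l e) l e); split.
  rewrite mulr_gt0 //; elim/big_ind: _ => // x y x0 y0; by rewrite lt_min x0.
move=> e le; rewrite mulrA mulfV ?mul1r //; exact: bigmin_le_cond.
Qed.

(** A chain shorter than [delta] advances by less than 1/16 along each edge, which
    leaves a single possible value for the integers of [chain_lift]. *)
Lemma chain_near delta p q c : fine_scale delta -> chain p q c -> c < delta ->
  (forall e, 0 < l e -> circ_near (ecoord e p) (ecoord e q)) /\
  \sum_e l e * `|circ_inc (ecoord e p) (ecoord e q)| <= c.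
Proof.
move=> [d0 hd] /chain_lift[k hk] cd.
have key e : 0 < l e -> circ_near (ecoord e p) (ecoord e q) /\
    circ_inc (ecoord e p) (ecoord e q) = ecoord e q - ecoord e p + (k e)%:~R.
  move=> le; apply: circ_near_int; try exact: ecoord01.
  have h1 : l e * `|ecoord e q - ecoord e p + (k e)%:~R| < l e * 16^-1.
    apply: le_lt_trans (le_lt_trans hk _).
      rewrite [leRHS](bigD1 e) //= lerDl; apply: sumr_ge0 => e' _.
      by rewrite mulr_ge0.
    by apply: lt_le_trans cd _; have := hd e le; lra.
  by move: h1; rewrite ltr_pM2l.
split=> [e /key[]//|]; apply: le_trans hk; apply: ler_sum => e _.
have [le|le] := ltP 0 (l e); first by have [_ ->] := key e le.
have -> : l e = 0 by apply/eqP; rewrite eq_le le l_ge0.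
by rewrite !mul0r.
Qed.

Lemma gball_near delta p q e : fine_scale delta -> gball p delta q -> 0 < l e ->
  circ_near (ecoord e p) (ecoord e q).
Proof. by move=> fd [c pq cd] le; have [h _] := chain_near fd pq cd; exact: h. Qed.

End Increments.

(** * Holonomy and its invariance under homotopy *)
Section Holonomy.
Variables (R : realType) (G : multigraph) (l : edge G -> R).
Hypothesis l_ge0 : forall e, 0 <= l e.
Implicit Types (p q : mgraph l) (S : seq (edge G)) (e : edge G).

(** [S] is a set of edges with a cut at their midpoints.  Two copies of the graph
    cut there, glued crosswise, form a double cover; [flips] tells whether the
    step from [p] to [q] changes the sheet. *)
Definition flips S p q : bool :=
  foldr (fun e b => circ_flip (ecoord e p) (ecoord e q) (+) b) false S.

(** The coordinate of [e] is counted with opposite signs on the two sheets. *)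
Definition hstep S e p q (x : R) : R :=
  (if flips S p q then - x else x) + circ_inc (ecoord e p) (ecoord e q).

(** The composition of the steps along [P 0, ..., P n], the first step being the
    outermost map. *)
Fixpoint hol S e (P : nat -> mgraph l) n (x : R) : R :=
  if n is n'.+1 then hol S e P n' (hstep S e (P n') (P n'.+1) x) else x.

(** The sign of a translation is not an invariant: conjugation by [x -> - x]
    reverses it. *)
Definition translation (F : R -> R) (r : R) :=
  (forall x, F x = x + r) \/ (forall x, F x = x - r).

Variables (delta : R) (S : seq (edge G)) (e : edge G).
Hypothesis delta_fine : fine_scale l delta.
Hypothesis e_gt0 : 0 < l e.
Hypothesis S_gt0 : forall e', e' \in S -> 0 < l e'.
Hypothesis eS : e \notin S.

Lemma flips_cocycle p q r : gball p delta q -> gball q delta r -> gball p delta r ->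
  flips S p q (+) flips S q r = flips S p r.
Proof.
move=> pq qr pr; rewrite /flips; elim: S S_gt0 => //= e' S' IH S0.
rewrite -IH; last by move=> e1 h; apply: S0; rewrite inE h orbT.
have le' : 0 < l e' by apply: S0; rewrite inE eqxx.
rewrite -(@circ_flip_cocycle _ (ecoord e' p) (ecoord e' q) (ecoord e' r)) //;
  try exact: (gball_near l_ge0 delta_fine).
by rewrite addbACA.
Qed.

(** A change of sheet happens in the interior of an edge of [S], away from [e],
    where the coordinate of [e] is constant. *)
Lemma flips_inc0 p q r : gball p delta q -> gball q delta r ->
  flips S p q -> circ_inc (ecoord e q) (ecoord e r) = 0.
Proof.
move=> pq qr fl; have [e' e'S fe'] : exists2 e', e' \in S & circ_flip (ecoord e' p) (ecoord e' q).
  move: fl; rewrite /flips; elim: (S) => //= e' S' IH.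
  case E : (circ_flip (ecoord e' p) _) => /=; first by exists e' => //; rewrite inE eqxx.
  by move=> /IH[e1 h1 h2]; exists e1 => //; rewrite inE h1 orbT.
have le' := S_gt0 e'S.
have [h1 h2] := circ_flip_mid (gball_near l_ge0 delta_fine pq le')
  (gball_near l_ge0 delta_fine qr le') fe'.
have key s : 0 < ecoord e' s -> ecoord e s = 0.
  rewrite /ecoord; case: eqP => [->|]; last by rewrite ltxx.
  by case: eqP => // ee; move: eS; rewrite -ee e'S.
by rewrite !key // circ_inc00.
Qed.

(** The maps [hstep] form a cocycle on small triangles: signs and increments do so
    separately, and by [flips_inc0] they do not interfere. *)
Lemma hstep_comp p q r x : gball p delta q -> gball q delta r -> gball p delta r ->
  hstep S e p q (hstep S e q r x) = hstep S e p r x.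
Proof.
move=> pq qr pr; rewrite /hstep -(flips_cocycle pq qr pr).
rewrite -(@circ_inc_cocycle _ (ecoord e p) (ecoord e q) (ecoord e r)) ?ecoord01 //;
  try exact: (gball_near l_ge0 delta_fine).
have := flips_inc0 pq qr; case: (flips S p q) => [->//|_].
  by case: (flips S q r) => /=; ring.
by case: (flips S q r) => /=; ring.
Qed.

(** A ladder of small squares, each of them cut into two small triangles. *)
Lemma hol_square (P Q : nat -> mgraph l) n x :
  (forall j, (j < n)%N -> gball (P j) delta (P j.+1)) ->
  (forall j, (j < n)%N -> gball (Q j) delta (Q j.+1)) ->
  (forall j, (j <= n)%N -> gball (P j) delta (Q j)) ->
  (forall j, (j < n)%N -> gball (P j) delta (Q j.+1)) ->
  hol S e P n (hstep S e (P n) (Q n) x) = hstep S e (P 0%N) (Q 0%N) (hol S e Q n x).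
Proof.
elim: n x => [//|n IH] x hP hQ hPQ hD /=.
rewrite hstep_comp; [|by apply: hP|by apply: hPQ|by apply: hD].
rewrite -(@hstep_comp (P n) (Q n)); [|by apply: hPQ; lia|by apply: hQ|by apply: hD].
by apply: IH => j jn; [apply: hP|apply: hQ|apply: hPQ|apply: hD]; lia.
Qed.

Lemma translation_conj p q (F H : R -> R) r :
  (forall x, F (hstep S e p q x) = hstep S e p q (H x)) ->
  translation F r -> translation H r.
Proof.
move=> FH; rewrite /hstep in FH; case: (flips S p q) FH => FH [] h.
- by right=> x; have := FH x; rewrite h; lra.
- by left=> x; have := FH x; rewrite h; lra.
- by left=> x; have := FH x; rewrite h; lra.
- by right=> x; have := FH x; rewrite h; lra.
Qed.

Lemma hol_norm (P : nat -> mgraph l) n x :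
  `|hol S e P n x| <= `|x| + \sum_(j < n) `|circ_inc (ecoord e (P j)) (ecoord e (P j.+1))|.
Proof.
elim: n x => [x|n IH x] /=; first by rewrite big_ord0 addr0.
rewrite big_ord_recr /= (addrC (\sum_(_ < _) _)) addrA; apply: le_trans (IH _) _.
rewrite lerD2r /hstep; apply: le_trans (ler_normD _ _) _; rewrite lerD2r.
by case: (flips _ _ _); rewrite ?normrN.
Qed.

Lemma translation_le (P : nat -> mgraph l) n r : translation (hol S e P n) r ->
  `|r| <= \sum_(j < n) `|circ_inc (ecoord e (P j)) (ecoord e (P j.+1))|.
Proof.
move=> h; have := hol_norm P n 0; rewrite normr0 add0r; apply: le_trans.
by case: h => ->; rewrite ?add0r ?sub0r ?normrN.
Qed.

End Holonomy.

(** ** Uniform continuity of homotopies *)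
Section UniformHomotopy.
Variable R : realType.

Lemma within_ball (X Y : pseudoMetricType R) (A : set X) (f : X -> Y) x eps :
  {within A, continuous f} -> A x -> 0 < eps ->
  exists2 r : R, 0 < r & forall y, A y -> ball x r y -> ball (f x) eps (f y).
Proof.
move=> fc Ax e0; have /subspace_continuousP/(_ x Ax)/cvg_ballP/(_ _ e0) h := fc.
have /nbhs_ballP[r r0 hr] : \forall y \near x, A y -> ball (f x) eps (f y) by exact: h.
by exists r => // y Ay xy; exact: hr.
Qed.

(** Compactness of the square.  Only the first point is confined to it in the time
    variable, so that the estimate can be used across the base point of a loop. *)
Lemma homotopy_uniform (X : pseudoMetricType R) (K : R -> R -> X) eps :
  {within [set p : R * R | 0 <= p.1 <= 1], continuous (fun p : R * R => K p.1 p.2)} ->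
  0 < eps ->
  exists2 eta : R, 0 < eta & forall s t s' t', 0 <= s <= 1 -> 0 <= s' <= 1 -> 0 <= t <= 1 ->
    `|s - s'| < eta -> `|t - t'| < eta -> ball (K s t) eps (K s' t').
Proof.
move=> Kc e0.
pose A := `[0 : R, 1]%classic `*` `[0 : R, 1]%classic.
have cA : compact A by apply: compact_setX; exact: segment_compact.
pose P (eta : R) (x : R * R) := 0 <= x.1 <= 1 -> forall y : R * R, 0 <= y.1 <= 1 ->
  ball x eta y -> ball (K x.1 x.2) eps (K y.1 y.2).
have : \forall eta \near 0^'+, A `<=` P eta.
  apply: (iffLR (compact_near_coveringP A) cA R (0^'+) P _) => x [/= x1 x2].
  have x1' : 0 <= x.1 <= 1 by move: x1; rewrite /= in_itv.
  have e20 : 0 < eps / 2 by rewrite divr_gt0.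
  have [r r0 hr] := within_ball Kc x1' e20.
  have r20 : 0 < r / 2 by rewrite divr_gt0.
  near=> x' eta => x'1 y y1 xy.
  have xx' : ball x (r / 2) x' by near: x'; exact: nbhsx_ballx.
  have er : eta < r / 2 by near: eta; exact: nbhs_right_lt.
  have bx : ball (K x.1 x.2) (eps / 2) (K x'.1 x'.2).
    by apply: (hr x') => //; apply: le_ball xx'; lra.
  have by_ : ball (K x.1 x.2) (eps / 2) (K y.1 y.2).
    apply: (hr y) => //; have -> : r = r / 2 + r / 2 by lra.
    by apply: ball_triangle xx' _; apply: le_ball xy; exact: ltW.
  by rewrite (splitr eps); apply: ball_triangle by_; exact: ball_sym.
move=> hP; near (0 : R)^'+ => eta; have hA : A `<=` P eta by near: eta.
exists eta; first by near: eta; exact: nbhs_right_gt.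
move=> s t s' t' s01 s'01 t01 hs ht.
by apply: (hA (s, t) _ s01 (s', t')) => //=; rewrite /A /= !in_itv.
Unshelve. all: by end_near. Qed.

End UniformHomotopy.

(** ** Invariance of translation lengths *)
Section HomotopyCrossing.
Variables (R : realType) (G : multigraph) (l : edge G -> R).
Hypothesis l_ge0 : forall e, 0 <= l e.

Definition sample (a : R -> mgraph l) (N : nat) (j : nat) : mgraph l := a (j%:R / N%:R).

(** A homotopy of loops, sampled on a fine grid, is a stack of ladders
    [hol_square] whose two ends agree because the curves are closed: each ladder
    conjugates the holonomy of one row into that of the next. *)
Lemma homotopy_translation (a b : R -> mgraph l) delta S e :
  fine_scale l delta -> 0 < l e -> (forall e', e' \in S -> 0 < l e') -> e \notin S ->
  freely_homotopic a b ->
  exists N0 : nat, forall N, (N0 <= N)%N ->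
    (forall j, (j < N)%N -> gball (sample a N j) delta (sample a N j.+1)) /\
    forall r, translation (hol S e (sample b N) N) r ->
      translation (hol S e (sample a N) N) r.
Proof.
move=> fd e0 S0 eS [K [Kc Kper Ka Kb]].
have [eta eta0 hK] := homotopy_uniform Kc fd.1.
have [N0 hN0] : exists N0 : nat, eta^-1 < N0%:R.
  by exists (Num.truncn eta^-1).+1; exact: truncnS_gt.
exists N0.+1 => N hN.
have N_gt0 : (0 < N%:R :> R) by rewrite ltr0n; lia.
have Ninv : N%:R^-1 < eta.
  rewrite -[eta]invrK ltf_pV2 ?posrE ?invr_gt0 //; apply: lt_trans hN0 _.
  by rewrite ltr_nat.
pose P i : nat -> mgraph l := sample (K (i%:R / N%:R)) N.
have frac i : (i <= N)%N -> 0 <= (i%:R / N%:R : R) <= 1.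
  by move=> iN; rewrite divr_ge0 ?ler0n //= ler_pdivrMr // mul1r ler_nat.
have step i i' : (i <= i'.+1)%N && (i' <= i.+1)%N -> `|i%:R / N%:R - i'%:R / N%:R : R| < eta.
  move=> /andP[h1 h2]; apply: le_lt_trans Ninv.
  rewrite -mulrBl normrM (gtr0_norm (x := N%:R^-1)) ?invr_gt0 // ler_piMl ?invr_ge0 ?ler0n //.
  have H1 : i%:R <= i'%:R + 1 :> R by rewrite natr1 ler_nat.
  have H2 : i'%:R <= i%:R + 1 :> R by rewrite natr1 ler_nat.
  by rewrite ler_norml; apply/andP; split; lra.
have hP i i' j j' : (i <= N)%N -> (i' <= N)%N -> (j <= N)%N ->
    (i <= i'.+1)%N && (i' <= i.+1)%N -> (j <= j'.+1)%N && (j' <= j.+1)%N ->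
    gball (P i j) delta (P i' j').
  by move=> iN i'N jN hi hj; apply: hK; try exact: frac; exact: step.
have P0 : P 0%N = sample a N by apply/funext => j; rewrite /P /sample mul0r Ka.
have PN : P N = sample b N.
  by apply/funext => j; rewrite /P /sample divff ?gt_eqF // Kb.
have Pend i : (i <= N)%N -> P i N = P i 0%N.
  move=> iN; rewrite /P /sample divff ?gt_eqF // mul0r.
  by rewrite -[in RHS](Kper _ (frac i iN)) add0r.
split.
  by move=> j jN; rewrite -P0; apply: hP => //; lia.
move=> r; rewrite -PN -P0.
suff key i : (i <= N)%N -> translation (hol S e (P i) N) r -> translation (hol S e (P 0%N) N) r.
  exact: key.
elim: i => // i IH iN h; apply: IH; first by lia.
apply: (@translation_conj R G l S e (P i.+1 0%N) (P i 0%N) _ _ _ _ h) => x.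
rewrite -[in LHS]Pend // -[in LHS](Pend i); last by lia.
apply: (hol_square l_ge0 fd e0 S0 eS) => j jN.
- by apply: hP; lia.
- by apply: hP; lia.
- by apply: hP; lia.
- by apply: hP; lia.
Qed.

End HomotopyCrossing.

(** * Loops that traverse an edge path *)
Section DartPoints.
Variables (R : realType) (G : multigraph).

Lemma i01_inj (x y : {i01 R}) : x%:num = y%:num -> x = y.
Proof.
case: x y => [x Px] [y Py] /= E; subst y; congr Itv.Def; exact: bool_irrelevance.
Qed.

Lemma clamp01_ge0 (x : R) : 0 <= Num.max 0 (Num.min 1 x).
Proof. by rewrite le_max lexx. Qed.

Lemma clamp01_le1 (x : R) : Num.max 0 (Num.min 1 x) <= 1.
Proof. by rewrite ge_max ler01 ge_min lexx. Qed.

(** Lets points of edges be written without a proof that their coordinate lies in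
    [0, 1]. *)
Definition clamp01 (x : R) : {i01 R} := Itv01 (clamp01_ge0 x) (clamp01_le1 x).

Lemma clamp01K (x : R) : 0 <= x <= 1 -> (clamp01 x)%:num = x.
Proof.
move=> /andP[x0 x1]; have -> : (clamp01 x)%:num = Num.max 0 (Num.min 1 x) by [].
by rewrite (min_idPr x1) (max_idPr x0).
Qed.

Variable l : edge G -> R.
Implicit Types (d : dart G) (e : edge G).

Definition dpt d (x : R) : mgraph l := (d.1, clamp01 (if d.2 then 1 - x else x)).

Lemma dpt_num d x : 0 <= x <= 1 -> (dpt d x).2%:num = if d.2 then 1 - x else x.
Proof. by move=> x01; rewrite clamp01K //; case: d.2 => //; lra. Qed.

Lemma ecoord_dpt e d x : 0 <= x <= 1 ->
  ecoord e (dpt d x) = if d.1 == e then (if d.2 then 1 - x else x) else 0.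
Proof. by move=> x01; rewrite /ecoord dpt_num. Qed.

Lemma dpt_src d : at_vertex (dpt d 0) (dsrc d).
Proof.
rewrite /at_vertex dpt_num ?lexx ?ler01 // /dsrc /=; case: d.2.
  by right; rewrite subr0.
by left.
Qed.

Lemma dpt_tgt d : at_vertex (dpt d 1) (dtgt d).
Proof.
rewrite /at_vertex dpt_num ?lexx ?ler01 // /dtgt /=; case: d.2.
  by left; rewrite subrr.
by right.
Qed.

Lemma chain_dpt d x y : 0 <= x <= 1 -> 0 <= y <= 1 ->
  chain (dpt d x) (dpt d y) (l d.1 * `|x - y|).
Proof.
move=> x01 y01; have := chain_segment (l := l) (clamp01 (if d.2 then 1 - x else x))
  (chain_nil ((d.1, clamp01 (if d.2 then 1 - y else y)) : mgraph l)).
rewrite addr0 !clamp01K; try by case: d.2; lra.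
suff -> : `|(if d.2 then 1 - x else x) - (if d.2 then 1 - y else y)| = `|x - y| by [].
case: d.2 => //; rewrite -(normrN (x - y)); congr (`| _ |); ring.
Qed.

Lemma chain_same_vertex (p q : mgraph l) x :
  at_vertex p x -> at_vertex q x -> chain p q 0.
Proof. by move=> px qx; exact: chain_vertex px qx (chain_nil q). Qed.

End DartPoints.

Lemma dart_pointE (R : realType) (G : multigraph) (d : dart G) (s : {i01 R}) :
  dart_point d s = dpt (fun=> 1) d s%:num.
Proof.
congr pair; apply: i01_inj; rewrite clamp01K; first by case: d.2.
have h0 : 0 <= s%:num by []; have h1 : s%:num <= 1 by [].
by case: d.2; lra.
Qed.

Section LoopPath.
Variables (R : realType) (G : multigraph) (d0 : dart G) (c : seq (dart G)).
Hypothesis c_closed : closed_path c.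
Local Notation n := (size c).

Lemma size_closed_gt0 : (0 < n)%N.
Proof. by case/andP: c_closed; case: c. Qed.

(** Indices are taken modulo the length, so that [gpath] below is a periodic path
    defined on the whole line. *)
Definition cdart (m : int) : dart G := nth d0 c `|(m %% n)%Z|%N.

Lemma cdart_nat i : (i < n)%N -> cdart i%:Z = nth d0 c i.
Proof. by move=> h; rewrite /cdart modz_nat /= modn_small. Qed.

Lemma cdartD m : cdart (m + n%:Z) = cdart m.
Proof. by rewrite /cdart modzDr. Qed.

Lemma cdart_follows m : dtgt (cdart m) = dsrc (cdart (m + 1)).
Proof.
have n0 := size_closed_gt0.
have key i : (i < n)%N -> dtgt (nth d0 c i) = dsrc (nth d0 c (i.+1 %% n)).
  case/andP: c_closed; case: c => //= x p _ /(pathP d0) h ip.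
  have := h i; rewrite size_rcons => /(_ ip) /eqP.
  rewrite -rcons_cons nth_rcons /= ip => ->.
  rewrite nth_rcons; move: ip; rewrite ltnS leq_eqVlt => /orP[/eqP ->|ip].
    by rewrite ltnn eqxx modnn.
  by rewrite ip modn_small.
rewrite /cdart; have n0' : n%:Z != 0 by rewrite -lt0n.
have := ltz_pmod m (d := n%:Z); rewrite ltz_nat => /(_ n0).
have := modz_ge0 m n0'; rewrite -[((m + 1) %% _)%Z]modzDml.
case: (m %% n)%Z => // i _; rewrite ltz_nat => hi; rewrite key //=.
by rewrite -PoszD modz_nat /= addn1.
Qed.

Definition gpath l (y : R) : mgraph l :=
  dpt l (cdart (Num.floor y)) (y - (Num.floor y)%:~R).

Lemma gpathE l (m : int) x : 0 <= x < 1 -> gpath l (m%:~R + x) = dpt l (cdart m) x.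
Proof.
move=> x01; rewrite /gpath.
have -> : Num.floor (m%:~R + x) = m.
  by apply: floor_def; rewrite rmorphD /=; apply/andP; split; lra.
by congr dpt; ring.
Qed.

Lemma floor_split (y : R) : exists (m : int) (x : R), [/\ y = m%:~R + x, 0 <= x & x < 1].
Proof.
exists (Num.floor y), (y - (Num.floor y)%:~R).
have := floor_itv y; rewrite rmorphD /= => /andP[h1 h2]; split; lra.
Qed.

(** Such an interval contains at most one integer, that is one vertex to pass. *)
Lemma gpath_chain y y' : y <= y' < y + 1 ->
  chain (gpath (fun=> 1) y) (gpath (fun=> 1) y') (y' - y).
Proof.
have [m [x [-> x0 x1]]] := floor_split y; have [m' [x' [-> x'0 x'1]]] := floor_split y'.
move=> /andP[h1 h2]; rewrite !gpathE ?x0 ?x'0 //.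
have [mm|mm] : m' = m \/ m' = m + 1.
  have H1 : (m < m' + 1)%R by rewrite -(ltr_int R) rmorphD /=; lra.
  have H2 : (m' < m + 2)%R by rewrite -(ltr_int R) rmorphD /=; lra.
  by case: (ltgtP m' m) => h; [lia|right; lia|left].
- subst m'; have := chain_dpt (fun=> 1) (cdart m) (x := x) (y := x').
  rewrite mul1r distrC ger0_norm; last lra.
  have -> : m%:~R + x' - (m%:~R + x) = x' - x by ring.
  by apply; lra.
- subst m'; have c1 := chain_dpt (fun=> 1) (cdart m) (x := x) (y := 1).
  have c2 := chain_dpt (fun=> 1) (cdart (m + 1)) (x := 0) (y := x').
  have {}c1 := c1 ltac:(lra) ltac:(lra); have {}c2 := c2 ltac:(lra) ltac:(lra).
  have c12 : chain (dpt (fun=> 1 : R) (cdart m) 1) (dpt (fun=> 1) (cdart (m + 1)) 0) 0.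
    apply: (chain_same_vertex (dpt_tgt _ _)); rewrite cdart_follows; exact: dpt_src.
  have := chain_trans c1 (chain_trans c12 c2).
  rewrite !mul1r add0r distrC ger0_norm; last lra.
  rewrite sub0r normrN ger0_norm //.
  have -> // : 1 - x + x' = (m + 1)%:~R + x' - (m%:~R + x) by rewrite rmorphD /=; ring.
Qed.

Definition gloop (x : R) : realization R G := gpath (fun=> 1) (n%:R * x).

Lemma gloop_traverses : traverses gloop c.
Proof.
have n0 := size_closed_gt0; have n0' : (0 < n%:R :> R) by rewrite ltr0n.
split; last first.
  move=> i s s1; rewrite /gloop mulrC divfK ?gt_eqF // dart_pointE.
  rewrite -[i%:R]/((i%:Z)%:~R) gpathE; last by apply/andP.
  by rewrite cdart_nat ?ltn_ord // (tnth_nth d0).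
split; last first.
  move=> t; rewrite /gloop mulrDr mulr1.
  have [m [x [-> x0 x1]]] := floor_split (n%:R * t).
  rewrite addrAC -[n%:R in LHS]/((n%:Z)%:~R) -rmorphD /= !gpathE ?x0 //.
  by rewrite cdartD.
move=> t; apply/cvg_ballP => eps eps0.
apply/nbhs_ballP; pose r := Num.min 1 eps / n%:R.
have r0 : 0 < Num.min 1 eps by rewrite lt_min ltr01.
exists r; first by rewrite /= divr_gt0.
move=> t' /=; rewrite /ball /= /r ltr_pdivlMr // => tt'.
have key u v : u <= v -> `|u - v| * n%:R < Num.min 1 eps -> gball (gloop u) eps (gloop v).
  move=> uv; rewrite distrC ger0_norm ?subr_ge0 // lt_min => /andP[h1 h2].
  exists (n%:R * v - n%:R * u); last by rewrite -mulrBr mulrC.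
  apply: gpath_chain; rewrite ler_pM2l // uv /= -ltrBlDl -mulrBr mulrC //.
have [h|/ltW h] := leP t t'; first exact: key.
by apply: (@ball_sym R (realization R G)); apply: key => //; rewrite distrC.
Qed.

End LoopPath.

(** * Holonomy of candidates *)
Section LoopHolonomy.
Variables (R : realType) (G : multigraph) (l : edge G -> R).
Implicit Types (d : dart G) (S : seq (edge G)) (e : edge G).

Definition sgd d : R := if d.2 then -1 else 1.

(** The holonomy along a whole dart. *)
Definition dmap S e d (x : R) : R :=
  (if d.1 \in S then - x else x) + (if d.1 == e then sgd d else 0).

Lemma hol_add S e (P : nat -> mgraph l) a b x :
  hol S e P (a + b) x = hol S e P a (hol S e (fun k => P (a + k)%N) b x).
Proof. by elim: b x => [|b IH] x; rewrite ?addn0 // addnS /= IH addnS. Qed.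

(** At a vertex the coordinate of an edge is 0 or 1, depending on the name of the
    vertex; these are the same point of the circle. *)
Lemma circ_vertex (x : R) (b : bool) : 0 <= x <= 1 -> x != 2^-1 ->
  circ_flip x b%:R = false /\ circ_inc x b%:R = (if x < 2^-1 then - x else 1 - x).
Proof.
move=> x01 x2; rewrite /circ_flip /circ_inc.
have {x2} [x2|x2] : x < 2^-1 \/ 2^-1 < x by case: (ltgtP x 2^-1) x2 => // h _; [left|right].
  rewrite x2; case: b => /=.
    rewrite ger0_norm; last lra.
    have -> : (1 < 2^-1 :> R) = false by apply/negbTE; rewrite -leNgt; lra.
    rewrite leNgt; have -> : 2^-1 < 1 - x by lra.
    have -> : x < 1 by lra.
    by split=> //=; ring.
  rewrite sub0r normrN ger0_norm; last lra.
  have -> : (0 < 2^-1 :> R) by lra.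
  by rewrite leNgt; have -> : (2^-1 < x) = false by apply/negbTE; rewrite -leNgt; lra.
have -> : (x < 2^-1) = false by apply/negbTE; rewrite -leNgt; lra.
case: b => /=.
  rewrite ger0_norm; last lra.
  have -> : (1 < 2^-1 :> R) = false by apply/negbTE; rewrite -leNgt; lra.
  by rewrite leNgt; have -> : (2^-1 < 1 - x) = false by apply/negbTE; rewrite -leNgt; lra.
rewrite sub0r normrN ger0_norm; last lra.
have -> : (0 < 2^-1 :> R) by lra.
rewrite leNgt x2; have -> : (x < 0) = false by apply/negbTE; rewrite -leNgt; lra.
by split=> //=; ring.
Qed.

Lemma flips1 S e' (p q : mgraph l) : uniq S ->
  (forall e, e != e' -> circ_flip (ecoord e p) (ecoord e q) = false) ->
  flips S p q = (e' \in S) && circ_flip (ecoord e' p) (ecoord e' q).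
Proof.
move=> + h; rewrite /flips; elim: S => //= e1 S IH /andP[e1S /IH ->].
rewrite inE; have [->|h1] := eqVneq e' e1; last by rewrite h 1?eq_sym.
by case: (e1 \in S) e1S => //= _; rewrite addbF.
Qed.

(** In [M] steps the coordinate of the edge of [d] moves by [1 / M] each time, in
    the direction of [d], and passes 1/2 once.  The end point [P M] may be given by
    any name of the target of [d]. *)
Lemma hol_dart S e d (P : nat -> mgraph l) M x : (2 < M)%N -> uniq S -> e \notin S ->
  (forall k, (k < M)%N -> P k = dpt l d (k%:R / M%:R)) ->
  (forall e', exists b : bool, ecoord e' (P M) = b%:R) ->
  hol S e P M x = dmap S e d x.
Proof.
move=> M2 uS eS hP hM.
have M0 : (0 < M%:R :> R) by rewrite ltr0n; lia.
have Mi : 0 < M%:R^-1 :> R by rewrite invr_gt0.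
have M3 : M%:R^-1 <= 3^-1 :> R by rewrite lef_pV2 ?posrE // ler_nat.
pose y k : R := if d.2 then 1 - k%:R / M%:R else k%:R / M%:R.
have k01 k : (k < M)%N -> 0 <= (k%:R / M%:R : R) <= 1.
  by move=> kM; rewrite divr_ge0 ?ler0n //= ler_pdivrMr // mul1r ler_nat; exact: ltnW.
have cP e' k : (k < M)%N -> ecoord e' (P k) = if d.1 == e' then y k else 0.
  by move=> kM; rewrite hP // ecoord_dpt //; exact: k01.
have flip00 : circ_flip (0 : R) 0 = false.
  by rewrite /circ_flip subrr normr0 addbb ltNge invr_ge0 ler0n.
have flip0b (b : bool) : circ_flip (0 : R) b%:R = false /\ circ_inc (0 : R) b%:R = 0.
  have [||-> ->] := @circ_vertex 0 b; [lra| lra |].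
  by rewrite invr_gt0 ltr0n oppr0.
have yk k : y k.+1 - y k = sgd d / M%:R.
  rewrite /y /sgd -natr1; case: d.2; ring.
have step k z : (k.+1 < M)%N -> hstep S e (P k) (P k.+1) z =
    (if (d.1 \in S) && circ_flip (y k) (y k.+1) then - z else z) +
    (if d.1 == e then sgd d / M%:R else 0).
  move=> kM; rewrite /hstep (@flips1 S d.1) //; last first.
    by move=> e' /negPf h; rewrite !cP ?[d.1 == _]eq_sym ?h //; lia.
  rewrite !cP ?eqxx; try lia; congr (_ + _).
  case: eqP => _; last exact: circ_inc00.
  rewrite /circ_inc yk ifT // /sgd; case: d.2; rewrite ?mulN1r ?mul1r ?normrN gtr0_norm //; lra.
have last_step z : hstep S e (P M.-1) (P M) z =
    z + (if d.1 == e then sgd d / M%:R else 0).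
  have M1 : (M.-1 < M)%N by lia.
  have yM : y M.-1 = if d.2 then M%:R^-1 else 1 - M%:R^-1.
    rewrite /y; have -> : M.-1%:R = M%:R - 1 :> R by rewrite -subn1 natrB //; lia.
    by rewrite mulrBl divff ?gt_eqF // mul1r; case: d.2 => //; ring.
  have yM01 : 0 <= y M.-1 <= 1 by rewrite yM; case: d.2; lra.
  have yM2 : y M.-1 != 2^-1.
    by rewrite yM; case: d.2; apply/eqP; lra.
  rewrite /hstep (@flips1 S d.1) //; last first.
    move=> e' /negPf h; have [b ->] := hM e'.
    by rewrite cP // [d.1 == _]eq_sym h; case: (flip0b b).
  rewrite (cP d.1) // eqxx (cP e) //; have [b ->] := hM d.1; have [h1 _] := circ_vertex b yM01 yM2.
  rewrite h1 andbF; congr (_ + _); case: eqP => _; last first.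
    by have [b' ->] := hM e; case: (flip0b b').
  have [b' ->] := hM e; have [_ ->] := circ_vertex b' yM01 yM2; rewrite yM /sgd; case: d.2.
    by rewrite ifT; lra.
  by rewrite ifF; lra.
have key k z : (k < M)%N -> hol S e P k z =
    (if (d.1 \in S) && ((y 0 < 2^-1) (+) (y k < 2^-1)) then - z else z) +
    (if d.1 == e then k%:R * (sgd d / M%:R) else 0).
  elim: k z => [|k IH] z kM /=.
    by rewrite addbb andbF mul0r; case: eqP; rewrite addr0.
  rewrite IH ?step //; last lia.
  have -> : circ_flip (y k) (y k.+1) = (y k < 2^-1) (+) (y k.+1 < 2^-1).
    rewrite /circ_flip yk; set f := (_ < `| _ |); suff -> : f = false by rewrite addbF.
    apply/negbTE; rewrite /f -leNgt /sgd.
    case: d.2; rewrite ?mulN1r ?mul1r ?normrN gtr0_norm //; lra.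
  rewrite -natr1; case: eqP => [de|_]; first by rewrite de (negPf eS) /=; ring.
  case: (d.1 \in S); rewrite /= ?addr0 //.
  by case: (y 0 < _); case: (y k < _); case: (y k.+1 < _) => /=; ring.
have E : M = M.-1.+1 by lia.
rewrite [in LHS]E /= -E last_step key; last lia.
have hy : (y 0 < 2^-1) (+) (y M.-1 < 2^-1).
  rewrite /y; have -> : M.-1%:R = M%:R - 1 :> R by rewrite -subn1 natrB //; lia.
  rewrite mulrBl divff ?gt_eqF // mul1r mul0r; case: d.2.
    by rewrite subr0 ltNge (_ : 2^-1 <= 1); [rewrite /=|]; lra.
  have -> : (0 < 2^-1 :> R) by lra.
  by rewrite /= -leNgt; lra.
rewrite hy andbT /dmap; case: eqP => [de|_]; last by rewrite !addr0.
rewrite de (negPf eS) -addrA; congr (_ + _).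
have -> : M.-1%:R = M%:R - 1 :> R by rewrite -subn1 natrB //; lia.
by field; rewrite gt_eqF.
Qed.

End LoopHolonomy.

Section LoopTranslation.
Variables (R : realType) (G : multigraph) (l : edge G -> R).
Implicit Types (d : dart G) (S : seq (edge G)) (e : edge G).

Lemma sample_loop d0 c M i k : closed_path c -> (k < M)%N ->
  sample (gloop d0 c : R -> mgraph l) (size c * M) (i * M + k)%N =
  dpt l (cdart d0 c i%:Z) (k%:R / M%:R).
Proof.
move=> cc kM; have n0 := size_closed_gt0 cc.
have M0 : (0 < M%:R :> R) by rewrite ltr0n; lia.
rewrite /sample /gloop natrM natrD natrM; set n := size c in n0 *.
have -> : n%:R * ((i%:R * M%:R + k%:R) / (n%:R * M%:R)) = (i%:Z)%:~R + k%:R / M%:R :> R.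
  rewrite -pmulrn; field; rewrite !gt_eqF // ltr0n //.
by rewrite gpathE // divr_ge0 ?ler0n //= ltr_pdivrMr // mul1r ltr_nat.
Qed.

Lemma hol_loop d0 c S e M (x : R) : closed_path c -> (2 < M)%N -> uniq S -> e \notin S ->
  hol S e (sample (gloop d0 c : R -> mgraph l) (size c * M)) (size c * M) x =
  foldr (dmap S e) x c.
Proof.
move=> cc M2 uS eS; have n0 := size_closed_gt0 cc.
have hs i k := @sample_loop d0 c M i k cc; set n := size c in n0 hs *.
suff key i z : (i <= n)%N ->
    hol S e (sample (gloop d0 c : R -> mgraph l) (n * M)) (i * M) z =
    foldr (dmap S e) z (take i c).
  by rewrite key // take_size.
elim: i z => [|i IH] z iN; first by rewrite mul0n take0.
rewrite mulSn addnC hol_add IH; last exact: ltnW.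
rewrite (take_nth d0) // foldr_rcons; congr foldr.
rewrite (@hol_dart R G l S e (nth d0 c i)) //.
  by move=> k kM; rewrite hs // cdart_nat.
move=> e'; have -> : (i * M + M = i.+1 * M + 0)%N by rewrite mulSn addn0 addnC.
rewrite hs; last lia.
by rewrite mul0r; apply: (ecoord_vertex e' (dpt_src l _)).
Qed.

Lemma foldr_dmap_avoid S e (x : R) c : e \notin edges c -> ~~ has (mem S) (edges c) ->
  foldr (dmap S e) x c = x.
Proof.
elim: c => //= d c IH; rewrite inE !negb_or => /andP[h1 h2] /andP[h3 h4].
by rewrite IH // /dmap (negPf h3) eq_sym (negPf h1) addr0.
Qed.

(** A circle that crosses a single cut changes the sheet. *)
Lemma foldr_dmap_flip S e (x : R) c e' : e \notin edges c -> uniq (edges c) ->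
  e' \in S -> e' \in edges c -> (forall e1, e1 \in S -> e1 \in edges c -> e1 = e') ->
  foldr (dmap S e) x c = - x.
Proof.
move=> ec uc e'S /(edgesP c)[d dc e'd] h.
move: ec uc h; case/splitPr: dc => c1 c2.
rewrite /edges map_cat /= mem_cat inE !negb_or cat_uniq /= => /and3P[h1 h2 h3] /and3P[h4 h5 h6] h.
rewrite foldr_cat /= (@foldr_dmap_avoid _ _ _ c2) //; last first.
  apply/hasPn => e1 e1c; apply/negP => e1S.
  have := h e1 e1S; rewrite mem_cat inE e1c !orbT => /(_ isT) E.
  by move/andP: h6 => [/negP h6 _]; apply: h6; rewrite -e'd -E.
rewrite foldr_dmap_avoid //; last first.
  apply/hasPn => e1 e1c; apply/negP => e1S.
  have := h e1 e1S; rewrite mem_cat inE e1c => /(_ isT) E.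
  by move: h5; rewrite negb_or => /andP[/negP h5 _]; apply: h5; rewrite -e'd -E.
by rewrite /dmap -e'd e'S eq_sym e'd (negPf h2) addr0.
Qed.

Lemma foldr_dmap_once S e (x : R) c d : d \in c -> d.1 = e -> uniq (edges c) ->
  ~~ has (mem S) (edges c) -> foldr (dmap S e) x c = x + sgd R d.
Proof.
move=> dc de + /hasPn hS; have dS : d.1 \notin S by apply: hS; apply/edgesP; exists d.
have {}hS s : {subset s <= c} -> ~~ has (mem S) (edges s).
  by move=> sc; apply/hasPn => _ /edgesP[d' d's ->]; apply: hS; apply/edgesP; exists d' => //; exact: sc.
move: hS; case/splitPr: dc => c1 c2 hS.
rewrite /edges map_cat /= cat_uniq /= de negb_or => /and3P[_ /andP[h5 _] /andP[h6 _]].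
rewrite foldr_cat /= (@foldr_dmap_avoid S e _ c2) //; last first.
  by apply: hS => d' h; rewrite mem_cat inE h !orbT.
rewrite (@foldr_dmap_avoid S e _ c1) //; last by apply: hS => d' h; rewrite mem_cat h.
by rewrite /dmap (negPf dS) de eqxx.
Qed.

Lemma translation_sgd e (F : R -> R) d : (forall x, F x = x + sgd R d) -> translation F 1.
Proof. by rewrite /sgd; case: d.2 => h; [right|left]. Qed.

Lemma embedded_crossing c e : embedded_circle c -> e \in edges c ->
  translation (fun x : R => foldr (dmap [::] e) x c) 1 /\ count_mem e (edges c) = 1%N.
Proof.
move=> /and3P[_ _ uc] ec; have /edgesP[d dc de] := ec; split; last by rewrite count_uniq_mem // ec.
by apply: (@translation_sgd e _ d) => x; apply: foldr_dmap_once => //; exact/hasPn.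
Qed.

Lemma dmap_revp S e (x : R) w d : d \in w -> d.1 = e -> uniq (edges w) ->
  ~~ has (mem S) (edges w) -> foldr (dmap S e) x (revp w) = x - sgd R d.
Proof.
move=> dw de uw hw; rewrite (@foldr_dmap_once S e x _ (drev d)) //.
- by rewrite /sgd /=; case: d.2 => /=; rewrite ?opprK.
- by rewrite mem_revp drevK.
- by rewrite edges_revp rev_uniq.
- by rewrite edges_revp has_rev.
Qed.

(** Without cuts, the two crossings of an edge of [w] cancel.  Cuts on one edge of
    [u] and one edge of [v] reverse the sign between them, and once more at the
    end, so the crossings add up.  The edges of [u] and [v], crossed only once,
    are treated without cuts. *)
Lemma barbell_crossing (u v w : seq (dart G)) e (eu ev : edge G) :
  let c := u ++ w ++ v ++ revp w in
  uniq (edges (u ++ w ++ v)) -> eu \in edges u -> ev \in edges v -> e \in edges c ->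
  exists S, [/\ e \notin S, uniq S, {subset S <= [:: eu; ev]} &
    translation (fun x : R => foldr (dmap S e) x c) (count_mem e (edges c))%:R].
Proof.
move=> c uc euu evv ec.
have E : edges c = edges (u ++ w ++ v) ++ rev (edges w).
  by rewrite /c !catA /edges map_cat; congr (_ ++ _); rewrite -/(edges _) edges_revp.
have cnt : count_mem e (edges c) = (1 + (e \in edges w))%N.
  rewrite E count_cat count_uniq_mem // count_uniq_mem ?rev_uniq.
    rewrite mem_rev; suff -> : e \in edges (u ++ w ++ v) by [].
    move: ec; rewrite E mem_cat mem_rev; case/orP => // h.
    rewrite /edges !map_cat !mem_cat; apply/orP; right; apply/orP; left; exact: h.
  by move: uc; rewrite /edges !map_cat !cat_uniq => /and3P[_ _ /and3P[]].
rewrite cnt; move: (uc); rewrite [edges _]/edges !map_cat !cat_uniq has_cat negb_or -!/(edges _).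
move=> /and3P[uu /andP[nuw nuv] /and3P[uw nwv uv]].
have [ew|ew] := boolP (e \in edges w); last first.
  exists [::]; rewrite addn0; split => //.
  have /edgesP[d dc de] : e \in edges (u ++ w ++ v).
    by move: ec; rewrite E mem_cat mem_rev (negPf ew) orbF.
  apply: (@translation_sgd e _ d) => x; rewrite /c !catA foldr_cat.
  rewrite (@foldr_dmap_avoid _ _ _ (revp w)) ?edges_revp ?mem_rev //; last exact/hasPn.
  by rewrite -catA; apply: foldr_dmap_once => //; exact/hasPn.
have eNu : e \notin edges u by move/hasPn: nuw => /(_ e ew).
have eNv : e \notin edges v.
  by apply/negP => h; move/hasPn: nwv => /(_ e h); rewrite /= ew.
have evNu : ev \notin edges u by move/hasPn: nuv => /(_ ev evv).
have euNw : eu \notin edges w.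
  by apply/negP => h; move/hasPn: nuw => /(_ eu h); rewrite /= euu.
have evNw : ev \notin edges w by move/hasPn: nwv => /(_ ev evv).
have euNv : eu \notin edges v.
  by apply/negP => h; move/hasPn: nuv => /(_ eu h); rewrite /= euu.
have neuv : eu != ev by apply: contraNneq evNu => <-.
exists [:: eu; ev]; split => //.
- rewrite !inE negb_or; apply/andP; split.
    by apply: contraNneq eNu => ->.
  by apply: contraNneq eNv => ->.
- by rewrite /= inE neuv.
have /edgesP[d dw de] := ew.
have hSw : ~~ has (mem [:: eu; ev]) (edges w).
  apply/hasPn => e1 e1w /=; rewrite !inE negb_or; apply/andP; split.
    by apply: contraNneq euNw => <-.
  by apply: contraNneq evNw => <-.
suff FE x : foldr (dmap [:: eu; ev] e) x c = x - 2 * sgd R d.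
  move: FE; rewrite /sgd; case: d.2 => FE; [left|right] => x.
    by rewrite FE -[(1 + true)%N]/2%N; ring.
  by rewrite FE -[(1 + true)%N]/2%N; ring.
rewrite /c !foldr_cat (@dmap_revp _ e x w d) // (@foldr_dmap_flip _ e _ v ev) //; first last.
- by move=> e1; rewrite !inE => /orP[/eqP ->|/eqP -> //]; rewrite (negPf euNv).
- by rewrite !inE eqxx orbT.
rewrite (@foldr_dmap_once _ e _ w d) // (@foldr_dmap_flip _ e _ u eu) //; first last.
- by move=> e1; rewrite !inE => /orP[/eqP -> //|/eqP ->]; rewrite (negPf evNu).
- by rewrite !inE eqxx.
by ring.
Qed.

End LoopTranslation.

(** * Lower bound for the slope *)
Section Chains.
Variables (R : realType) (G : multigraph) (l : edge G -> R).
Hypothesis l_ge0 : forall e, 0 <= l e.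
Implicit Types p q : mgraph l.

Lemma chain_ge0 p q c : chain p q c -> 0 <= c.
Proof. by elim=> // *; rewrite addr_ge0 ?mulr_ge0. Qed.

Lemma gdist_le p q c : chain p q c -> gdist p q <= c.
Proof.
move=> pq; apply: ge_inf => //; exists 0 => y; exact: chain_ge0.
Qed.

Lemma chain_approx p q c eps : chain p q c -> 0 < eps ->
  exists2 x, chain p q x & x < gdist p q + eps.
Proof.
move=> pq e0; have hi : has_inf [set c | chain p q c].
  by split; [exists c|exists 0 => y; exact: chain_ge0].
by have [x xpq xlt] := inf_adherent e0 hi; exists x.
Qed.

End Chains.

Section CountSum.
Variables (R : realType) (G : multigraph).

Lemma path_sum_count (f : edge G -> R) (c : seq (dart G)) :
  path_sum f c = \sum_e f e * (count_mem e (edges c))%:R.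
Proof.
elim: c => [|d c IH]; first by rewrite path_sum_nil big1 // => e _; rewrite mulr0.
rewrite path_sum_cons IH.
have -> : f d.1 = \sum_e f e * (d.1 == e)%:R.
  rewrite (bigD1 d.1) //= eqxx mulr1 big1 ?addr0 // => e /negPf.
  by rewrite eq_sym => ->; rewrite mulr0.
by rewrite -big_split; apply: eq_bigr => e _ /=; rewrite -mulrDr natrD.
Qed.

(** The samples of a loop come in blocks of [M], one for each dart. *)
Lemma sum_blocks (b : nat -> R) (w : dart G -> R) d0 (c : seq (dart G)) M :
  (forall i k, (i < size c)%N -> (k < M)%N -> b (i * M + k)%N <= w (nth d0 c i) / M%:R) ->
  (0 < M)%N -> \sum_(j < size c * M) b j <= \sum_(d <- c) w d.
Proof.
move=> hb M0; rewrite -(big_mkord xpredT b).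
suff key i : (i <= size c)%N ->
    \sum_(0 <= j < i * M) b j <= \sum_(d <- take i c) w d.
  by have := key _ (leqnn (size c)); rewrite take_size.
elim: i => [|i IH] ic; first by rewrite mul0n big_geq // take0 big_nil.
rewrite (take_nth d0) // -cats1 big_cat big_seq1 /= (big_cat_nat (n := i * M)) //=; last first.
  by rewrite leq_mul2r leqnSn orbT.
apply: lerD; first by apply: IH; exact: ltnW.
rewrite -{1}[(i * M)%N]add0n big_addn mulSn addnK.
apply: (@le_trans _ _ (\sum_(0 <= k < M) w (nth d0 c i) / M%:R)).
  by rewrite !big_nat; apply: ler_sum => k /andP[_ kM]; rewrite addnC; exact: hb.
rewrite sumr_const_nat subn0 -[leLHS]mulr_natr divfK // pnatr_eq0; lia.
Qed.

End CountSum.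

Section Stretch.
Variables (R : realType) (G : multigraph).
Variables (l l' : edge G -> R).
Hypothesis l_ge0 : forall e, 0 <= l e.
Hypothesis l'_ge0 : forall e, 0 <= l' e.

(** Some holonomy of [c] translates by the number of times that [c] crosses [e],
    so that no homotopy can reduce this number. *)
Definition detects (c : seq (dart G)) e := exists S,
  [/\ e \notin S, uniq S, forall e', e' \in S -> 0 < l' e' &
    translation (fun x : R => foldr (dmap S e) x c) (count_mem e (edges c))%:R].

Lemma continuous_zero (f : mgraph l -> mgraph l') p q eps : continuous f ->
  chain p q 0 -> 0 < eps -> gball (f p) eps (f q).
Proof.
move=> fc pq e0; have /cvg_ballP/(_ _ e0) h := fc p.
have /nbhs_ballP[r r0 hr] := h; apply: (hr q).
by exists 0.
Qed.

Lemma homotopic_loop (X : pseudoMetricType R) (f g : realization R G -> X)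
    (a : R -> realization R G) : homotopic R f g -> is_loop a ->
  freely_homotopic (f \o a) (g \o a).
Proof.
move=> [H [Hc H0 H1]] [ac aper]; exists (fun s t => H s (a t)); split.
- apply/subspace_continuousP => -[s t] /= s01; apply/cvg_ballP => eps e0.
  have [r r0 hr] := within_ball (x := (s, a t)) Hc s01 e0.
  have /cvg_ballP/(_ _ r0) hat := ac t.
  have hat2 : \forall p \near nbhs (s, t), ball (a t) r (a p.2).
    exact: (@cvg_snd _ _ (nbhs s) (nbhs t) _ _ hat).
  near=> p; apply: (hr (p.1, a p.2)); first by near: p; exact: withinT.
  split => /=.
    near: p; apply: cvg_within; apply: (cvg_fst (F := nbhs s) (G := nbhs t)).
    exact: nbhsx_ballx.
  by near: p; apply: cvg_within; exact: hat2.
- by move=> s _ t; rewrite aper.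
- by move=> t /=; rewrite H0.
- by move=> t /=; rewrite H1.
Unshelve. all: by end_near. Qed.

(** The image under [f] of the loop [c], sampled finely, crosses every edge [e] at
    least as often as [c] does; weighted by [l' e] these crossings add up to at
    most the length of the image, which is at most the sum of the numbers
    [s e * l e] over the edges of [c].  The edges of length 0 are mapped to points,
    up to an arbitrarily small error. *)
Lemma candidate_stretch (f : mgraph l -> mgraph l') s (d0 : dart G) c :
  continuous f -> homotopic R (f \o collapse l) (collapse l') -> linear_on_edges f s ->
  closed_path c -> (forall e, e \in edges c -> 0 < l' e -> detects c e) ->
  path_sum l' c <= max_slope l s * path_sum l c.
Proof.
move=> fc fh fl cc hc.
have [delta fd] := fine_ex l'; have d_gt0 := fd.1.
pose a : R -> realization R G := gloop d0 c.
have [al at_] := gloop_traverses R d0 cc.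
have fha := homotopic_loop fh al.
pose w (d : dart G) : R := if 0 < l d.1 then s d.1 * l d.1 else 0.
have n0 := size_closed_gt0 cc.
have N_ex : forall e, exists N0 : nat, e \in edges c -> 0 < l' e ->
    forall M, (N0 <= size c * M)%N -> (2 < M)%N ->
    (forall j, (j < size c * M)%N -> gball (sample (f \o collapse l \o a) (size c * M) j) delta
       (sample (f \o collapse l \o a) (size c * M) j.+1)) /\
    (count_mem e (edges c))%:R <= \sum_(j < size c * M)
      `|circ_inc (ecoord e (sample (f \o collapse l \o a) (size c * M) j))
                 (ecoord e (sample (f \o collapse l \o a) (size c * M) j.+1))|.
  move=> e; case: (pselect (e \in edges c /\ 0 < l' e)) => [[ec e0]|h]; last first.
    by exists 0%N => h1 h2; case: h.
  have [S [eS uS S0 tr]] := hc e ec e0.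
  have [N0 hN0] := homotopy_translation l'_ge0 fd e0 S0 eS fha.
  exists N0 => _ _ M NM M2; have [hb ht] := hN0 _ NM; split => //.
  rewrite -[leLHS]ger0_norm ?ler0n //; apply: translation_le; apply: ht.
  case: tr => tr; [left|right] => x; rewrite -tr;
    exact: (hol_loop l' d0 x cc M2 uS eS).
have /choice[N1 hN1] := N_ex.
have w_ge0 d : 0 <= w d.
  rewrite /w; case: ifP => // ld; have [s0 _] := fl _ ld.
  by rewrite mulr_ge0 // ltW.
have M_ex : forall d : dart G, exists M0 : nat, forall M, (M0 <= M)%N ->
    w d / M%:R < delta / 2 /\
    (0 < l d.1 -> forall t t' : {i01 R}, `|t%:num - t'%:num| <= M%:R^-1 ->
       gdist (f (d.1, t)) (f (d.1, t')) = s d.1 * (l d.1 * `|t%:num - t'%:num|)).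
  move=> d; case: (ltP 0 (l d.1)) => ld; last first.
    exists 0%N => M _; split => //; rewrite /w ifF ?mul0r ?divr_gt0 //.
    by apply/negbTE; rewrite -leNgt.
  have [_ [dl dl0 hdl]] := fl _ ld.
  exists (Num.truncn (Num.max (w d / (delta / 2)) dl^-1)).+1 => M hM.
  have hM' : Num.max (w d / (delta / 2)) dl^-1 < M%:R.
    by apply: lt_le_trans (truncnS_gt _) _; rewrite ler_nat.
  have M0 : 0 < M%:R :> R by rewrite ltr0n; lia.
  move: hM'; rewrite gt_max => /andP[h1 h2]; split.
    by rewrite ltr_pdivrMr // mulrC -ltr_pdivrMr ?divr_gt0.
  move=> _ t t' tt'; apply: hdl; apply: le_lt_trans tt' _.
  by rewrite -[dl]invrK ltf_pV2 ?posrE ?invr_gt0.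
have /choice[M1 hM1] := M_ex.
pose M := (3 + \max_e N1 e + \max_d M1 d)%N.
have M2 : (2 < M)%N by rewrite /M; lia.
have M0 : (0 < M%:R :> R) by rewrite ltr0n; lia.
have NM e : (N1 e <= size c * M)%N.
  have h : (N1 e <= \max_e N1 e)%N by exact: leq_bigmax.
  by apply: (leq_trans (n := M)); [rewrite /M; lia|rewrite leq_pmull].
have MM d : (M1 d <= M)%N.
  have h : (M1 d <= \max_d M1 d)%N by exact: leq_bigmax.
  by rewrite /M; lia.
pose P := sample (f \o collapse l \o a) (size c * M).
pose b j := \sum_e l' e * `|circ_inc (ecoord e (P j)) (ecoord e (P j.+1))|.
have max_ge0 : 0 <= max_slope l s.
  apply: (big_ind (fun x : R => 0 <= x)) => // [x y x0 _|e0 le0].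
    by rewrite le_max x0.
  by have [] := fl _ le0.
have [|none] := pselect (exists2 e, e \in edges c & 0 < l' e); last first.
  rewrite path_sum_count big1 => [|e _].
    by rewrite mulr_ge0 // /path_sum; apply: sumr_ge0.
  have [ec|ec] := boolP (e \in edges c); last by rewrite (count_memPn ec) mulr0.
  have -> : l' e = 0.
    by apply/eqP; rewrite eq_le l'_ge0 andbT leNgt; apply/negP => h; apply: none; exists e.
  by rewrite mul0r.
move=> [e1 e1c e10]; have [hball _] := hN1 e1 e1c e10 M (NM e1) M2.
have sum_b : path_sum l' c <= \sum_(j < size c * M) b j.
  rewrite path_sum_count /b exchange_big /=; apply: ler_sum => e _.
  rewrite -mulr_sumr; have [e0|e0] := ltP 0 (l' e); last first.
    have -> : l' e = 0 by apply/eqP; rewrite eq_le l'_ge0 e0.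
    by rewrite !mul0r.
  rewrite ler_wpM2l //; have [ec|ec] := boolP (e \in edges c).
    by have [_] := hN1 e ec e0 M (NM e) M2.
  by rewrite (count_memPn ec); apply: sumr_ge0.
apply: (le_trans sum_b); apply: (@le_trans _ _ (\sum_(d <- c) w d)); last first.
  rewrite /path_sum mulr_sumr; apply: ler_sum => d _; rewrite /w.
  case: ifP => ld; last by rewrite mulr_ge0.
  by rewrite ler_wpM2r // /max_slope; exact: le_bigmax_cond.
apply: (sum_blocks (d0 := d0)) => // i k ic kM.
have jM : (i * M + k < size c * M)%N.
  by apply: (leq_trans (n := i.+1 * M)); [rewrite mulSn addnC ltn_add2r|rewrite leq_mul2r ic orbT].
set d := nth d0 c i.
have k01 m : (m <= M)%N -> 0 <= (m%:R / M%:R : R) <= 1.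
  by move=> mM; rewrite divr_ge0 ?ler0n //= ler_pdivrMr // mul1r ler_nat.
have Pj : P (i * M + k)%N = f (dpt l d (k%:R / M%:R)).
  by rewrite /d -(cdart_nat d0 ic) -(sample_loop l d0 i cc kM).
have Pj1 eps : 0 < eps -> gball (f (dpt l d (k.+1%:R / M%:R))) eps (P (i * M + k).+1%N).
  move=> eps0; have [k1M|k1M] := ltnP k.+1 M.
    have -> : P (i * M + k).+1%N = f (dpt l d (k.+1%:R / M%:R)); last by exists 0 => //; exact: chain_nil.
    by rewrite -addnS /d -(cdart_nat d0 ic) -(sample_loop l d0 i cc k1M).
  have kE : k.+1 = M by apply/eqP; rewrite eqn_leq kM k1M.
  rewrite kE divff ?gt_eqF //.
  have -> : P (i * M + k).+1%N = f (dpt l (cdart d0 c (i%:Z + 1)) 0).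
    have -> : (i * M + k).+1%N = (i.+1 * M + 0)%N by rewrite mulSn addn0 -addnS kE addnC.
    have -> : i%:Z + 1 = i.+1%:Z by rewrite -PoszD addn1.
    have := @sample_loop R G l d0 c M i.+1 0%N cc (ltn_trans (isT : (0 < 2)%N) M2).
    by rewrite mul0r => <-.
  apply: continuous_zero => //; apply: (chain_same_vertex (dpt_tgt _ _)).
  by rewrite /d -(cdart_nat d0 ic) (cdart_follows d0 cc); exact: dpt_src.
have [wM hM] := hM1 d M (MM d).
have bnd eps : 0 < eps -> eps < delta / 2 -> b (i * M + k)%N <= w d / M%:R + eps.
  move=> eps0 epsd.
  suff [x [px xlt]] : exists x, chain (P (i * M + k)%N) (P (i * M + k).+1%N) x /\
      x < w d / M%:R + eps.
    have xd : x < delta by rewrite (splitr delta); apply: (lt_trans xlt); exact: ltrD.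
    have [_ hb] := chain_near l'_ge0 fd px xd.
    exact: (le_trans hb (ltW xlt)).
  have e2 : 0 < eps / 2 by rewrite divr_gt0.
  have [y py ylt] := Pj1 _ e2.
  suff [z pz zlt] : exists2 z, chain (P (i * M + k)%N) (f (dpt l d (k.+1%:R / M%:R))) z &
      z < w d / M%:R + eps / 2.
    exists (z + y); split; first exact: chain_trans pz py.
    by apply: (lt_le_trans (ltrD zlt ylt)); rewrite -addrA -splitr.
  rewrite Pj; have [ld|ld] := ltP 0 (l d.1); last first.
    have l0 : l d.1 = 0 by apply/eqP; rewrite eq_le ld l_ge0.
    have := chain_dpt l d (k01 k (ltnW kM)) (k01 k.+1 kM); rewrite l0 mul0r => h.
    have [z pz zlt] := continuous_zero fc h e2.
    by exists z; rewrite // /w l0 ltxx mul0r add0r.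
  have [x0 px0 _] := hball _ jM; rewrite -/P Pj in px0.
  have c0 := chain_trans px0 (chain_sym py).
  have [z pz zlt] := chain_approx l'_ge0 c0 e2; exists z => //.
  apply: (lt_le_trans zlt); rewrite lerD2r /dpt.
  have num m : (m <= M)%N -> (clamp01 (if d.2 then 1 - m%:R / M%:R else m%:R / M%:R) : {i01 R})%:num =
      if d.2 then 1 - m%:R / M%:R else m%:R / M%:R.
    by move=> mM; rewrite clamp01K //; have := k01 m mM; case: d.2; lra.
  have nE : `|(clamp01 (if d.2 then 1 - k%:R / M%:R else k%:R / M%:R) : {i01 R})%:num -
      (clamp01 (if d.2 then 1 - k.+1%:R / M%:R else k.+1%:R / M%:R) : {i01 R})%:num| = M%:R^-1.
    rewrite !num //; last exact: ltnW.
    rewrite -(natr1 k) mulrDl mul1r; case: d.2.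
      have -> : forall u v : R, 1 - u - (1 - (u + v)) = v by move=> *; ring.
      by rewrite gtr0_norm ?invr_gt0.
    have -> : forall u v : R, u - (u + v) = - v by move=> *; ring.
    by rewrite normrN gtr0_norm ?invr_gt0.
  rewrite hM ?nE // /w ld mulrA; exact: lexx.
apply/ler_addgt0Pr => eps eps0.
have em : 0 < Num.min eps (delta / 4) by rewrite lt_min eps0 divr_gt0.
apply: le_trans (bnd _ em _) _; last by rewrite lerD2l ge_min lexx.
rewrite gt_min; apply/orP; right; rewrite ltr_pM2l // ltf_pV2 ?posrE //; lra.
Qed.

End Stretch.

(** * Potentials *)
Lemma sum_cts (R : realType) (T : topologicalType) (I : Type) (r : seq I) (F : I -> T -> R) :
  (forall i, continuous (F i)) -> continuous (fun x => \sum_(i <- r) F i x).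
Proof.
move=> hF; elim: r => [|i r IH].
  rewrite (_ : (fun x => _) = cst 0); first exact: cst_continuous.
  by apply/funext => x; rewrite big_nil.
rewrite (_ : (fun x => _) = (fun x => F i x + \sum_(j <- r) F j x)).
  by move=> x; apply: continuousD; [exact: hF|exact: IH].
by apply/funext => x; rewrite big_cons.
Qed.

Section Potentials.
Variables (R : realType) (G : multigraph).
Hypothesis valence_gt2 : forall x : vertex G, (2 < valence x)%N.
Implicit Types (d : dart G) (p : seq (dart G)) (phi : dart G -> R).

Lemma third_dart (a b : dart G) (x : vertex G) :
  exists d, [/\ dsrc d = x, d != a & d != b].
Proof.
have [[d /and3P[/eqP h1 h2 h3]]|none] := pselect (exists d, [&& dsrc d == x, d != a & d != b]).
  by exists d.
have : (#|[pred d : dart G | dsrc d == x]| <= #|pred2 a b|)%N.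
  apply: subset_leq_card; apply/fintype.subsetP => d; rewrite !inE => h.
  apply/negPn; rewrite negb_or; apply/negP => /andP[h1 h2]; apply: none; exists d.
  by rewrite h h1.
have := valence_gt2 x; rewrite /valence card2; case: (a != b) => /=; lia.
Qed.

(** When [phi d] is the length gained by the edge of [d] at its source, a path that
    turns from one dart to another at a vertex does not become shorter. *)
Definition turns_ge0 phi := forall d d', d != d' -> dsrc d = dsrc d' -> 0 <= phi d + phi d'.

Section Bellman.
Variable f : edge G -> R.
Hypothesis f_le0 : forall c : seq (dart G), immersed c -> path_sum f c <= 0.

(** Cutting out the loop between two passages through the same dart does not
    decrease the sum, as [f] is nonpositive on this loop. *)
Lemma path_sum_bounded p : sorted (@nonback G) p ->
  path_sum f p <= \sum_(d : dart G) `|f d.1|.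
Proof.
elim: {p}(size p).+1 {-2}p (ltnSn (size p)) => // n IH p pn sp.
have [up|/nuniq_split[d [s1 [s2 [s3 E]]]]] := boolP (uniq p).
  rewrite /path_sum; apply: (@le_trans _ _ (\sum_(d <- p) `|f d.1|)).
    by apply: ler_sum => d _; exact: ler_norm.
  rewrite big_uniq // big_mkcond; apply: ler_sum => d _ /=.
  by case: ifP.
have s3S : sorted (@nonback G) ((d :: s2) ++ (d :: s3)).
  by move: sp; rewrite E; exact: sorted_cat_r.
move: s3S; rewrite (sorted_catE _ d) //= => /and3P[h1 h2 h3].
have il : immersed (d :: s2) by rewrite immersedE (cycleE _ d) //= h1.
have sq : sorted (@nonback G) (s1 ++ d :: s3).
  have [s10|s10] := eqVneq s1 [::]; first by rewrite s10.
  rewrite (sorted_catE _ d) //= h3 andbT; move: sp; rewrite E (sorted_catE _ d) //=.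
  by case/and3P => -> ->.
have := IH (s1 ++ d :: s3); rewrite E in pn *.
rewrite !(path_sum_cat, path_sum_cons) => h.
have {}h := h ltac:(move: pn; rewrite !size_cat /=; lia) sq.
by have := f_le0 il; rewrite path_sum_cons; lra.
Qed.

(** The sums of [f] along the paths that start by [d]. *)
Definition exits d : set R :=
  [set x | exists p, sorted (@nonback G) (d :: p) /\ x = path_sum f (d :: p)].

Lemma exits_sup d : has_sup (exits d).
Proof.
split; first by exists (path_sum f [:: d]), [::].
exists (\sum_(d : dart G) `|f d.1|) => _ [p [sp ->]]; exact: path_sum_bounded.
Qed.

Lemma exits_step d d' : nonback d d' -> f d.1 + sup (exits d') <= sup (exits d).
Proof.
move=> dd'; rewrite addrC -lerBrDr; apply: ge_sup.
  by exists (path_sum f [:: d']), [::].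
move=> _ [p [sp ->]]; rewrite lerBrDr addrC -path_sum_cons.
apply: ub_le_sup; first by have [] := exits_sup d.
by exists (d' :: p); split => //=; rewrite dd'.
Qed.

Definition feasible phi :=
  (forall d, phi d + phi (drev d) <= - f d.1) /\ turns_ge0 phi.

(** By [exits_step] the suprema are a dual solution of the linear problem of
    maximising [f] over loops.  Taking the difference of the two orientations gives
    equality on the edges [potential_edge]. *)
Definition potential d : R := (sup (exits (drev d)) - sup (exits d) - f d.1) / 2.

Lemma potential_edge d : potential d + potential (drev d) = - f d.1.
Proof. by rewrite /potential drevK /=; lra. Qed.

Lemma potential_feasible : feasible potential.
Proof.
split=> [d|d d' dd' sd]; first by rewrite potential_edge.
have := @exits_step (drev d) d'; rewrite nonback_out sd eqxx dd' => /(_ isT) h1.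
have := @exits_step (drev d') d; rewrite nonback_out sd eqxx eq_sym dd' => /(_ isT) h2.
by rewrite /potential /= in h1 h2 *; lra.
Qed.

End Bellman.

(** At most one value at a vertex is negative, say [- r]; then the others are at
    least [r], and there are two of them. *)
Lemma vertex_sum phi (d0 : dart G) : turns_ge0 phi ->
  `|phi d0| <= \sum_(d : dart G | dsrc d == dsrc d0) phi d.
Proof.
move=> tp; set x := dsrc d0; set S := \sum_(_ | _) _.
have three a b c : dsrc a = x -> dsrc b = x -> dsrc c = x -> a != b -> a != c -> b != c ->
    (forall d, dsrc d = x -> d != a -> d != b -> d != c -> 0 <= phi d) ->
    phi a + phi b + phi c <= S.
  move=> ax bx cx ab ac bc h.
  rewrite /S (bigD1 a) ?ax ?eqxx //= (bigD1 b) ?bx ?eqxx ?(eq_sym b) ?ab //=.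
  rewrite (bigD1 c) ?cx ?eqxx ?(eq_sym c) ?ac ?bc //= !addrA lerDl.
  apply: sumr_ge0 => d /andP[/andP[/andP[/eqP h1 h2] h3] h4]; exact: h.
have [[m [mx m0]]|pos] := pselect (exists m, dsrc m = x /\ phi m < 0).
  have ge d : dsrc d = x -> d != m -> - phi m <= phi d.
    by move=> dx dm; have := tp d m dm; rewrite dx mx => /(_ erefl); lra.
  have ge0 d : dsrc d = x -> d != m -> 0 <= phi d by move=> h1 h2; have := ge d h1 h2; lra.
  have [->|d0m] := eqVneq d0 m.
    have [a [ax am _]] := third_dart m m x; have [b [bx bm ba]] := third_dart m a x.
    have := three m a b mx ax bx; rewrite (eq_sym m) am (eq_sym m) bm eq_sym ba.
    move=> /(_ isT isT isT) h; have := h (fun d h1 h2 _ _ => ge0 d h1 h2).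
    have := ge a ax am; have := ge b bx bm; rewrite ltr0_norm //; lra.
  have [b [bx bm ba]] := third_dart m d0 x.
  have := three m d0 b mx erefl bx; rewrite (eq_sym m) d0m (eq_sym m) bm eq_sym ba.
  move=> /(_ isT isT isT) h; have := h (fun d h1 h2 _ _ => ge0 d h1 h2).
  have := ge0 d0 erefl d0m; have := ge b bx bm => h1 h2; rewrite ger0_norm //; lra.
have ge0 d : dsrc d = x -> 0 <= phi d.
  by move=> dx; rewrite leNgt; apply/negP => h; apply: pos; exists d.
rewrite ger0_norm ?ge0 // /S (bigD1 d0) ?eqxx //= lerDl.
by apply: sumr_ge0 => d /andP[/eqP dx _]; exact: ge0.
Qed.

Lemma total_sum phi (d0 : dart G) : turns_ge0 phi -> `|phi d0| <= \sum_(d : dart G) phi d.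
Proof.
move=> tp; rewrite (partition_big (@dsrc G) predT) //=.
rewrite (bigD1 (dsrc d0)) //=; apply: le_trans (vertex_sum d0 tp) _; rewrite lerDl.
apply: sumr_ge0 => x _; have [d [dx _ _]] := third_dart d0 d0 x.
by rewrite -dx; apply: le_trans (vertex_sum d tp).
Qed.

Lemma sum_darts phi : \sum_(d : dart G) phi d = \sum_e (phi (e, false) + phi (e, true)).
Proof.
have -> : \sum_(d : dart G) phi d = \sum_(p : edge G * bool) phi (p.1, p.2).
  by apply: eq_bigr => -[].
rewrite -(pair_bigA _ (fun e b => phi (e, b))) /=; apply: eq_bigr => e _.
by rewrite big_bool addrC.
Qed.

Section Minimal.
Variable f : edge G -> R.
Hypothesis f_le0 : forall c : seq (dart G), immersed c -> path_sum f c <= 0.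

Definition minimal phi := feasible f phi /\
  forall psi, feasible f psi -> \sum_d phi d <= \sum_d psi d.

Let T := prod_topology (fun _ : dart G => R).

Lemma eval_cts d : continuous (fun phi : T => phi d).
Proof. exact: (@proj_continuous _ (fun _ : dart G => R) d). Qed.

Lemma eval2_closed d d' (c : R) : closed [set phi : T | c <= phi d + phi d'].
Proof.
have -> : [set phi : T | c <= phi d + phi d'] =
    (fun phi : T => phi d + phi d') @^-1` [set x | c <= x] by [].
apply: preimage_closed; last exact: closed_ge.
by move=> phi _; apply: continuousD; exact: eval_cts.
Qed.

Lemma eval2_closed_le d d' (c : R) : closed [set phi : T | phi d + phi d' <= c].
Proof.
have -> : [set phi : T | phi d + phi d' <= c] =
    (fun phi : T => phi d + phi d') @^-1` [set x | x <= c] by [].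
apply: preimage_closed; last exact: closed_le.
by move=> phi _; apply: continuousD; exact: eval_cts.
Qed.

(** By [total_sum], the feasible functions whose sum does not exceed that of
    [potential f] form a compact set. *)
Lemma minimal_potential : exists phi, minimal phi.
Proof.
pose K := \sum_d potential f d.
pose box : set T := [set phi | forall d, `[- K, K]%classic (phi d)].
pose A : set T := box `&` ((\bigcap_(d in [set: dart G]) [set phi : T | phi d + phi (drev d) <= - f d.1]) `&`
  (\bigcap_(p in [set p : dart G * dart G | p.1 != p.2 /\ dsrc p.1 = dsrc p.2])
     [set phi : T | 0 <= phi p.1 + phi p.2])).
have cA : compact A.
  apply: compact_closedI.
    apply: (@tychonoff (dart G) (fun=> R) (fun=> `[- K, K]%classic)) => d.
    exact: segment_compact.
  apply: closedI; apply: closed_bigI => i _; [exact: eval2_closed_le|exact: eval2_closed].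
have inA phi : feasible f phi -> \sum_d phi d <= K -> A phi.
  move=> [h1 h2] hK; split; last by split=> [d _|p [hp hp']]; [exact: h1|exact: h2].
  move=> d; have := total_sum d h2 => h; rewrite /= in_itv /= -ler_norml.
  exact: le_trans h hK.
have A0 : A !=set0 by exists (potential f); apply: inA => //; exact: potential_feasible.
have [|phi] := @compact_EVT_min T R (fun phi : T => \sum_d phi d) A A0 cA.
  by apply: continuous_subspaceT; apply: sum_cts => d; exact: eval_cts.
rewrite inE => -[_ [h1 h2]] hmin; exists phi.
have fphi : feasible f phi.
  by split=> [d|d d' dd' sd]; [exact: (h1 d I)|exact: (h2 (d, d'))].
split=> // psi fpsi; have [h|/ltW h] := leP (\sum_d psi d) K.
  by apply: hmin; rewrite inE; exact: inA.
apply: le_trans h; apply: hmin; rewrite inE; apply: inA => //; exact: potential_feasible.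
Qed.

Section NormalForm.
Variable phi : dart G -> R.
Hypothesis phi_min : minimal phi.

(** Otherwise the value at [d] could be lowered to minus the least of the other
    values at the same vertex. *)
Lemma minimal_tight d :
  exists d', [/\ d' != d, dsrc d' = dsrc d & phi d + phi d' = 0].
Proof.
have [[h1 h2] hmin] := phi_min.
have [i0 [i0d i0n _]] := third_dart d d (dsrc d).
pose P (d' : dart G) := (d' != d) && (dsrc d' == dsrc d).
have Pi0 : P i0 by rewrite /P i0n i0d eqxx.
case: (Order.TotalTheory.arg_minP phi Pi0) => m /andP[md /eqP ms] hm.
exists m; split => //; apply/eqP; rewrite eq_le; apply/andP; split; last first.
  by apply: h2; rewrite // eq_sym.
rewrite leNgt; apply/negP => pos.
pose psi (x : dart G) := if x == d then - phi m else phi x.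
have psi_le x : psi x <= phi x.
  by rewrite /psi; case: eqP => [->|//]; lra.
have fpsi : feasible f psi.
  split=> [x|x y xy sxy]; first by apply: le_trans (h1 x); exact: lerD.
  rewrite /psi; have [xd|xd] := eqVneq x d; have [yd|yd] := eqVneq y d.
  - by move: xy; rewrite xd yd eqxx.
  - have := hm y; rewrite /P yd -sxy xd eqxx => /(_ isT); lra.
  - have := hm x; rewrite /P xd sxy yd eqxx => /(_ isT); lra.
  - exact: h2.
have := hmin _ fpsi; rewrite leNgt => /negP; apply.
rewrite (bigD1 d) //= [ltRHS](bigD1 d) //=.
have -> : psi d = - phi m by rewrite /psi eqxx.
apply: ltr_leD; first by lra.
by apply: ler_sum => x _; exact: psi_le.
Qed.

(** With [minimal_zero] below: at each vertex [phi] is zero, or [- r] on one dart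
    and [r] on all the others. *)
Lemma minimal_opp d d' : phi d < 0 -> d' != d -> dsrc d' = dsrc d -> phi d' = - phi d.
Proof.
have [[_ h2] _] := phi_min.
move=> d0 d'd ss; have [x [xd' xs x0]] := minimal_tight d'.
have h : 0 <= phi d' + phi d by exact: h2.
have [xE|xd] := eqVneq x d; first by move: x0; rewrite xE; lra.
by have := h2 x d xd; rewrite xs => /(_ ss); lra.
Qed.

Lemma minimal_zero d : (forall d', dsrc d' = dsrc d -> 0 <= phi d') -> phi d = 0.
Proof.
move=> h; have [x [_ xs x0]] := minimal_tight d.
by have := h d erefl; have := h x xs; lra.
Qed.

(** Otherwise the motion of the vertex could be made smaller: raising [phi d] by
    [eps] and lowering the other values at the vertex, at least two, by [eps]
    decreases the total sum. *)
Lemma minimal_saturated d : phi d < 0 -> phi d + phi (drev d) = - f d.1.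
Proof.
have [[h1 h2] hmin] := phi_min.
move=> d0; apply/eqP; rewrite eq_le h1 leNgt; apply/negP => slack.
pose eps := Num.min (- phi d) (- f d.1 - (phi d + phi (drev d))).
have e0 : 0 < eps by rewrite lt_min; apply/andP; split; lra.
have e1 : eps <= - phi d by rewrite ge_min lexx.
have e2 : eps <= - f d.1 - (phi d + phi (drev d)) by rewrite ge_min lexx orbT.
pose psi (x : dart G) := if x == d then phi x + eps else
  if dsrc x == dsrc d then phi x - eps else phi x.
have psi_le x : x != d -> psi x <= phi x.
  by rewrite /psi => /negPf ->; case: ifP => _; lra.
have fpsi : feasible f psi.
  split=> [x|x y xy sxy].
    have key : psi d + psi (drev d) <= - f d.1.
      rewrite {1}/psi eqxx; have := psi_le (drev d) (drev_neq d); lra.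
    have [->|xd] := eqVneq x d; first exact: key.
    have [xr|xr] := eqVneq (drev x) d.
      by have -> : x = drev d; [rewrite -xr drevK|rewrite drevK addrC].
    by apply: le_trans (h1 x); apply: lerD; exact: psi_le.
  rewrite /psi; have [xd|xd] := eqVneq x d; have [yd|yd] := eqVneq y d.
  - by move: xy; rewrite xd yd eqxx.
  - rewrite -sxy xd eqxx; have := h2 d y; rewrite eq_sym yd -xd => /(_ isT sxy); lra.
  - rewrite sxy yd eqxx; have := h2 x d xd; rewrite sxy yd => /(_ erefl); lra.
  - rewrite sxy; case: eqP => ys; last exact: h2.
    rewrite (minimal_opp d0 xd) ?sxy // (minimal_opp d0 yd) //; lra.
have := hmin _ fpsi; rewrite leNgt => /negP; apply.
have [a [as_ ad _]] := third_dart d d (dsrc d); have [b [bs bd ba]] := third_dart d a (dsrc d).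
rewrite (bigD1 d) //= [ltRHS](bigD1 d) //= (bigD1 a) //= [in ltRHS](bigD1 a) //=.
rewrite (bigD1 b) /=; last by rewrite bd ba.
rewrite [in ltRHS](bigD1 b) /=; last by rewrite bd ba.
have -> : psi d = phi d + eps by rewrite /psi eqxx.
have -> : psi a = phi a - eps by rewrite /psi (negPf ad) as_ eqxx.
have -> : psi b = phi b - eps by rewrite /psi (negPf bd) bs eqxx.
set s1 := \sum_(i | _) psi i; set s2 := \sum_(i | _) phi i.
have : s1 <= s2 by apply: ler_sum => x /andP[/andP[xd _] _]; exact: psi_le.
lra.
Qed.

End NormalForm.
End Minimal.
End Potentials.

(** * Edge paths parametrised by arc length *)
Section PathPoints.
Variables (R : realType) (G : multigraph) (l : edge G -> R).
Hypothesis l_ge0 : forall e, 0 <= l e.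
Variable p0 : mgraph l.
Implicit Types (d : dart G) (c z : seq (dart G)).

(** The point [p0] is a mere default for the empty path. *)
Fixpoint pt c (y : R) : mgraph l :=
  if c is d :: c' then
    if (y <= l d.1) || (c' == [::]) then dpt l d (y / l d.1) else pt c' (y - l d.1)
  else p0.

Lemma path_sum_ge0 c : 0 <= path_sum l c.
Proof. by rewrite /path_sum; apply: sumr_ge0. Qed.

Lemma frac01 (a y : R) : 0 <= a -> 0 <= y <= a -> 0 <= y / a <= 1 /\ a * (y / a) = y.
Proof.
move=> a0 /andP[y0 ya]; have [aE|an0] := eqVneq a 0; first rewrite aE in ya *.
  by rewrite invr0 mulr0 lexx ler01 mul0r; split => //; move: ya y0; lra.
have a_gt0 : 0 < a by rewrite lt_neqAle eq_sym an0.
split; last by rewrite mulrC divfK.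
by rewrite divr_ge0 //= ler_pdivrMr // mul1r.
Qed.

Lemma pt_head d c y : 0 <= y <= l d.1 -> pt (d :: c) y = dpt l d (y / l d.1).
Proof. by move=> /andP[_ yl] /=; rewrite yl. Qed.

Lemma pt_start d c : at_vertex (pt (d :: c) 0) (dsrc d).
Proof. by rewrite pt_head ?lexx ?l_ge0 // mul0r; exact: dpt_src. Qed.

Lemma dpt_rev d x : 0 <= x <= 1 -> dpt l (drev d) (1 - x) = dpt l d x.
Proof. by move=> x01; congr pair => /=; case: d.2 => //=; congr clamp01; ring. Qed.

Lemma dpt_end d : chain (dpt l d (l d.1 / l d.1)) (dpt l d 1) 0.
Proof.
have [l0|l0] := eqVneq (l d.1) 0; last by rewrite divff //; exact: chain_nil.
rewrite l0 mul0r; have := chain_dpt l d (x := 0) (y := 1).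
by rewrite l0 mul0r; apply; rewrite ?lexx ?ler01.
Qed.

Lemma dpt_follows d d' : follows d d' -> chain (dpt l d 1) (dpt l d' 0) 0.
Proof.
move=> /eqP dd'; apply: (chain_same_vertex (dpt_tgt _ _)); rewrite dd'; exact: dpt_src.
Qed.

Lemma pt_chain c y y' : c != [::] -> sorted (@follows G) c ->
  0 <= y -> y <= y' -> y' <= path_sum l c -> chain (pt c y) (pt c y') (y' - y).
Proof.
elim: c y y' => // d c IH y y' _ sc y0 yy' y'c.
rewrite path_sum_cons in y'c.
have [hy'|] := boolP ((y' <= l d.1) || (c == [::])).
  have y'l : y' <= l d.1.
    by case/orP: hy' => // /eqP c0; rewrite c0 path_sum_nil addr0 in y'c.
  rewrite !pt_head; try by apply/andP; split; lra.
  have [f1 e1] := frac01 (l_ge0 d.1) (y := y) ltac:(lra).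
  have [f2 e2] := frac01 (l_ge0 d.1) (y := y') ltac:(lra).
  have := chain_dpt l d f1 f2; rewrite -[l d.1 as X in X * _]ger0_norm // -normrM mulrBr e1 e2.
  by rewrite distrC ger0_norm // subr_ge0.
rewrite negb_or -ltNge => /andP[y'l c0].
have [d' [c' cE]] : exists d' c', c = d' :: c' by case: (c) c0 => // d' c' _; exists d', c'.
have sc' : sorted (@follows G) c by move: sc; rewrite cE /= => /andP[].
have dd' : follows d d' by move: sc; rewrite cE /= => /andP[].
have ptE x : l d.1 < x -> pt (d :: c) x = pt c (x - l d.1).
  by rewrite /= leNgt (negPf c0) orbF => ->.
rewrite (ptE y') //; have [yl|yl] := leP y (l d.1); last first.
  rewrite ptE //; have := IH (y - l d.1) (y' - l d.1) c0 sc'.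
  have -> : y' - l d.1 - (y - l d.1) = y' - y by ring.
  by apply; lra.
rewrite pt_head ?y0 //; have [f1 e1] := frac01 (l_ge0 d.1) (y := y) ltac:(lra).
have c1 := chain_dpt l d f1 (y := 1) ltac:(lra).
have c2 := dpt_follows dd'.
have c3 : chain (dpt l d' 0) (pt c (y' - l d.1)) (y' - l d.1).
  have := IH 0 (y' - l d.1) c0 sc' (lexx 0); rewrite subr0.
  have -> : pt c 0 = dpt l d' 0 by rewrite cE pt_head ?lexx ?l_ge0 // mul0r.
  by apply; lra.
have := chain_trans c1 (chain_trans c2 c3).
rewrite add0r -[l d.1 as X in X * _]ger0_norm // -normrM mulrBr e1 mulr1.
rewrite distrC ger0_norm; last lra.
by have -> : l d.1 - y + (y' - l d.1) = y' - y by ring.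
Qed.

Lemma pt_cat_l c1 c2 y : c1 != [::] -> y <= path_sum l c1 -> pt (c1 ++ c2) y = pt c1 y.
Proof.
elim: c1 y => // d c1 IH y _; rewrite path_sum_cons /= => h.
have [c1E|c10] := eqVneq c1 [::].
  by rewrite c1E path_sum_nil addr0 in h *; rewrite h.
rewrite orbF cat_ne (negPf c10) /= orbF.
case: ifP => // /negbT; rewrite -ltNge => yl; apply: IH => //.
by rewrite lerBlDl.
Qed.

Lemma pt_cat_r c1 c2 y : c2 != [::] -> sorted (@follows G) (c1 ++ c2) ->
  0 <= y -> y <= path_sum l c2 ->
  chain (pt (c1 ++ c2) (path_sum l c1 + y)) (pt c2 y) 0.
Proof.
move=> c20; elim: c1 => [|d c1 IH] sc y0 yc.
  by rewrite path_sum_nil add0r; exact: chain_nil.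
have sc' : sorted (@follows G) (c1 ++ c2) by move: sc => /=; exact: path_sorted.
have IH' := IH sc' y0 yc; rewrite path_sum_cons -addrA.
have c0 : c1 ++ c2 != [::] by rewrite cat_ne (negPf c20) andbF.
rewrite [X in chain X]/= (negPf c0) orbF; case: ifP => [h|/negbT h]; last first.
  by have -> : l d.1 + (path_sum l c1 + y) - l d.1 = path_sum l c1 + y by ring.
have z0 : path_sum l c1 + y = 0.
  by have := path_sum_ge0 c1; move: h; rewrite gerDl; lra.
rewrite z0 addr0 in h *; rewrite z0 in IH'.
have [d' [c' cE]] : exists d' c', c1 ++ c2 = d' :: c'.
  by case: (c1 ++ c2) c0 => // d' c' _; exists d', c'.
have dd' : follows d d' by move: sc; rewrite /= cE /= => /andP[].
have c1' : chain (dpt l d' 0) (pt (c1 ++ c2) 0) 0.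
  by rewrite cE pt_head ?lexx ?l_ge0 // mul0r; exact: chain_nil.
have := chain_trans (dpt_end d) (chain_trans (dpt_follows dd') (chain_trans c1' IH')).
by rewrite !addr0.
Qed.

Lemma pt1_rev d y : 0 <= y <= l d.1 ->
  chain (pt [:: drev d] (l d.1 - y)) (pt [:: d] y) 0.
Proof.
move=> yl; have [f e] := frac01 (l_ge0 d.1) yl.
rewrite pt_head; last by move: yl => /= ; lra.
rewrite pt_head //= mulrBl; have [l0|l0] := eqVneq (l d.1) 0; last first.
  by rewrite divff // dpt_rev //; exact: chain_nil.
rewrite l0 invr0 !mulr0 subr0.
have := chain_dpt l d (x := 1) (y := 0); rewrite l0 mul0r -(dpt_rev d (x := 1)) ?lexx ?ler01 //.
by rewrite subrr; apply; rewrite ?lexx ?ler01.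
Qed.

Lemma follows_rev d d' : follows (drev d') (drev d) = follows d d'.
Proof. by rewrite /follows /= dtgt_drev dsrc_drev eq_sym. Qed.

Lemma follows_revp c : sorted (@follows G) (revp c) = sorted (@follows G) c.
Proof.
rewrite /revp rev_sorted sorted_map; apply: eq_sorted => d d' /=; exact: follows_rev.
Qed.

Lemma pt_rev c y : c != [::] -> sorted (@follows G) c -> 0 <= y -> y <= path_sum l c ->
  chain (pt (revp c) (path_sum l c - y)) (pt c y) 0.
Proof.
elim: c y => // d c IH y _ sc y0 yc; rewrite path_sum_cons in yc.
have rE : revp (d :: c) = revp c ++ [:: drev d] by rewrite -cat1s revp_cat.
have [cE|c0] := eqVneq c [::].
  rewrite cE /revp /= path_sum_cons path_sum_nil addr0.
  by apply: pt1_rev; move: yc; rewrite cE path_sum_nil; lra.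
have sr : sorted (@follows G) (revp c ++ [:: drev d]) by rewrite -rE follows_revp.
rewrite rE path_sum_cons; have [yl|yl] := leP y (l d.1).
  have c1 := @pt_cat_r (revp c) [:: drev d] (l d.1 - y) isT sr.
  rewrite path_sum_cons path_sum_nil addr0 path_sum_revp in c1.
  have {}c1 := c1 ltac:(lra) ltac:(rewrite /=; lra).
  have c2 := @pt1_rev d y ltac:(lra).
  rewrite pt_head; last lra.
  rewrite [pt [:: d] y]pt_head in c2; last lra.
  have := chain_trans c1 c2; rewrite addr0.
  by have -> : path_sum l c + (l d.1 - y) = l d.1 + path_sum l c - y by ring.
rewrite pt_cat_l ?revp_ne ?path_sum_revp //; last lra.
have -> : pt (d :: c) y = pt c (y - l d.1) by rewrite /= leNgt yl (negPf c0).
have -> : l d.1 + path_sum l c - y = path_sum l c - (y - l d.1) by ring.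
apply: IH => //; first by move: sc => /=; exact: path_sorted.
  by lra.
by lra.
Qed.

Hypothesis forest : forall c, embedded_circle c -> ~~ all (fun e => l e == 0) (edges c).

(** The edges of length 0 contain no circle. *)
Lemma zero_no_return d z : sorted (@nonback G) (d :: z ++ [:: drev d]) ->
  (forall d', d' \in z -> l d'.1 = 0) -> False.
Proof.
move=> sz z0; have [zE|zn0] := eqVneq z [::].
  by move: sz; rewrite zE /= nonbackE eqxx !andbF.
move: sz => /= ; rewrite -[path _ _ _]/(sorted (@nonback G) ([:: d] ++ (z ++ [:: drev d]))).
rewrite (sorted_catE _ d) ?cat_ne ?(negPf zn0) // (sorted_catE _ d) // head_cat_ne //=.
move=> /and4P[/andP[/eqP h1 _] sz /andP[/eqP h2 _] _].
have [|w [v [b [zE ev v0]]]] := closed_has_circle (x0 := d) zn0 sz.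
  rewrite h2 dsrc_drev h1; apply: map_f; exact: head_mem.
apply: (negP (forest ev)); apply/allP => e /edgesP[d' d'v ->].
by rewrite z0 // zE !mem_cat d'v orbT.
Qed.

Variable delta : R.
Hypothesis delta_fine : fine_scale l delta.

Lemma delta_zero d y : l d.1 < y -> y < delta -> l d.1 = 0.
Proof.
have [d0 hd] := delta_fine.
move=> h1 h2; apply/eqP; rewrite eq_le l_ge0 andbT leNgt; apply/negP => h.
by have := hd _ h; lra.
Qed.

Lemma pt_small c y : c != [::] -> 0 <= y -> y <= path_sum l c -> y < delta ->
  exists z d c' s, [/\ c = z ++ d :: c', forall d', d' \in z -> l d'.1 = 0,
    0 <= s <= 1, pt c y = dpt l d s & l d.1 * s = y].
Proof.
elim: c y => // d c IH y _ y0; rewrite path_sum_cons => yc yd.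
have [h|] := boolP ((y <= l d.1) || (c == [::])).
  have yl : 0 <= y <= l d.1.
    rewrite y0; case/orP: h => // /eqP c0; by rewrite c0 path_sum_nil addr0 in yc.
  have [f e] := frac01 (l_ge0 d.1) yl.
  by exists [::], d, c, (y / l d.1); split => //; rewrite pt_head.
rewrite negb_or -ltNge => /andP[yl c0]; have l0 := delta_zero yl yd.
have [|z [d' [c' [s [E h1 h2 h3 h4]]]]] := IH y c0 y0 _ yd; first by move: yc; rewrite l0 add0r.
exists (d :: z), d', c', s; split => //.
- by rewrite E.
- by move=> d1; rewrite inE => /orP[/eqP ->|/h1].
- by rewrite /= leNgt yl (negPf c0) l0 subr0.
Qed.

(** Two positions that are close to each other are on the same dart, or on two
    darts separated by darts of length 0 only. *)
Lemma pt_near c y y' : c != [::] -> 0 <= y -> y <= y' -> y' <= path_sum l c -> y' - y < delta ->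
  (exists d s s', [/\ 0 <= s <= 1, 0 <= s' <= 1, pt c y = dpt l d s, pt c y' = dpt l d s' &
     l d.1 * (s' - s) = y' - y]) \/
  (exists c1 d z d' c2 s s', [/\ c = c1 ++ d :: z ++ d' :: c2,
     (forall x, x \in z -> l x.1 = 0) /\ (0 <= s <= 1 /\ 0 <= s' <= 1), pt c y = dpt l d s,
     pt c y' = dpt l d' s' & l d.1 * (1 - s) + l d'.1 * s' = y' - y]).
Proof.
elim: c y y' => // d c IH y y' _ y0 yy'; rewrite path_sum_cons => y'c yd.
have [h|] := boolP ((y' <= l d.1) || (c == [::])).
  have y'l : 0 <= y' <= l d.1.
    rewrite (le_trans y0) //=; case/orP: h => // /eqP c0; by rewrite c0 path_sum_nil addr0 in y'c.
  have yl : 0 <= y <= l d.1 by lra.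
  have [f e] := frac01 (l_ge0 d.1) yl; have [f' e'] := frac01 (l_ge0 d.1) y'l.
  left; exists d, (y / l d.1), (y' / l d.1); split; rewrite ?pt_head //.
  by rewrite mulrBr e e'.
rewrite negb_or -ltNge => /andP[y'l c0].
have y'E : pt (d :: c) y' = pt c (y' - l d.1) by rewrite /= leNgt y'l (negPf c0).
have [yl|yl] := leP y (l d.1).
  have [f e] := frac01 (l_ge0 d.1) (y := y) ltac:(lra).
  have [|||z [d' [c' [s' [E h1 h2 h3 h4]]]]] := @pt_small c (y' - l d.1) c0; try lra.
  right; exists [::], d, z, d', c', (y / l d.1), s'; split => //.
  - by rewrite E.
  - by rewrite pt_head ?y0.
  - by rewrite y'E.
  - by rewrite mulrBr mulr1 e h4; ring.
have yE : pt (d :: c) y = pt c (y - l d.1) by rewrite /= leNgt yl (negPf c0).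
have E : y' - l d.1 - (y - l d.1) = y' - y by ring.
have := IH (y - l d.1) (y' - l d.1) c0; rewrite E yE y'E.
case; try lra; first by move=> h; left.
move=> [c1 [d1 [z [d' [c2 [s [s' [cE h1 h2 h3 h4]]]]]]]]; right.
by exists (d :: c1), d1, z, d', c2, s, s'; split => //; rewrite cE.
Qed.

Lemma inc_orient (b : bool) (x y : R) : 0 <= x <= 1 -> 0 <= y <= 1 ->
  `|circ_inc (if b then 1 - x else x) (if b then 1 - y else y)| = `|circ_inc x y|.
Proof.
case: b => // x01 y01; rewrite -(normrN (circ_inc x y)); congr (`| _ |).
have -> : circ_inc (1 - x) (1 - y) = if `|y - x| <= 2^-1 then x - y else
    if y < x then x - y - 1 else x - y + 1.
  rewrite /circ_inc; have -> : 1 - y - (1 - x) = - (y - x) by ring.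
  rewrite normrN; have -> : (1 - x < 1 - y) = (y < x) by rewrite ltrD2l ltrN2.
  by case: ifP => _; [ring|case: ifP => _; ring].
rewrite /circ_inc; case: ifP => h; first by ring.
case: (ltgtP x y) => h'; try ring.
by move: h; rewrite h' subrr normr0 invr_ge0 ler0n.
Qed.

(** A path without backtracking parametrises its image locally isometrically: two
    nearby positions lie on one edge or on both sides of a vertex, and in the
    second case both edges contribute to the length of a chain joining them.  In
    that case the edges differ, by [zero_no_return], unless the path goes round and
    enters the same dart again. *)
Lemma pt_isometry c y y' x : sorted (@nonback G) c -> c != [::] ->
  0 <= y -> y <= y' -> y' <= path_sum l c -> y' - y < delta ->
  chain (pt c y) (pt c y') x -> y' - y <= x.
Proof.
have [d0 hd] := delta_fine.
move=> sc c0 y0 yy' y'c yd ch; have [hx|hx] := leP delta x; first lra.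
have [_ hinc] := chain_near l_ge0 delta_fine ch hx; apply: le_trans hinc.
have term e : l e * `|circ_inc (ecoord e (pt c y)) (ecoord e (pt c y'))| <=
    \sum_e l e * `|circ_inc (ecoord e (pt c y)) (ecoord e (pt c y'))|.
  rewrite [leRHS](bigD1 e) //= lerDl; apply: sumr_ge0 => e' _; by rewrite mulr_ge0.
have [[d [s [s' [s01 s'01 yE y'E E]]]]|] := pt_near c0 y0 yy' y'c yd.
  apply: le_trans (term d.1); rewrite yE y'E !ecoord_dpt // eqxx inc_orient // -E.
  have [l0|l0] := eqVneq (l d.1) 0; first by rewrite l0 !mul0r.
  have l_gt0 : 0 < l d.1 by rewrite lt_neqAle eq_sym l0 l_ge0.
  have ss : 0 <= s' - s < 16^-1.
    have h := hd _ l_gt0; apply/andP; split.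
      by rewrite -(pmulr_rge0 _ l_gt0) E subr_ge0.
    by rewrite -(ltr_pM2l l_gt0) E; lra.
  rewrite ler_pM2l // /circ_inc; have -> : `|s' - s| = s' - s by rewrite ger0_norm //; lra.
  by rewrite ifT ?ler_norm //; lra.
move=> [c1 [d [z [d' [c2 [s [s' [cE [z0 [s01 s'01]] yE y'E E]]]]]]]].
have hs : l d.1 != 0 -> 1 - s < 16^-1.
  move=> l0; have l_gt0 : 0 < l d.1 by rewrite lt_neqAle eq_sym l0 l_ge0.
  have h := hd _ l_gt0; rewrite -(ltr_pM2l l_gt0).
  have : 0 <= l d'.1 * s' by rewrite mulr_ge0 //; lra.
  by move: E; lra.
have hs' : l d'.1 != 0 -> s' < 16^-1.
  move=> l0; have l_gt0 : 0 < l d'.1 by rewrite lt_neqAle eq_sym l0 l_ge0.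
  have h := hd _ l_gt0; rewrite -(ltr_pM2l l_gt0).
  have : 0 <= l d.1 * (1 - s) by rewrite mulr_ge0 //; lra.
  by move: E; lra.
have far (u v : R) : 0 <= u -> 0 <= v -> u < 16^-1 -> v < 16^-1 -> circ_inc (1 - u) v = u + v.
  move=> u0 v0 u1 v1; rewrite /circ_inc ler0_norm; last lra.
  by rewrite ifF; [rewrite ifF; [ring|]|]; apply/negbTE; rewrite -?ltNge -?leNgt; lra.
rewrite yE y'E in term *; rewrite -E.
have [dd|dd] := eqVneq d.1 d'.1.
  have [l0|l0] := eqVneq (l d.1) 0.
    by rewrite -dd l0 !mul0r addr0; apply: sumr_ge0 => e _; rewrite mulr_ge0.
  have dE : d' = d.
    case: (same_edge dd) => // d'E.
    exfalso; apply: (@zero_no_return d z) => //.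
    rewrite -d'E; move: sc; rewrite cE => /sorted_cat_r; rewrite -cat_cons.
    rewrite -[d' :: c2]cat1s catA => /sorted_cat_l; by rewrite cat_cons.
  subst d'; apply: le_trans (term d.1).
  rewrite !ecoord_dpt // eqxx inc_orient // -mulrDr ler_wpM2l //.
  have h1 := hs l0; have h2 := hs' l0; have := far (1 - s) s'.
  have -> : 1 - (1 - s) = s by ring.
  move=> -> //; try lra; exact: ler_norm.
have termd : l d.1 * (1 - s) <= l d.1 * `|circ_inc (ecoord d.1 (dpt l d s)) (ecoord d.1 (dpt l d' s'))|.
  have [->|l0] := eqVneq (l d.1) 0; first by rewrite !mul0r.
  rewrite ler_wpM2l // !ecoord_dpt // eqxx eq_sym (negPf dd); have h := hs l0.
  have -> : `|circ_inc (if d.2 then 1 - s else s) 0| = `|circ_inc (1 - (1 - s)) 0|.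
    case: d.2; last by congr (`|circ_inc _ _|); ring.
    rewrite (far (1 - s) 0); try lra.
    have a : `|0 - (1 - s)| = 1 - s by rewrite sub0r normrN ger0_norm //; lra.
    by rewrite /circ_inc a ifT; [rewrite sub0r normrN addr0|lra].
  by rewrite far ?addr0 ?ler_norm //; lra.
have termd' : l d'.1 * s' <= l d'.1 * `|circ_inc (ecoord d'.1 (dpt l d s)) (ecoord d'.1 (dpt l d' s'))|.
  have [->|l0] := eqVneq (l d'.1) 0; first by rewrite !mul0r.
  rewrite ler_wpM2l // !ecoord_dpt // eqxx (negPf dd); have h := hs' l0.
  case: d'.2; last first.
    have a : `|s'| = s' by rewrite ger0_norm //; lra.
    by rewrite /circ_inc subr0 a ifT; [rewrite a|lra].
  have a : `|1 - s'| = 1 - s' by rewrite ger0_norm //; lra.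
  rewrite /circ_inc subr0 a ifF; last by apply/negbTE; rewrite -ltNge; lra.
  rewrite ifT; last lra.
  have -> : 1 - s' - 1 = - s' by ring.
  by rewrite normrN ler_norm.
apply: le_trans (lerD termd termd') _.
rewrite [leRHS](bigD1 d.1) //= lerD2l (bigD1 d'.1) ?(eq_sym d'.1) //= lerDl.
by apply: sumr_ge0 => e _; rewrite mulr_ge0.
Qed.

End PathPoints.

(** * Moving the vertices along a potential *)
Section Rays.
Variables (R : realType) (G : multigraph) (l l' : edge G -> R) (phi : dart G -> R).
Hypothesis l_ge0 : forall e, 0 <= l e.
Hypothesis l'_ge0 : forall e, 0 <= l' e.
Hypothesis l'_eq0 : forall e, l' e = 0 -> l e = 0.
Hypothesis forest : forall c : seq (dart G), embedded_circle c ->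
  ~~ all (fun e => l e == 0) (edges c).
Hypothesis phi_opp : forall d d' : dart G,
  phi d < 0 -> d' != d -> dsrc d' = dsrc d -> phi d' = - phi d.
Hypothesis phi_zero : forall d, (forall d', dsrc d' = dsrc d -> 0 <= phi d') -> phi d = 0.
(** The length of the image of an edge after both of its ends have been moved. *)
Definition new_length (d : dart G) : R := l' d.1 + phi d + phi (drev d).
Hypothesis len_ge0 : forall d, 0 <= new_length d.
Hypothesis len_eq0 : forall d, l d.1 = 0 -> new_length d = 0.
Hypothesis room : forall d : dart G, 0 < l d.1 -> - phi d <= l' d.1.
Variable out : vertex G -> dart G.
Hypothesis outP : forall x, dsrc (out x) = x.
Implicit Types (d : dart G) (x : vertex G) (c : seq (dart G)).

(** The direction into which the vertex [x] is moved; by [phi_opp] there is at most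
    one. *)
Definition push x : option (dart G) := [pick d : dart G | (dsrc d == x) && (phi d < 0)].

Lemma pushP x : (exists d, [/\ push x = Some d, dsrc d = x & phi d < 0]) \/
  (push x = None /\ forall d, dsrc d = x -> phi d = 0).
Proof.
rewrite /push; case: pickP => [d /andP[/eqP h1 h2]|h]; first by left; exists d.
right; split => // d dx; apply: phi_zero => d' d's; rewrite leNgt; apply/negP => h'.
by have := h d'; rewrite d's dx eqxx h'.
Qed.

Definition shift x : R := if push x is Some d then - phi d else 0.

Lemma shift_ge0 x : 0 <= shift x.
Proof. by rewrite /shift; have [[d [-> _ h]]|[-> _]] := pushP x; lra. Qed.

Lemma phi_shift d : phi d = if push (dsrc d) == Some d then - shift (dsrc d) else shift (dsrc d).
Proof.
rewrite /shift; have [[a [pa ax h]]|[-> h]] := pushP (dsrc d); last by rewrite h.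
rewrite pa; have [[->]|ad] := eqVneq (Some a) (Some d); first by rewrite opprK.
by apply: phi_opp => //; apply: contra ad => /eqP ->.
Qed.

(** On an edge that has length 0 in [l], both ends have the same image.  If the far
    end of [d] moves further, so does a vertex pushed into [d]. *)
Definition passes d : bool := (l d.1 == 0) && (0 < phi (drev d)).

(** The path along which [x] is moved, cut off after [n] darts.  It ends: apart
    from its last edge it runs in the forest of edges of length 0
    [ray_uniq]. *)
Fixpoint ray n x : seq (dart G) :=
  if n is n'.+1 then
    if push x is Some d then d :: (if passes d then ray n' (dtgt d) else [::]) else [::]
  else [::].

Lemma ray_push n x d : push x = Some d ->
  ray n.+1 x = d :: (if passes d then ray n (dtgt d) else [::]).
Proof. by move=> /= ->. Qed.

Lemma ray_head n x d c : ray n x = d :: c -> push x = Some d.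
Proof. by case: n => //= n; case: (push x) => // d' [->]. Qed.

Lemma passes_push d : passes d -> exists d', [/\ push (dtgt d) = Some d', d' != drev d &
  phi (drev d) = shift (dtgt d)].
Proof.
move=> /andP[_ h]; have [[d' [pd' d'x d'0]]|[_ h']] := pushP (dtgt d); last first.
  by move: h; rewrite h' ?ltxx ?dsrc_drev.
have d'd : d' != drev d by apply: contraTneq h => <-; rewrite -leNgt ltW.
exists d'; split => //; rewrite phi_shift dsrc_drev pd' ifF //.
by apply/negbTE; apply: contra d'd => /eqP[->].
Qed.

Lemma ray_sorted n x : sorted (@nonback G) (ray n x).
Proof.
elim: n x => //= n IH x; have [[d [pd dx d0]]|[-> //]] := pushP x; rewrite pd.
case: ifP => // /passes_push[d' [pd' d'd _]].
have := IH (dtgt d); case: n {IH} => [//|n]; rewrite (ray_push _ pd') /= nonbackE d'd andbT.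
rewrite -/(ray _ _) => ->; rewrite andbT.
by have [[a [pa ax _]]|[]] := pushP (dtgt d); [move: pa; rewrite pd' => -[->]; rewrite ax|rewrite pd'].
Qed.

Lemma ray_zero n x p s : ray n x = p ++ s -> s != [::] -> forall d, d \in p -> l d.1 = 0.
Proof.
elim: n x p => [|n IH] x [|a p] //= E s0 d.
move: E; have [[b [-> _ _]]|[-> //]] := pushP x => -[ba E].
rewrite inE => /orP[/eqP ->|]; last first.
  move: E; case: ifP => [_ E|_]; first exact: (IH _ _ E).
  by case: p.
move: E; case: ifP => [/andP[/eqP h _] _|_]; first by rewrite -ba.
by case: p => //=; case: (s) s0.
Qed.

Lemma map_nuniq (T U : eqType) (f : T -> U) (s : seq T) : ~~ uniq (map f s) ->
  exists s1 a s2 b s3, s = s1 ++ (a :: s2) ++ (b :: s3) /\ f a = f b.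
Proof.
elim: s => //= a s IH; rewrite negb_and negbK => /orP[/mapP[b bs E]|/IH].
  by case/splitPr: bs => s2 s3; exists [::], a, s2, b, s3.
by move=> [s1 [a' [s2 [b [s3 [-> h]]]]]]; exists (a :: s1), a', s2, b, s3.
Qed.

Lemma ray_uniq n x : uniq (verts (ray n x)).
Proof.
apply/negPn/negP => /map_nuniq[s1 [a [s2 [b [s3 [E ab]]]]]].
have sr := ray_sorted n x; rewrite E in sr.
have := sorted_cat_r sr; rewrite (sorted_catE _ a) //= => /and3P[h1 /andP[/eqP h2 _] _].
have [|w [v [c [E' ev v0]]]] := @closed_has_circle G a (a :: s2) isT h1.
  by rewrite /= h2 -ab inE eqxx.
apply: (negP (forest ev)); apply/allP => e /edgesP[d dv ->]; apply/eqP.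
rewrite catA in E; apply: (ray_zero E) => //.
by rewrite mem_cat E' !mem_cat dv !orbT.
Qed.

Lemma ray_size n x : (size (ray n x) <= #|vertex G|)%N.
Proof.
by rewrite -(size_map (@dsrc G)) -(card_uniqP (ray_uniq n x)); exact: max_card.
Qed.

Lemma ray_stable n x : (size (ray n x) < n)%N -> ray n.+1 x = ray n x.
Proof.
elim: n x => // n IH x; rewrite /= -/(ray n _).
by case: (push x) => // d; case: ifP => // _ /= h; congr cons; exact: IH.
Qed.

Definition way x := ray #|vertex G|.+2 x.

Lemma wayE x : way x = if push x is Some d then
  d :: (if passes d then way (dtgt d) else [::]) else [::].
Proof.
transitivity (if push x is Some d then
  d :: (if passes d then ray #|vertex G|.+1 (dtgt d) else [::]) else [::]); first by [].
case: (push x) => // d; congr cons; case: ifP => // _.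
by rewrite -ray_stable // ltnS; exact: ray_size.
Qed.

Lemma way_sorted x : sorted (@nonback G) (way x).
Proof. exact: ray_sorted. Qed.

(** An edge of positive length has room for the motion, and on an edge of length 0
    the motions of both ends differ by exactly its length in [l']. *)
Lemma way_shift x : shift x <= path_sum l' (way x).
Proof.
rewrite /way; have : (size (ray #|vertex G|.+2 x) < #|vertex G|.+2)%N.
  by rewrite ltnS; apply: leqW; exact: ray_size.
elim: _.+2 x => // n IH x /=; rewrite {1}/shift.
have [[d [pd dx d0]]|[-> _]] := pushP x; last by rewrite path_sum_nil.
rewrite pd path_sum_cons; case: ifP => [pa|npa]; last first.
  rewrite path_sum_nil addr0 => _; have [h|h] := ltP 0 (l d.1); first exact: room.
  have lz : l d.1 = 0 by apply/eqP; rewrite eq_le h l_ge0.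
  move: npa; rewrite /passes lz eqxx /= => /negbT; rewrite -leNgt.
  by have := len_eq0 lz; rewrite /new_length; lra.
move=> /= sz; have := IH (dtgt d) sz.
have [d' [_ _ <-]] := passes_push pa.
have lz : l d.1 = 0 by case/andP: pa => /eqP.
by have := len_eq0 lz; rewrite /new_length; lra.
Qed.

Lemma way_src x d c : way x = d :: c -> dsrc d = x.
Proof.
move=> /ray_head pd; have [[d' [pd' h _]]|[h _]] := pushP x; last by rewrite h in pd.
by move: pd; rewrite pd' => -[<-].
Qed.

(** The image of the edge of [d] runs inside [track d], which joins the furthest
    positions of its ends.  A vertex that moves into [d] itself needs no detour. *)
Definition back d := if push (dsrc d) == Some d then [::] else revp (way (dsrc d)).
Definition track d := back d ++ d :: revp (back (drev d)).
Definition base d := path_sum l' (back d).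

Lemma back_nonback d : back d != [::] -> nonback (last d (back d)) d.
Proof.
rewrite /back; case: ifP => // h; rewrite revp_ne => w0; rewrite last_revp //.
case E : (way (dsrc d)) w0 => [//|a c] _ /=.
rewrite nonback_out (way_src E) eqxx /=.
by apply: contraFneq h => ad; rewrite (ray_head E) ad.
Qed.

Lemma back_sorted d : sorted (@nonback G) (back d).
Proof. by rewrite /back; case: ifP => // _; rewrite sorted_revp way_sorted. Qed.

Lemma track_sorted d : sorted (@nonback G) (track d).
Proof.
have tail : sorted (@nonback G) (d :: revp (back (drev d))).
  have [E|ne] := eqVneq (back (drev d)) [::]; first by rewrite E.
  rewrite -cat1s (sorted_catE _ d) ?revp_ne //= sorted_revp back_sorted andbT.
  rewrite head_revp //; have := back_nonback ne.
  have -> : last (drev d) (back (drev d)) = last d (back (drev d)) by case: (back _) ne.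
  by rewrite -nonback_rev drevK.
rewrite /track; have [->|ne] := eqVneq (back d) [::]; first exact: tail.
by rewrite (sorted_catE _ d) // back_sorted tail /= (back_nonback ne).
Qed.

Lemma track_ne d : track d != [::].
Proof. by rewrite /track cat_ne andbF. Qed.

Lemma track_rev d : track (drev d) = revp (track d).
Proof.
rewrite /track drevK revp_cat -[d :: _]cat1s revp_cat revpK -catA.
by have -> : revp [:: d] = [:: drev d] by [].
Qed.

Lemma track_sum d : path_sum l' (track d) = base d + l' d.1 + base (drev d).
Proof. by rewrite /track path_sum_cat path_sum_cons path_sum_revp addrA. Qed.

Lemma base_ge0 d : 0 <= base d.
Proof. exact: path_sum_ge0. Qed.

Lemma base_phi d : phi d <= base d.
Proof.
rewrite phi_shift /base /back; case: ifP => _; last by rewrite path_sum_revp way_shift.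
by rewrite path_sum_nil oppr_le0 shift_ge0.
Qed.

Lemma track_follows d : sorted (@follows G) (track d).
Proof. exact: nonback_follows (track_sorted d). Qed.

(** ** The deformation of the identity *)
Let p0 (d : dart G) : mgraph l' := dpt l' d 0.

Definition track_pt d y : mgraph l' := pt (p0 (out (dsrc d))) (track d) y.

(** The position of the vertex [x] at time [s]; at time 1 it has moved by
    [shift x]. *)
Definition moved s x : mgraph l' := pt (p0 (out x)) (way x) (s * shift x).

Lemma pt_default p q c y : c != [::] -> pt (l := l') p c y = pt q c y.
Proof. by elim: c y => //= d [|d' c] IH y _; [rewrite orbT|case: ifP => // _; exact: IH]. Qed.

Lemma track_pt_rev d y : 0 <= y -> y <= path_sum l' (track d) ->
  chain (track_pt d (path_sum l' (track d) - y)) (track_pt (drev d) y) 0.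
Proof.
move=> y0 yl; rewrite /track_pt track_rev.
have := @pt_rev R G l' l'_ge0 (p0 (out (dsrc (drev d)))) (track d) (path_sum l' (track d) - y)
  (track_ne d) (track_follows d).
have -> : path_sum l' (track d) - (path_sum l' (track d) - y) = y by ring.
rewrite subr_ge0 gerBl => /(_ yl y0) h; apply: chain_sym.
by rewrite (@pt_default (p0 (out (dsrc d))) (p0 (out (dsrc (drev d))))) ?track_ne.
Qed.

(** Seen on the track of any dart at [x], the motion of [x] is the same: away from
    the dart, along the detour, unless it goes into the dart. *)
Lemma track_start s d : 0 <= s <= 1 ->
  chain (track_pt d (base d - s * phi d)) (moved s (dsrc d)) 0.
Proof.
move=> s01; have sh0 := shift_ge0 (dsrc d); have shw := way_shift (dsrc d).
have ssh : s * shift (dsrc d) <= shift (dsrc d) by rewrite ler_piMl //; lra.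
have ssh0 : 0 <= s * shift (dsrc d) by rewrite mulr_ge0 //; lra.
rewrite /track_pt /moved phi_shift /base /back.
have [pd|npd] := eqVneq (push (dsrc d)) (Some d).
  rewrite path_sum_nil mulrN opprK add0r /track /back pd eqxx cat0s.
  have wE := wayE (dsrc d); rewrite pd in wE; rewrite wE in shw *.
  case pa: (passes d) wE shw => wE shw.
    have [d' [pd' d'd _]] := passes_push pa.
    rewrite dsrc_drev ifF ?revpK; first exact: chain_nil.
    by apply/negbTE; rewrite pd'; apply: contra d'd => /eqP[->].
  rewrite -cat1s pt_cat_l //; first exact: chain_nil.
  exact: le_trans ssh shw.
rewrite /track /back (negPf npd) path_sum_revp.
have [wn|wn] := eqVneq (way (dsrc d)) [::].
  have s0 : shift (dsrc d) = 0.
    by apply/eqP; rewrite eq_le sh0 andbT; move: shw; rewrite wn path_sum_nil.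
  rewrite s0 mulr0 wn /= path_sum_nil subr0.
  rewrite -[if _ then _ else _]/(pt (p0 (out (dsrc d))) (d :: _) 0).
  apply: (chain_same_vertex (pt_start l'_ge0 _ _ _)); rewrite -{2}(outP (dsrc d)); exact: dpt_src.
rewrite pt_cat_l ?revp_ne ?path_sum_revp //; last by rewrite gerBl.
apply: pt_rev => //; first exact: nonback_follows (way_sorted _).
exact: le_trans ssh shw.
Qed.

(** The image of [e] at time [s] is a segment of its track between the moved ends,
    run through at constant speed. *)
Definition pos s e (x : R) : R :=
  base (e, false) - s * phi (e, false) + x * (l' e + s * (phi (e, false) + phi (e, true))).

Definition deform s (p : mgraph l') : mgraph l' := track_pt (p.1, false) (pos s p.1 p.2%:num).

Lemma pos_start s e : pos s e 0 = base (e, false) - s * phi (e, false).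
Proof. by rewrite /pos mul0r addr0. Qed.

Lemma pos_end s e : pos s e 1 =
  path_sum l' (track (e, false)) - (base (e, true) - s * phi (e, true)).
Proof. by rewrite /pos track_sum /=; ring. Qed.

Lemma len_s s e : 0 <= s <= 1 -> 0 <= l' e + s * (phi (e, false) + phi (e, true)).
Proof.
move=> s01; have := len_ge0 (e, false); rewrite /new_length /= => h.
have -> : l' e + s * (phi (e, false) + phi (e, true)) =
  (1 - s) * l' e + s * (l' e + phi (e, false) + phi (e, true)) by ring.
by rewrite addr_ge0 // mulr_ge0 //; lra.
Qed.

Lemma start_s_ge0 s d : 0 <= s <= 1 -> 0 <= base d - s * phi d.
Proof.
move=> s01; have := base_phi d; have := base_ge0 d => h1 h2.
have -> : base d - s * phi d = (1 - s) * base d + s * (base d - phi d) by ring.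
by rewrite addr_ge0 // mulr_ge0 //; lra.
Qed.

Lemma pos_bounds s e (x : R) : 0 <= s <= 1 -> 0 <= x <= 1 ->
  0 <= pos s e x /\ pos s e x <= path_sum l' (track (e, false)).
Proof.
move=> s01 x01; have h := len_s e s01.
have h0 := start_s_ge0 (e, false) s01; have h1 := start_s_ge0 (e, true) s01.
split; first by rewrite /pos addr_ge0 // mulr_ge0 //; lra.
apply: (@le_trans _ _ (pos s e 1)); last by rewrite pos_end gerBl.
by rewrite /pos lerD2l ler_wpM2r //; lra.
Qed.

Lemma deform_vertex s p x : 0 <= s <= 1 -> at_vertex p x ->
  chain (deform s p) (moved s x) 0.
Proof.
move=> s01; rewrite /deform => -[[-> <-]|[-> <-]].
  by rewrite pos_start; exact: (track_start (p.1, false)).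
rewrite pos_end; set y := base _ - _.
have y0 : 0 <= y by exact: start_s_ge0.
have yl : y <= path_sum l' (track (p.1, false)).
  have [_] := pos_bounds p.1 (x := 0) s01 ltac:(lra).
  have [] := pos_bounds p.1 (x := 1) s01 ltac:(lra).
  by rewrite pos_end -/y; lra.
have := chain_trans (track_pt_rev y0 yl) (track_start (p.1, true) s01).
by rewrite addr0.
Qed.

Lemma track_chain d y y' : 0 <= y -> y <= path_sum l' (track d) ->
  0 <= y' -> y' <= path_sum l' (track d) -> chain (track_pt d y) (track_pt d y') `|y - y'|.
Proof.
have key z z' : 0 <= z -> z <= z' -> z' <= path_sum l' (track d) ->
    chain (track_pt d z) (track_pt d z') (z' - z).
  by move=> *; apply: pt_chain => //; [exact: track_ne|exact: track_follows].
move=> y0 yl y'0 y'l; have [h|/ltW h] := leP y y'.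
  by rewrite distrC ger0_norm ?subr_ge0 //; exact: key.
by rewrite ger0_norm ?subr_ge0 //; apply: chain_sym; exact: key.
Qed.

(** The metric [m] in the source is left open: it is [l] for the final map, and the
    metric of edge lengths 1 for the homotopy. *)
Lemma deform_lipschitz (m : edge G -> R) s K (p q : mgraph m) (c : R) : 0 <= s <= 1 ->
  (forall e, l' e + s * (phi (e, false) + phi (e, true)) <= K * m e) ->
  chain p q c ->
  exists2 c', chain (deform s (p : mgraph l')) (deform s (q : mgraph l')) c' & c' <= K * c.
Proof.
move=> s01 hK; elim=> [p1|e x y q1 c1 _ [c' ch hc']|p1 p' v q1 c1 h h' _ [c' ch hc']].
- by exists 0; [exact: chain_nil|rewrite mulr0].
- have x01 (z : {i01 R}) : 0 <= z%:num <= 1 by apply/andP.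
  have [a1 a2] := pos_bounds e s01 (x01 x); have [b1 b2] := pos_bounds e s01 (x01 y).
  have ct := track_chain a1 a2 b1 b2.
  eexists; first exact: (chain_trans ct ch).
  rewrite mulrDr; apply: lerD => //.
  have -> : pos s e x%:num - pos s e y%:num =
     (l' e + s * (phi (e, false) + phi (e, true))) * (x%:num - y%:num) by rewrite /pos; ring.
  by rewrite normrM ger0_norm ?len_s // mulrA ler_wpM2r.
- exists c' => //; have h1 := deform_vertex (p := p1) s01 h.
  have h2 := deform_vertex (p := p') s01 h'.
  by have := chain_trans h1 (chain_trans (chain_sym h2) ch); rewrite !add0r.
Qed.

Lemma deform_time s s' p : 0 <= s <= 1 -> 0 <= s' <= 1 ->
  exists2 c, chain (deform s p) (deform s' p) c &
    c <= `|s - s'| * (\sum_d `|phi d|).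
Proof.
move=> s01 s'01; have x01 : 0 <= p.2%:num <= 1 by apply/andP.
have [a1 a2] := pos_bounds p.1 s01 x01; have [b1 b2] := pos_bounds p.1 s'01 x01.
exists `|pos s p.1 p.2%:num - pos s' p.1 p.2%:num|; first exact: track_chain.
have -> : pos s p.1 p.2%:num - pos s' p.1 p.2%:num = (s - s') *
   (p.2%:num * phi (p.1, true) - (1 - p.2%:num) * phi (p.1, false)) by rewrite /pos; ring.
rewrite normrM ler_wpM2l //; apply: le_trans (ler_normB _ _) _.
rewrite !normrM (bigD1 (p.1, true)) //= (bigD1 (p.1, false)) /=; last by rewrite xpair_eqE andbF.
apply: lerD; first by rewrite ler_piMl // ger0_norm; lra.
rewrite -[leLHS]addr0; apply: lerD; last exact: sumr_ge0.
by rewrite ler_piMl // ger0_norm; lra.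
Qed.

Lemma deform0 p : chain (deform 0 p) p 0.
Proof.
have x01 : 0 <= p.2%:num <= 1 by apply/andP.
rewrite /deform /pos !mul0r subr0 addr0 /track_pt /track.
have h : p.2%:num * l' p.1 <= path_sum l' ((p.1, false) :: revp (back (drev (p.1, false)))).
  rewrite path_sum_cons /= -[leLHS]addr0; apply: lerD; last exact: path_sum_ge0.
  by rewrite ler_piMl //; lra.
have h0 : 0 <= p.2%:num * l' p.1 by rewrite mulr_ge0 //; lra.
have := @pt_cat_r R G l' l'_ge0 (p0 (out (dsrc (p.1, false)))) (back (p.1, false))
  ((p.1, false) :: revp (back (drev (p.1, false)))) _ isT (track_follows (p.1, false)) h0 h.
rewrite pt_head; last by rewrite h0 /= ler_piMl //; lra.
move=> c1; suff c2 : chain (dpt l' (p.1, false) (p.2%:num * l' p.1 / l' p.1)) p 0.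
  by have := chain_trans c1 c2; rewrite addr0.
have pE : p = dpt l' (p.1, false) p.2%:num.
  by move: x01; case: (p) => e x x01; congr pair; apply: i01_inj; rewrite clamp01K.
have [l0|l0] := eqVneq (l' p.1) 0; last by rewrite mulfK // -pE; exact: chain_nil.
rewrite [X in chain _ X]pE l0 mulr0 mul0r.
have := chain_dpt l' (p.1, false) (x := 0) (y := p.2%:num); rewrite /= l0 mul0r.
by apply; rewrite ?lexx ?ler01.
Qed.

Lemma len_pair e : new_length (e, false) = l' e + 1 * (phi (e, false) + phi (e, true)).
Proof. by rewrite /new_length /= mul1r addrA. Qed.

Definition final_map (p : mgraph l) : mgraph l' := deform 1 (p : mgraph l').

Variable sigma : R.
Hypothesis sigma_gt0 : 0 < sigma.
Hypothesis len_le : forall d, new_length d <= sigma * l d.1.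

Let i01_01 (x : {i01 R}) : 0 <= x%:num <= 1.
Proof. by apply/andP. Qed.

Lemma final_cts : continuous final_map.
Proof.
move=> p.
apply: (iffRL (@cvg_ballP R (mgraph l') _ (nbhs p) (nbhs_filter p) final_map (final_map p))).
move=> eps eps0; apply/nbhs_ballP; exists (eps / sigma); first by rewrite /= divr_gt0.
move=> q [c pq cs].
have [|e|c' ch hc'] := @deform_lipschitz l 1 sigma p q c _ _ pq; first by rewrite ler01 lexx.
  by rewrite -len_pair; exact: len_le (e, false).
exists c' => //; apply: le_lt_trans hc' _; by rewrite mulrC -ltr_pdivlMr.
Qed.

(** [deform 0 p] and [p] are at distance 0 but may be different names of a vertex,
    whereas a homotopy ends exactly at the identity. *)
Definition deform_homotopy (s : R) (p : realization R G) : mgraph l' :=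
  if s == 1 then p else deform (1 - s) (p : mgraph l').

Lemma deform_homotopyE s p : chain (deform_homotopy s p) (deform (1 - s) (p : mgraph l')) 0.
Proof.
rewrite /deform_homotopy; case: eqP => [->|_]; last exact: chain_nil.
by rewrite subrr; apply: chain_sym; exact: deform0.
Qed.

Lemma final_homotopic : homotopic R (final_map \o collapse l) (collapse l').
Proof.
exists deform_homotopy; split; last 2 first.
- by move=> p; rewrite /deform_homotopy eq_sym oner_eq0 subr0.
- by move=> p; rewrite /deform_homotopy eqxx.
pose P := \sum_d `|phi d|; pose K := \sum_e l' e + 2 * P.
have P0 : 0 <= P by exact: sumr_ge0.
have L0 : 0 <= \sum_e l' e by exact: sumr_ge0.
have K0 : 0 <= K by rewrite addr_ge0 // mulr_ge0.
have phiP d : `|phi d| <= P by rewrite /P (bigD1 d) //= lerDl; exact: sumr_ge0.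
apply/subspace_continuousP => -[s p] /= s01; apply/cvg_ballP => eps eps0.
pose r := eps / (K + P + 1).
have KP : 0 < K + P + 1 by lra.
have r0 : 0 < r by rewrite divr_gt0.
suff : \forall q \near nbhs (s, p), 0 <= q.1 <= 1 ->
  gball (deform_homotopy s p) eps (deform_homotopy q.1 q.2) by [].
apply/nbhs_ballP; exists r => // -[s' q] [/= ss' [c pq cr]] s'01.
have t01 (u : R) : 0 <= u <= 1 -> 0 <= 1 - u <= 1 by move=> ?; lra.
have [c1 ch1 hc1] := deform_time (p : mgraph l') (t01 s s01) (t01 s' s'01).
have [e|c2 ch2 hc2] := @deform_lipschitz (fun=> 1) (1 - s') K p q c (t01 s' s'01) _ pq.
  rewrite mulr1; have h1 := phiP (e, false); have h2 := phiP (e, true).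
  have h3 : l' e <= \sum_e l' e by rewrite (bigD1 e) //= lerDl; exact: sumr_ge0.
  have : (1 - s') * (phi (e, false) + phi (e, true)) <= 2 * P.
    apply: le_trans (ler_norm _) _; rewrite normrM.
    apply: (@le_trans _ _ (1 * `|phi (e, false) + phi (e, true)|)).
      by rewrite ler_wpM2r // ger0_norm; lra.
    rewrite mul1r; apply: le_trans (ler_normD _ _) _; lra.
  by rewrite /K; lra.
exists (0 + (c1 + (c2 + 0))).
  apply: chain_trans (deform_homotopyE s p) _; apply: chain_trans ch1 _.
  by apply: chain_trans ch2 _; apply: chain_sym; exact: deform_homotopyE.
rewrite add0r addr0.
have hr : r * (K + P + 1) = eps by rewrite divfK ?gt_eqF.
have h1 : c1 <= r * P.
  apply: le_trans hc1 _; rewrite ler_wpM2r //.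
  have -> : 1 - s - (1 - s') = - (s - s') by ring.
  by rewrite normrN; exact: ltW.
have h2 : c2 <= K * r by apply: le_trans hc2 _; rewrite ler_wpM2l // ltW.
by move: hr; rewrite mulrDr mulrDr mulr1 (mulrC K) in h2 *; lra.
Qed.

Lemma forest' c : embedded_circle c -> ~~ all (fun e => l' e == 0) (edges c).
Proof.
move=> /forest; apply: contra => /allP h; apply/allP => e /h /eqP h'.
by apply/eqP; exact: l'_eq0.
Qed.

Definition slope e := new_length (e, false) / l e.

(** Tracks have no backtracking, so [pt_isometry] computes the distances. *)
Lemma final_linear : linear_on_edges final_map slope.
Proof.
move=> e le; split; first by rewrite /slope divr_ge0 // ltW.
have [delta fd] := fine_ex l'; have [d0 _] := fd.
set L := new_length (e, false).
have L1 : 0 < L + 1 by have := len_ge0 (e, false); rewrite -/L; lra.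
exists (delta / (L + 1)); first by rewrite divr_gt0.
have key (x y : {i01 R}) : x%:num <= y%:num -> `|x%:num - y%:num| < delta / (L + 1) ->
    gdist (final_map (e, x)) (final_map (e, y)) = L * (y%:num - x%:num).
  move=> xy; rewrite ltr_pdivlMr // => hxy.
  have s1 : 0 <= (1 : R) <= 1 by rewrite ler01 lexx.
  have [a1 a2] := pos_bounds e s1 (i01_01 x); have [b1 b2] := pos_bounds e s1 (i01_01 y).
  have posE : pos 1 e y%:num - pos 1 e x%:num = L * (y%:num - x%:num).
    by rewrite /pos -len_pair -/L; ring.
  have L0 : 0 <= L * (y%:num - x%:num) by rewrite mulr_ge0 ?len_ge0 ?subr_ge0.
  have pp : pos 1 e x%:num <= pos 1 e y%:num by rewrite -subr_ge0 posE.
  have ch := track_chain a1 a2 b1 b2.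
  rewrite distrC ger0_norm ?subr_ge0 // posE in ch.
  apply/eqP; rewrite eq_le (gdist_le l'_ge0 ch) /=.
  apply: lb_le_inf; first by eexists; exact: ch.
  move=> z zc; rewrite -posE.
  apply: (@pt_isometry R G l' l'_ge0 (p0 (out (dsrc (e, false)))) forest' delta fd
    (track (e, false))) => //.
  - exact: track_sorted.
  - exact: track_ne.
  - rewrite posE; apply: le_lt_trans hxy; rewrite distrC ger0_norm ?subr_ge0 //.
    have -> : (y%:num - x%:num) * (L + 1) = L * (y%:num - x%:num) + (y%:num - x%:num) by ring.
    by rewrite lerDl subr_ge0.
move=> x y hxy; rewrite /slope -/L.
have -> : L / l e * (l e * `|x%:num - y%:num|) = L * `|x%:num - y%:num|.
  by rewrite mulrA divfK ?gt_eqF.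
have [h|/ltW h] := leP x%:num y%:num.
  by rewrite key // distrC ger0_norm ?subr_ge0.
have -> : gdist (final_map (e, x)) (final_map (e, y)) = gdist (final_map (e, y)) (final_map (e, x)).
  by rewrite /gdist; congr inf; apply/seteqP; split => z /chain_sym.
rewrite key //; last by rewrite distrC.
by rewrite ger0_norm ?subr_ge0.
Qed.

(** The final map has the new lengths divided by the old ones as slopes. *)
Lemma stretching_map : exists (f : mgraph l -> mgraph l') s,
  [/\ continuous f, homotopic R (f \o collapse l) (collapse l'), linear_on_edges f s &
      max_slope l s <= sigma].
Proof.
exists final_map, slope; split.
- exact: final_cts.
- exact: final_homotopic.
- exact: final_linear.
apply: bigmax_le; first exact: ltW.
by move=> e le; rewrite /slope ler_pdivrMr //; exact: len_le (e, false).
Qed.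

End Rays.

(** * Candidates in a metric graph *)
Section Candidates.
Variables (R : realType) (G : multigraph) (l : edge G -> R).
Hypothesis l_ge0 : forall e, 0 <= l e.
Hypothesis forest : forall c : seq (dart G), embedded_circle c ->
  ~~ all (fun e => l e == 0) (edges c).
Implicit Types (c u v w : seq (dart G)).

Lemma circle_positive_edge c : embedded_circle c -> exists2 e, e \in edges c & 0 < l e.
Proof.
move=> /forest /allPn[e ec le]; exists e => //.
by rewrite lt_neqAle eq_sym le l_ge0.
Qed.

(** The edges of length 0 form a forest, so each circle of a barbell has an edge of
    positive length on which a cut can be placed. *)
Lemma candidate_detects c e : embedded_circle c \/ barbell c -> e \in edges c ->
  detects l c e.
Proof.
case=> [ce ec|[u [v [w [-> _ /andP[cu cv] _ /and3P[_ uc _]]]]] ec].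
  have [tr cnt] := embedded_crossing R ce ec.
  by exists [::]; split => //; rewrite cnt.
have [eu euu lu] := circle_positive_edge cu; have [ev evv lv] := circle_positive_edge cv.
have [S [eS uS SS tr]] := barbell_crossing R uc euu evv ec.
exists S; split => // e' /SS; rewrite !inE => /orP[]/eqP -> //.
Qed.

Lemma circle_length_gt0 c : embedded_circle c -> 0 < path_sum l c.
Proof.
move=> /circle_positive_edge[_ /edgesP[d dc ->] ld].
move: dc; case/splitPr => c1 c2; rewrite path_sum_cat path_sum_cons.
by rewrite ltr_wpDl ?ltr_pwDl // path_sum_ge0.
Qed.

Lemma immersed_length_gt0 c : immersed c -> 0 < path_sum l c.
Proof.
move=> /immersed_has_circle[w [v [b [-> ev]]]]; rewrite !path_sum_cat.
by rewrite ltr_wpDl ?path_sum_ge0 // ltr_pwDl ?path_sum_ge0 // circle_length_gt0.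
Qed.

End Candidates.

Section Essential.
Variables (R : realType) (G : multigraph).
Implicit Types (c : seq (dart G)).

Lemma freely_homotopic_refl (X : topologicalType) (a : R -> X) : is_loop a -> freely_homotopic a a.
Proof.
move=> [ac aper]; exists (fun _ => a); split => //.
apply: continuous_subspaceT => p.
by apply: (@continuous_comp _ _ _ snd a); [exact: cvg_snd|exact: ac].
Qed.

(** The holonomy of a constant loop is the identity, that of [c] is a translation
    of positive length. *)
Lemma loop_essential d0 c : closed_path c -> embedded_circle c \/ barbell c ->
  essential (gloop d0 c : R -> realization R G).
Proof.
move=> cc hc; have [al _] := gloop_traverses R d0 cc; split => // -[p hp].
have l1 : forall e : edge G, (0 : R) <= (fun=> 1) e by move=> e; exact: ler01.
have f1 c' : embedded_circle c' -> ~~ all (fun e : edge G => (1 : R) == 0) (edges c').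
  move=> /and3P[/andP[c0 _] _ _]; rewrite oner_eq0; case: c' c0 => //.
have [d dc] : exists d, d \in c by case/andP: cc; case: (c) => // d c' _ _; exists d; rewrite inE eqxx.
have ec : d.1 \in edges c by apply/edgesP; exists d.
have [S [eS uS S0 tr]] := candidate_detects l1 f1 hc ec.
have [delta fd] := fine_ex (fun _ : edge G => 1 : R).
have [N0 hN0] := homotopy_translation l1 fd ltr01 S0 eS hp.
have n0 := size_closed_gt0 cc.
have [_ ht] := hN0 (size c * (3 + N0))%N ltac:(nia).
have cst x : hol S d.1 (sample (fun=> p) (size c * (3 + N0))) (size c * (3 + N0)) x = x.
  elim: (X in hol _ _ _ X) x => // m IH x /=; rewrite IH /hstep /sample.
  have -> : circ_inc (ecoord d.1 p) (ecoord d.1 p) = 0.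
    by rewrite /circ_inc subrr normr0 invr_ge0 ler0n.
  rewrite addr0 ifF //; rewrite /flips; elim: (S) => //= e S' ->.
  by rewrite addbF /circ_flip subrr normr0 addbb ltNge invr_ge0 ler0n.
have := ht 0 (or_introl (fun x => etrans (cst x) (esym (addr0 x)))).
have M2 : (2 < 3 + N0)%N by lia.
have E x := @hol_loop R G (fun=> 1) d0 c S d.1 (3 + N0) x cc M2 uS eS.
have cnt : 0 < (count_mem d.1 (edges c))%:R :> R.
  by rewrite ltr0n -has_count; apply/hasP; exists d.1 => /=.
move=> h; have {E} := E 0; have t0 : foldr (dmap S d.1) (0 : R) c = (count_mem d.1 (edges c))%:R \/
    foldr (dmap S d.1) (0 : R) c = - (count_mem d.1 (edges c))%:R :> R.
  by case: tr => /(_ 0) h0; [left|right]; rewrite h0; ring.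
by case: h => ->; case: t0 => ->; rewrite ?addr0 ?subr0 => /esym /eqP;
  rewrite ?oppr_eq0 (gt_eqF cnt).
Qed.

Lemma candidate_realized c : immersed c -> embedded_circle c \/ barbell c ->
  exists a : R -> realization R G,
    [/\ candidate_loop a, essential a & immersed_representative a c].
Proof.
move=> ic hc; have cc := immersed_closed ic.
have [d0 _] : exists d0 : dart G, true by case: (c) ic => // d0 *; exists d0.
have tr := gloop_traverses R d0 cc; exists (gloop d0 c); split.
- exists c => //; exists 0%N; rewrite rot0.
  by case: hc => h; [constructor 1|constructor 3].
- exact: loop_essential.
- split => //; exists (gloop d0 c) => //; apply: freely_homotopic_refl; exact: tr.1.
Qed.

End Essential.

(** * The norm *)
Section Norm.
Variables (R : realType) (G : multigraph).
Hypothesis valence_gt2 : forall x : vertex G, (2 < valence x)%N.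
Variable e0 : edge G.
Implicit Types (c : seq (dart G)) (l tau : edge G -> R).

(** A path can always be continued without backtracking, and with a fixed rule for
    the next dart it becomes periodic. *)
Lemma immersed_ex : exists c, immersed c.
Proof.
have /choice[next hn] : forall d : dart G, exists d', nonback d d'.
  move=> d; have [d' [ds dd _]] := third_dart valence_gt2 (drev d) (drev d) (dtgt d).
  by exists d'; rewrite nonbackE ds eqxx.
pose d0 : dart G := (e0, false).
have /trajectP[i io hi] : looping next d0 (order next d0) by exact: looping_order.
set n := order next d0 in io hi; pose y := iter i next d0.
have hy : iter (n - i) next y = y by rewrite /y -iterD subnK ?hi // ltnW.
have ni : (0 < n - i)%N by rewrite subn_gt0.
case: (n - i)%N ni hy => // m _ hy; exists (traject next y m.+1); apply/andP; split => //.
apply: (@sub_cycle _ (frel next)); first by move=> a b /= /eqP <-; exact: hn.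
rewrite /= rcons_path fpath_traject /= last_traject; apply/eqP; exact: hy.
Qed.

(** A finite set of loops, independent of the metric, that suffices to compute the
    norm. *)
Definition short_loops : seq (seq (dart G)) :=
  [seq c <- flatten [seq [seq tval t | t <- enum {: k.-tuple (dart G)}] |
     k <- iota 0 #|{: dart G}|.+1] | immersed c].

Lemma short_loopsP c : immersed c -> (size c <= #|{: dart G}|)%N -> c \in short_loops.
Proof.
move=> ic sc; rewrite mem_filter ic andTb; apply/flatten_mapP.
exists (size c); first by rewrite mem_iota /= add0n ltnS.
by apply/mapP; exists (in_tuple c) => //; rewrite mem_enum.
Qed.

Lemma short_loops_immersed c : c \in short_loops -> immersed c.
Proof. by rewrite mem_filter => /andP[]. Qed.

(** A longer loop repeats a dart and is cut there into two shorter ones. *)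
Lemma nonpos_of_short (f : edge G -> R) :
  (forall c, c \in short_loops -> path_sum f c <= 0) ->
  forall c, immersed c -> path_sum f c <= 0.
Proof.
move=> hf c; elim: {c}(size c).+1 {-2}c (ltnSn (size c)) => // n IH c cn ic.
have [uc|/nuniq_split[d [s1 [s2 [s3 E]]]]] := boolP (uniq c).
  by apply: hf; apply: short_loopsP => //; rewrite -(card_uniqP uc); exact: max_card.
move: ic; rewrite E => /immersed_cut[i1 i2].
have sz1 : (size (d :: s2) < n)%N by move: cn; rewrite E !size_cat /=; lia.
have sz2 : (size (d :: s3 ++ s1) < n)%N.
  by move: cn; rewrite E !size_cat /= !size_cat /=; lia.
have := IH _ sz1 i1; have := IH _ sz2 i2.
by rewrite !(path_sum_cat, path_sum_cons); lra.
Qed.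

Lemma max_ex (T : eqType) (s : seq T) (F : T -> R) : s != [::] ->
  exists2 x, x \in s & forall y, y \in s -> F y <= F x.
Proof.
elim: s => // a s IH _; have [->|s0] := eqVneq s [::].
  by exists a; [rewrite inE|move=> y; rewrite inE => /eqP ->].
have [x xs hx] := IH s0; have [h|/ltW h] := leP (F a) (F x).
  by exists x => [|y]; rewrite inE ?xs ?orbT // => /orP[/eqP ->|/hx].
exists a => [|y]; rewrite inE ?eqxx // => /orP[/eqP -> //|/hx ys]; exact: le_trans ys h.
Qed.

Definition ratio l tau c : R := path_sum tau c / path_sum l c.

Lemma path_sum_lin (a : R) l tau c :
  path_sum (fun e => tau e - a * l e) c = path_sum tau c - a * path_sum l c.
Proof. by rewrite /path_sum big_split /= sumrN mulr_sumr. Qed.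

Lemma path_sum_add l tau c :
  path_sum (fun e => l e + tau e) c = path_sum l c + path_sum tau c.
Proof. by rewrite /path_sum big_split. Qed.

Lemma path_sum_scale (a : R) tau c :
  path_sum (fun e => a * tau e) c = a * path_sum tau c.
Proof. by rewrite /path_sum mulr_sumr. Qed.

Section Metric.
Variable l : edge G -> R.
Hypothesis lm : is_metric l.

Lemma metric_ge0 e : 0 <= l e.
Proof. by have [h _ _] := lm; have /andP[] := h e. Qed.

Lemma metric_forest c : embedded_circle c -> ~~ all (fun e => l e == 0) (edges c).
Proof. by have [_ _ h] := lm; exact: h. Qed.

Lemma metric_gt0 c : immersed c -> 0 < path_sum l c.
Proof. exact: (immersed_length_gt0 metric_ge0 metric_forest). Qed.

Lemma short_max tau : exists c, [/\ c \in short_loops, immersed c &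
  forall c', immersed c' -> ratio l tau c' <= ratio l tau c].
Proof.
have [c0 ic0] := immersed_ex.
have s0 : short_loops != [::].
  apply/eqP => s0; have [c cs] : exists c, c \in short_loops.
    have [//|nex] := pselect (exists c, c \in short_loops).
    have := @nonpos_of_short (fun=> 1) _ c0 ic0.
    have -> : path_sum (fun=> 1) c0 = (size c0)%:R :> R.
      by rewrite /path_sum big_const_seq count_predT iter_addr_0.
    move=> h; have : (size c0)%:R <= 0 :> R by apply: h => c cs; case: nex; exists c.
    by case: (c0) ic0 => //= d c _; rewrite lern0.
  by rewrite s0 in cs.
have [c cs hc] := max_ex (ratio l tau) s0; exists c; split => //.
  exact: short_loops_immersed.
move=> c' ic'; rewrite /ratio ler_pdivrMr ?metric_gt0 // -subr_le0 -path_sum_lin.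
apply: nonpos_of_short ic' => c1 c1s; have ic1 := short_loops_immersed c1s.
by rewrite path_sum_lin subr_le0 -ler_pdivrMr ?metric_gt0 //; exact: hc.
Qed.

Lemma ratio_max_nonpos tau c : (forall c', immersed c' -> ratio l tau c' <= ratio l tau c) ->
  forall c', immersed c' -> path_sum (fun e => tau e - ratio l tau c * l e) c' <= 0.
Proof.
by move=> h c' ic'; rewrite path_sum_lin subr_le0 -ler_pdivrMr ?metric_gt0 //; exact: h.
Qed.

Lemma candidate_max tau : exists c, [/\ immersed c, embedded_circle c \/ barbell c &
  forall c', immersed c' -> ratio l tau c' <= ratio l tau c].
Proof.
have [c [_ ic hc]] := short_max tau.
have [|a [ia fa ca]] := extremal_candidate (ratio_max_nonpos hc) ic.
  by rewrite path_sum_lin /ratio divfK ?subrr // gt_eqF ?metric_gt0.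
exists a; split => // c' ic'; suff -> : ratio l tau a = ratio l tau c by exact: hc.
rewrite {1}/ratio; move: fa; rewrite path_sum_lin => /subr0_eq ->.
by rewrite mulfK // gt_eqF ?metric_gt0.
Qed.

Lemma norm_max tau c : immersed c -> embedded_circle c \/ barbell c ->
  (forall c', immersed c' -> ratio l tau c' <= ratio l tau c) ->
  norm_L l tau = ratio l tau c.
Proof.
move=> ic hc hmax; have [a [_ ea ra]] := candidate_realized R ic hc.
have mem : loop_ratios l tau (ratio l tau c) by exists a, c.
have ub : ubound (loop_ratios l tau) (ratio l tau c).
  by move=> _ [b [c' [_ [ic' _] ->]]]; exact: hmax.
apply/eqP; rewrite eq_le; apply/andP; split.
  by apply: ge_sup => //; exists (ratio l tau c).
by apply: ub_le_sup => //; exists (ratio l tau c).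
Qed.

Lemma norm_spec tau : exists c, [/\ immersed c, embedded_circle c \/ barbell c,
  norm_L l tau = ratio l tau c & forall c', immersed c' -> ratio l tau c' <= norm_L l tau].
Proof.
have [c [ic hc hmax]] := candidate_max tau.
by exists c; rewrite (norm_max ic hc hmax).
Qed.

Lemma norm_short tau : exists2 c, c \in short_loops & norm_L l tau = ratio l tau c.
Proof.
have [c [ic _ E h]] := norm_spec tau; have [c' [cs ic' h']] := short_max tau.
by exists c' => //; apply/eqP; rewrite eq_le h // andbT E h'.
Qed.

Lemma norm_add tau1 tau2 :
  norm_L l (fun e => tau1 e + tau2 e) <= norm_L l tau1 + norm_L l tau2.
Proof.
have [c [ic _ -> _]] := norm_spec (fun e => tau1 e + tau2 e).
have [_ [_ _ _ h1]] := norm_spec tau1; have [_ [_ _ _ h2]] := norm_spec tau2.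
by rewrite /ratio path_sum_add mulrDl lerD // -/(ratio l _ c) ?h1 ?h2.
Qed.

Lemma norm_scale_le (a : R) tau : 0 < a ->
  norm_L l (fun e => a * tau e) <= a * norm_L l tau.
Proof.
move=> a0; have [c [ic _ -> _]] := norm_spec (fun e => a * tau e).
have [_ [_ _ _ h]] := norm_spec tau.
by rewrite /ratio path_sum_scale -mulrA ler_pM2l // h.
Qed.

Lemma norm_scale (a : R) tau : 0 < a ->
  norm_L l (fun e => a * tau e) = a * norm_L l tau.
Proof.
move=> a0; apply/eqP; rewrite eq_le norm_scale_le //=.
have ai : 0 < a^-1 by rewrite invr_gt0.
have := norm_scale_le (fun e => a * tau e) ai.
have -> : (fun e => a^-1 * (a * tau e)) = tau.
  by apply/funext => e; rewrite mulrA mulVf ?mul1r ?gt_eqF.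
by rewrite -(ler_pM2l a0) mulrA mulfV ?mul1r ?gt_eqF.
Qed.

Lemma norm_excess tau c : immersed c ->
  path_sum (fun e => tau e - norm_L l tau * l e) c <= 0.
Proof.
have [_ [_ _ _ h]] := norm_spec tau; move=> /[dup] ic /h.
by rewrite path_sum_lin subr_le0 -ler_pdivrMr ?metric_gt0.
Qed.

End Metric.

(** The potential of [tau - lambda l] satisfies the bound of [total_sum], where the
    total sum is [lambda], the sum of [l] being 1 and that of [tau] being 0. *)
Lemma norm_ge0 l tau : is_metric l -> \sum_e tau e = 0 ->
  0 <= norm_L l tau /\ (norm_L l tau = 0 -> forall e, tau e = 0).
Proof.
move=> lm t0; pose f e := tau e - norm_L l tau * l e.
have f_le0 c : immersed c -> path_sum f c <= 0 by exact: norm_excess.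
have [h1 h2] := potential_feasible f_le0.
have sumE : \sum_d potential f d = norm_L l tau.
  rewrite sum_darts (eq_bigr (fun e => - f e)) => [|e _]; last exact: potential_edge.
  have [_ l1 _] := lm.
  by rewrite sumrN big_split /= sumrN -mulr_sumr l1 t0 mulr1 add0r opprK.
have bound d : `|potential f d| <= norm_L l tau by rewrite -sumE; exact: total_sum.
split; first exact: le_trans (normr_ge0 _) (bound (e0, false)).
move=> n0 e; have p0 d : potential f d = 0.
  by apply/eqP; rewrite -normr_eq0 eq_le normr_ge0 andbT -n0.
have := potential_edge f (e, false); rewrite !p0 addr0 /f n0 mul0r subr0 /= => /esym/eqP.
by rewrite oppr_eq0 => /eqP.
Qed.

Local Notation T := {ptws edge G -> R}.

Lemma path_sum_cts c : continuous (fun l : T => path_sum l c).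
Proof.
apply: (@sum_cts R T _ c (fun d (l : T) => l d.1)) => d.
exact: (@proj_continuous _ (fun _ : edge G => R) d.1).
Qed.

Lemma ratio_cts c (p : T * T) : path_sum p.1 c != 0 ->
  (fun q : T * T => ratio q.1 q.2 c) @ p --> ratio p.1 p.2 c.
Proof.
move=> p0.
have num : (fun q : T * T => path_sum q.2 c) @ p --> path_sum p.2 c.
  apply: (@continuous_comp _ _ _ snd (fun l : T => path_sum l c)); first exact: cvg_snd.
  exact: path_sum_cts.
have den : (fun q : T * T => path_sum q.1 c) @ p --> path_sum p.1 c.
  apply: (@continuous_comp _ _ _ fst (fun l : T => path_sum l c)); first exact: cvg_fst.
  exact: path_sum_cts.
exact: (cvgM num (cvgV p0 den)).
Qed.

Lemma near_all (X : eqType) (F : set_system (T * T)) (FF : Filter F) (s : seq X)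
    (P : X -> T * T -> Prop) :
  (forall x, x \in s -> \forall q \near F, P x q) ->
  \forall q \near F, forall x, x \in s -> P x q.
Proof.
elim: s => [|a s IH] h; first by apply: filterE.
have h1 := h a (mem_head _ _).
have h2 : \forall q \near F, forall x, x \in s -> P x q.
  by apply: IH => x xs; apply: h; rewrite inE xs orbT.
by apply: filterS2 h1 h2 => q pa ps x; rewrite inE => /orP[/eqP ->|/ps].
Qed.

(** The norm is the maximum of the ratios of the loops in [short_loops], which do
    not depend on the point. *)
Lemma norm_cts : {within [set p : T * T | is_metric p.1 /\ is_tangent p.2],
  continuous (fun p : T * T => norm_L p.1 p.2)}.
Proof.
apply/subspace_continuousP => p [/= pm _]; apply/cvgrPdist_lt => eps eps0.
rewrite near_withinE.
have H : \forall q \near p, forall c, c \in short_loops ->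
    `|ratio p.1 p.2 c - ratio q.1 q.2 c| < eps.
  apply: (@near_all _ (nbhs p) _ short_loops
    (fun c q => `|ratio p.1 p.2 c - ratio q.1 q.2 c| < eps)) => c cs; have pc := metric_gt0 pm (short_loops_immersed cs).
  by have /cvgrPdist_lt := @ratio_cts c p ltac:(by rewrite gt_eqF); exact.
apply: filterS H => q hq [/= qm _].
have [c1 s1 E1] := norm_short pm p.2; have [c2 s2 E2] := norm_short qm q.2.
have [_ [_ _ _ m1]] := norm_spec pm p.2; have [_ [_ _ _ m2]] := norm_spec qm q.2.
have := hq _ s1; have := hq _ s2; rewrite !ltr_distl -E1 -E2.
rewrite /from_subspace.
have := m1 _ (short_loops_immersed s2); have := m2 _ (short_loops_immersed s1); lra.
Qed.

(** * The distance for small times *)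
Section ShortTime.
Variables l tau : edge G -> R.
Hypothesis lm : is_metric l.
Hypothesis tau0 : is_tangent tau.
Hypothesis tau_int : integrable_vector l tau.
Local Notation lambda := (norm_L l tau).
Local Notation f := (fun e => tau e - lambda * l e).

Lemma integrable_zero e : l e = 0 -> 0 <= tau e.
Proof. by move=> l0; rewrite leNgt; apply/negP => /tau_int; rewrite l0 ltxx. Qed.

Lemma lower_bound t (l' := fun e => l e + t * tau e) sigma : 0 < t ->
  (forall e, 0 <= l' e) -> (forall e, l' e = 0 -> l e = 0) ->
  lipschitz_constants l l' sigma -> 1 + t * lambda <= sigma.
Proof.
move=> t0 l'_ge0 l'_eq0 [g [s [gc gh gl ->]]].
have [c [ic hc E _]] := norm_spec lm tau; have pc := metric_gt0 lm ic.
have forest' c' : embedded_circle c' -> ~~ all (fun e => l' e == 0) (edges c').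
  move=> /(metric_forest lm); apply: contra => /allP h; apply/allP => e /h /eqP /l'_eq0 ->.
  exact: eqxx.
have := @candidate_stretch R G l l' (metric_ge0 lm) l'_ge0 g s (e0, false) c gc gh gl
  (immersed_closed ic) (fun e ec _ => candidate_detects l'_ge0 forest' hc ec).
rewrite path_sum_add path_sum_scale.
have -> : path_sum tau c = lambda * path_sum l c by rewrite E /ratio divfK // gt_eqF.
by rewrite mulrA -{1}[path_sum l c]mul1r -mulrDl ler_pM2r.
Qed.

(** An end that moves into the edge saturates it.  If none does, both values of
    [phi] and [tau] are nonnegative with a nonpositive sum. *)
Lemma zero_edge phi d : minimal f phi -> l d.1 = 0 -> tau d.1 + phi d + phi (drev d) = 0.
Proof.
move=> pm l0; have [[h1 _] _] := pm; have h := h1 d; have t0 := integrable_zero l0.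
rewrite l0 mulr0 subr0 in h.
have [p1|p1] := ltP (phi d) 0.
  by have := minimal_saturated valence_gt2 pm p1; rewrite l0 mulr0 subr0; lra.
have [p2|p2] := ltP (phi (drev d)) 0; last by move: h t0 p1 p2; lra.
by have := minimal_saturated valence_gt2 pm p2; rewrite drevK l0 mulr0 subr0; lra.
Qed.

(** The same function [phi], multiplied by [t], serves for all small [t]. *)
Lemma distance_short_time : exists2 t0, 0 < t0 & forall t, 0 < t -> t < t0 ->
  lipschitz_distance l (fun e => l e + t * tau e) = ln (1 + t * lambda).
Proof.
have l0 := metric_ge0 lm; have [lambda0 _] := norm_ge0 lm tau0.
have [phi pm] : exists phi, minimal f phi.
  by apply: (minimal_potential valence_gt2) => c ic; exact: norm_excess.
have [[feas _] _] := pm.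
have [delta [d0 hd]] := fine_ex l.
pose C := \sum_e `|tau e| + \sum_d `|phi d|.
have C_tau e : `|tau e| <= C.
  by rewrite /C (bigD1 e) //= -addrA lerDl addr_ge0 ?sumr_ge0.
have C_phi d : `|phi d| <= C.
  by rewrite /C [X in _ + X](bigD1 d) //= addrCA lerDl addr_ge0 ?sumr_ge0.
have C0 : 0 <= C := le_trans (normr_ge0 _) (C_tau e0).
(* [C] bounds all speeds: before this time every length and every vertex moves by
   less than [delta]. *)
exists (delta / (C + 1)); first by rewrite divr_gt0 // ltr_wpDl.
move=> t t0; rewrite ltr_pdivlMr; last by rewrite ltr_wpDl.
move=> tC; set l' := fun e => _.
have tau_small e : `|t * tau e| < delta.
  rewrite normrM gtr0_norm //; apply: le_lt_trans tC; rewrite ler_pM2l //.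
  by have := C_tau e; lra.
have phi_small d : `|t * phi d| < delta.
  rewrite normrM gtr0_norm //; apply: le_lt_trans tC; rewrite ler_pM2l //.
  by have := C_phi d; lra.
have l_cases e : l e = 0 \/ 16 * delta <= l e.
  by have := l0 e; rewrite le_eqVlt => /orP[/eqP <-|/hd]; [left|right].
have l'_ge0 e : 0 <= l' e.
  rewrite /l'; case: (l_cases e) => h; first by rewrite h add0r mulr_ge0 ?integrable_zero ?ltW.
  by have := tau_small e; rewrite ltr_norml; lra.
have l'_eq0 e : l' e = 0 -> l e = 0.
  rewrite /l'; case: (l_cases e) => // h.
  by have := tau_small e; rewrite ltr_norml; lra.
have sigma0 : 0 < 1 + t * lambda by rewrite ltr_wpDr // mulr_ge0 // ltW.
have lenE d : new_length l' (fun d => t * phi d) d = l d.1 + t * (tau d.1 + phi d + phi (drev d)).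
  by rewrite /new_length /l'; ring.
have len0 d : l d.1 = 0 -> new_length l' (fun d => t * phi d) d = 0.
  by move=> ld; rewrite lenE zero_edge // ld mulr0 addr0.
have /choice[out outP] : forall x, exists d : dart G, dsrc d = x.
  by move=> x; have [d [dx _ _]] := third_dart valence_gt2 (e0, false) (e0, false) x; exists d.
have [|||||g [s [gc gh gl gs]]] := @stretching_map R G l l' (fun d => t * phi d) l0 l'_ge0 l'_eq0
  (metric_forest lm) _ _ _ len0 _ out outP _ sigma0.
- move=> d d'; rewrite (pmulr_rlt0 _ t0) -mulrN => p1 p2 p3; congr (_ * _).
  exact: (minimal_opp valence_gt2 pm).
- move=> d h; rewrite (minimal_zero valence_gt2 pm) ?mulr0 // => d' /h.
  by rewrite (pmulr_rge0 _ t0).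
- move=> d; case: (l_cases d.1) => h; first by rewrite len0.
  have := tau_small d.1; have := phi_small d; have := phi_small (drev d).
  by rewrite lenE !mulrDr !ltr_norml; lra.
- move=> d ld; case: (l_cases d.1) => h; first by rewrite h ltxx in ld.
  by have := tau_small d.1; have := phi_small d; rewrite /l' !ltr_norml; lra.
- move=> d; rewrite lenE mulrDl mul1r lerD2l -mulrA ler_pM2l //.
  by have := feas d; lra.
have low sigma : lipschitz_constants l l' sigma -> 1 + t * lambda <= sigma.
  exact: lower_bound.
have mem : lipschitz_constants l l' (1 + t * lambda).
  exists g, s; split => //; apply/eqP; rewrite eq_le gs andbT; apply: low.
  by exists g, s.
apply/eqP; rewrite eq_le; apply/andP; split.
  apply: ge_inf; last by exists (1 + t * lambda).
  exists (ln (1 + t * lambda)) => _ [sigma /low h <-]; rewrite ler_ln // posrE //.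
  exact: lt_le_trans h.
apply: lb_le_inf; first by exists (ln (1 + t * lambda)), (1 + t * lambda).
move=> _ [sigma /low h <-]; rewrite ler_ln // posrE //.
exact: lt_le_trans h.
Qed.

Lemma ln1_bounds (x : R) : 0 <= x -> x - x ^+ 2 <= ln (1 + x) <= x.
Proof.
move=> x0; rewrite le_ln1Dx ?andbT; last lra.
have x1 : 0 < 1 + x by lra.
have := @le_ln1Dx _ ((1 + x)^-1 - 1).
have -> : 1 + ((1 + x)^-1 - 1) = (1 + x)^-1 by ring.
rewrite lnV ?posrE // => h.
have i0 : 0 < (1 + x)^-1 by rewrite invr_gt0.
have {}h := h ltac:(lra).
have : x ^+ 2 + (1 - x) - (1 + x)^-1 >= 0.
  have -> : x ^+ 2 + (1 - x) - (1 + x)^-1 = x ^+ 3 / (1 + x) by field; lra.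
  by rewrite divr_ge0 ?exprn_ge0 // ltW.
lra.
Qed.

Lemma distance_derivative :
  lipschitz_distance l (fun e => l e + t * tau e) / t @[t --> 0^'+] --> lambda.
Proof.
have [lambda0 _] := norm_ge0 lm tau0; have [t0 t0_gt0 ht] := distance_short_time.
apply/cvgrPdist_lt => eps eps0; near=> t.
have t_gt0 : 0 < t by near: t; exact: nbhs_right_gt.
have tt0 : t < t0 by near: t; exact: nbhs_right_lt.
have te : t < eps / (lambda ^+ 2 + 1).
  by near: t; apply: nbhs_right_lt; rewrite divr_gt0 // ltr_wpDl // exprn_ge0.
rewrite ltr_pdivlMr in te; last by rewrite ltr_wpDl // exprn_ge0.
have /ln1_bounds/andP[h1 h2] : 0 <= t * lambda by rewrite mulr_ge0 // ltW.
rewrite ht //; apply: (@le_lt_trans _ _ (t * lambda ^+ 2)); last lra.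
rewrite distrC ler_distl ler_pdivrMr // ler_pdivlMr // !mulrDl !mulNr.
by apply/andP; split; nra.
Unshelve. all: by end_near.
Qed.

End ShortTime.
End Norm.

Theorem proposition8 (R : realType) (n : nat) (G : multigraph)
    (m : realization R (rose n) -> realization R G)
    (hn : (2 <= n)%N) (hG : is_graph G) (hrank : rank G = n)
    (hm : marking m) :
  (* (1) *)
  (forall l tau : edge G -> R,
     is_metric l -> is_tangent tau -> integrable_vector l tau ->
     lipschitz_distance l (fun e => l e + t * tau e) / t @[t --> 0^'+]
       --> norm_L l tau) /\
  (* (2) *)
  (forall l tau : edge G -> R, is_metric l -> is_tangent tau ->
     ubound (loop_ratios l tau) (norm_L l tau) /\
     exists (a : R -> realization R G) (c : seq (dart G)),
       [/\ candidate_loop a, essential a, immersed_representative a c &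
           norm_L l tau = path_sum tau c / path_sum l c]) /\
  (* (3) *)
  {within [set p : {ptws edge G -> R} * {ptws edge G -> R} |
             is_metric p.1 /\ is_tangent p.2],
     continuous (fun p : {ptws edge G -> R} * {ptws edge G -> R} =>
                   norm_L p.1 p.2)} /\
  (* (4) *)
  (forall l tau : edge G -> R, is_metric l -> is_tangent tau ->
     0 <= norm_L l tau /\ (norm_L l tau = 0 -> forall e, tau e = 0)) /\
  (* (5) *)
  (forall l tau1 tau2 : edge G -> R,
     is_metric l -> is_tangent tau1 -> is_tangent tau2 ->
     norm_L l (fun e => tau1 e + tau2 e) <= norm_L l tau1 + norm_L l tau2) /\
  (* (6) *)
  (forall (l tau : edge G -> R) (c : R),
     is_metric l -> is_tangent tau -> 0 < c ->
     norm_L l (fun e => c * tau e) = c * norm_L l tau).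
Proof.
have [_ val] := hG.
have [e0 _] : exists e0 : edge G, true.
  have [e _|h] := pickP (@predT (edge G)); first by exists e.
  by move: hrank; rewrite /rank (eq_card0 h); lia.
split; first by move=> l tau lm tt ti; exact: distance_derivative.
split.
  move=> l tau lm _; have [c [ic hc E h]] := norm_spec val e0 lm tau.
  split; first by move=> _ [a [c' [_ [ic' _] ->]]]; exact: h.
  by have [a [ca ea ra]] := candidate_realized R ic hc; exists a, c.
split; first exact: norm_cts.
split; first by move=> l tau lm tt; exact: norm_ge0.
split; first by move=> l tau1 tau2 lm _ _; exact: norm_add.
by move=> l tau a lm _ a0; exact: norm_scale.
Qed.
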